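(* Let $\Sigma$ be either $\mathbb{C}$ or the open unit disk $\mathbb{D}$, and let $u:\Sigma\to\mathbb{R}$ be a harmonic function; assume $u$ is non-constant in case $\Sigma=\mathbb{D}$. Then there exists a complete conformal minimal immersion $Y=(Y_1,Y_2,Y_3):\Sigma\to\mathbb{R}^3$ such that $Y_3=u$.
   Context: A conformal minimal immersion is a conformal immersion with harmonic coordinate functions; it is complete if the metric it induces on $\Sigma$ is complete (every divergent curve has infinite induced length). *)

(* Defs.v *)
(* Sigma is modelled as a domain in R^2 = C,
   points written (x, y) <-> x + i y. *)
From Stdlib Require Import Reals Lra List.
From Coquelicot Require Import Coquelicot.
Open Scope R_scope.

Inductive surface := PlaneC | DiskD.

Definition dom (S : surface) : R -> R -> Prop :=
  match S with
  | PlaneC => fun _ _ => True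
  | DiskD => fun x y => x ^ 2 + y ^ 2 < 1
  end.

Definition dx (f : R -> R -> R) (x y : R) : R := Derive (fun t => f t y) x.
Definition dy (f : R -> R -> R) (x y : R) : R := Derive (fun t => f x t) y.

Definition cont2 (f : R -> R -> R) (x y : R) : Prop :=
  continuous (fun p : R * R => f (fst p) (snd p)) (x, y).

Definition C1_on (Om : R -> R -> Prop) (f : R -> R -> R) : Prop :=
  forall x y, Om x y ->
    cont2 f x y /\
    ex_derive (fun t => f t y) x /\ ex_derive (fun t => f x t) y /\
    cont2 (dx f) x y /\ cont2 (dy f) x y.

Definition C2_on (Om : R -> R -> Prop) (f : R -> R -> R) : Prop :=
  C1_on Om f /\ C1_on Om (dx f) /\ C1_on Om (dy f).

Definition harmonic (Om : R -> R -> Prop) (f : R -> R -> R) : Prop :=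
  C2_on Om f /\ forall x y, Om x y -> dx (dx f) x y + dy (dy f) x y = 0.

(* Conformal minimal immersion Y = (Y1,Y2,Y3): harmonic coordinates,
   conformal (|Y_x| = |Y_y|, Y_x . Y_y = 0) and immersive (Y_x <> 0). *)
Definition conformal_minimal_immersion (Om : R -> R -> Prop)
    (Y1 Y2 Y3 : R -> R -> R) : Prop :=
  harmonic Om Y1 /\ harmonic Om Y2 /\ harmonic Om Y3 /\
  forall x y, Om x y ->
    let a1 := dx Y1 x y in let a2 := dx Y2 x y in let a3 := dx Y3 x y in
    let b1 := dy Y1 x y in let b2 := dy Y2 x y in let b3 := dy Y3 x y in
    a1 ^ 2 + a2 ^ 2 + a3 ^ 2 = b1 ^ 2 + b2 ^ 2 + b3 ^ 2 /\
    a1 * b1 + a2 * b2 + a3 * b3 = 0 /\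
    0 < a1 ^ 2 + a2 ^ 2 + a3 ^ 2.

Definition compact2 (K : R -> R -> Prop) : Prop :=
  forall s : nat -> R * R, (forall n, K (fst (s n)) (snd (s n))) ->
    exists (phi : nat -> nat) (p : R * R),
      (forall n, (phi n < phi (S n))%nat) /\ K (fst p) (snd p) /\
      filterlim (fun n => s (phi n)) eventually (locally p).

Definition divergent_curve (Om : R -> R -> Prop) (g : R -> R * R) : Prop :=
  (forall t, 0 <= t < 1 -> continuous g t /\ Om (fst (g t)) (snd (g t))) /\
  (forall K, compact2 K -> (forall x y, K x y -> Om x y) ->
     exists t0, t0 < 1 /\ forall t, t0 <= t < 1 -> ~ K (fst (g t)) (snd (g t))).

Definition dist3 (a b : R * R * R) : R :=
  let '(a1, a2, a3) := a in let '(b1, b2, b3) := b in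
  sqrt ((a1 - b1) ^ 2 + (a2 - b2) ^ 2 + (a3 - b3) ^ 2).

Fixpoint poly_len (c : R -> R * R * R) (t0 : R) (l : list R) : R :=
  match l with
  | nil => 0
  | t :: l' => dist3 (c t0) (c t) + poly_len c t l'
  end.

Fixpoint increasing_from (t0 : R) (l : list R) : Prop :=
  match l with
  | nil => True
  | t :: l' => t0 < t /\ increasing_from t l'
  end.

Definition infinite_length (c : R -> R * R * R) : Prop :=
  forall M : R, exists (t0 : R) (l : list R),
    0 <= t0 /\ increasing_from t0 l /\ List.Forall (fun t => t < 1) l /\
    M < poly_len c t0 l.

Definition complete_immersion (Om : R -> R -> Prop)
    (Y1 Y2 Y3 : R -> R -> R) : Prop :=
  forall g : R -> R * R, divergent_curve Om g ->
    infinite_length (fun t => (Y1 (fst (g t)) (snd (g t)),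
                               Y2 (fst (g t)) (snd (g t)),
                               Y3 (fst (g t)) (snd (g t)))).

(* Main.v *)
(* Let h = u_x - i u_y, a holomorphic function. For a holomorphic F put e = exp F and g = h^2 exp (-F), so that e g = h^2. Then phi = ((e - g) / 2, i (e + g) / 2, h) satisfies phi . phi = 0, and Y = Re (int phi dz) is a conformal minimal immersion with third coordinate u and conformal factor (|e| + |g|) / 2, which is at least |exp F| / 2 and at least |h|.

On the plane F = 0 already gives a complete metric. On the disk h is not identically zero, so by Blaschke's argument its zeros do not accumulate inside the disk, and there are annuli, arbitrarily close to the boundary, on which |h| >= m > 0. Each of these annuli contains many concentric walls {a <= |z| <= b, +-Re z <= 1/8} with openings on alternating sides. By Runge's theorem (pushing poles to infinity through the opening) F can be built as a series of polynomials with Re F huge on all the walls. A curve that crosses such an annulus either crosses a wall, which is long because of |exp F|, or runs through all the openings, which is long because |h| >= m. *)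

(* A wall cannot be a full ring. If Re F were huge on a whole circle, the maximum principle for - Re
   F would make it huge inside too, whereas each correction must stay small on the disk already
   treated. Hence the openings, and hence the need for |h| to make the detour through them
   expensive. The number of walls can be fixed only after m is known, and the size of Re F only
   after the thickness of the walls. Each annulus is made to contribute length at least 1.

   Two encodings carry the complex analysis. A holomorphic function comes with a continuous
   derivative, so that primitives and the mean value property reduce to differentiation under a real
   integral. A polynomial comes with its divided difference and both are estimated together; a
   locally uniform limit of such pairs is differentiable, with derivative the diagonal of the
   limiting divided difference.

   Curves are only continuous, so lengths are bounded below by inscribed polygons, and the bounds
   are propagated along the parameter interval instead of integrating the conformal factor. *)
Require Import Defs.
From Stdlib Require Import Reals Lra Lia List Wf_nat Classical ClassicalEpsilon.
From Coquelicot Require Import Coquelicot.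
Open Scope R_scope.

(** * Complex continuity and differentiability *)


(* Equalities in [C] typed through the canonical structures escape [ring] and [field]. *)
Ltac ceq := match goal with |- ?a = ?b => change (@eq C a b) end.

Lemma Ceta (z : C) : z = (fst z, snd z).
Proof. now destruct z. Qed.

Lemma Ceq (z w : C) : fst z = fst w -> snd z = snd w -> z = w.
Proof. destruct z, w; simpl; intros; now subst. Qed.

Lemma im_le_Cmod (z : C) : Rabs (Im z) <= Cmod z.
Proof.
  eapply Rle_trans; [|apply Rmax_Cmod]. apply Rmax_r.
Qed.

Lemma Cmod_sqr (z : C) : Cmod z ^ 2 = fst z ^ 2 + snd z ^ 2.
Proof. apply Cmod2_alt. Qed.

Lemma Cmod_triangle_inv (z w : C) : Cmod z - Cmod w <= Cmod (z - w).
Proof.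
  pose proof (Cmod_triangle (z - w) w) as H.
  replace (z - w + w)%C with z in H by ring. lra.
Qed.

Lemma Cmod_minus_sym (z w : C) : Cmod (z - w) = Cmod (w - z).
Proof. rewrite <- Cmod_opp. f_equal. ring. Qed.

Lemma Cmod_lt_sum (z : C) : Cmod z <= Rabs (fst z) + Rabs (snd z).
Proof.
  assert (H : z = (RtoC (fst z) + Ci * RtoC (snd z))%C)
    by (apply Ceq; simpl; ring).
  rewrite H at 1. eapply Rle_trans; [apply Cmod_triangle|].
  rewrite Cmod_mult, Cmod_Ci, !Cmod_R. lra.
Qed.

Definition ccont {T : UniformSpace} (f : T -> C) (p : T) : Prop :=
  @continuous T C_UniformSpace f p.

Section ContinuityC.
Context {T : UniformSpace}.
Implicit Types (f g : T -> C) (p : T).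

Lemma ccont_re f p : ccont f p -> continuous (fun x => fst (f x)) p.
Proof.
  intros H. apply (continuous_comp f fst p H).
  rewrite (Ceta (f p)). apply continuous_fst.
Qed.

Lemma ccont_im f p : ccont f p -> continuous (fun x => snd (f x)) p.
Proof.
  intros H. apply (continuous_comp f snd p H).
  rewrite (Ceta (f p)). apply continuous_snd.
Qed.

Lemma ccont_pair (a b : T -> R) p :
  continuous a p -> continuous b p -> ccont (fun x => (a x, b x)) p.
Proof.
  intros Ha Hb. apply (continuous_comp_2 a b (fun u v => (u, v)) p Ha Hb).
  apply continuous_ext with (f := fun x => x).
  - now intros [u v].
  - apply continuous_id.
Qed.

Lemma ccont_ext f g p : (forall x, f x = g x) -> ccont f p -> ccont g p.
Proof. apply continuous_ext. Qed.

Lemma ccont_const (c : C) p : ccont (fun _ : T => c) p.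
Proof. apply continuous_const. Qed.

Lemma ccont_plus f g p : ccont f p -> ccont g p -> ccont (fun x => f x + g x)%C p.
Proof.
  intros Hf Hg. apply ccont_pair; apply (continuous_plus (V := R_NormedModule)).
  all: auto using ccont_re, ccont_im.
Qed.

Lemma ccont_mult f g p : ccont f p -> ccont g p -> ccont (fun x => f x * g x)%C p.
Proof.
  intros Hf Hg. apply ccont_pair.
  - apply (continuous_minus (V := R_NormedModule));
    apply (continuous_mult (K := R_AbsRing)); auto using ccont_re, ccont_im.
  - apply (continuous_plus (V := R_NormedModule));
    apply (continuous_mult (K := R_AbsRing)); auto using ccont_re, ccont_im.
Qed.

Lemma ccont_opp f p : ccont f p -> ccont (fun x => - f x)%C p.
Proof.
  intros Hf. apply ccont_ext with (f := fun x => (RtoC (-1) * f x)%C).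
  - intros x. apply Ceq; simpl; ring.
  - apply ccont_mult; auto using ccont_const.
Qed.

Lemma ccont_minus f g p : ccont f p -> ccont g p -> ccont (fun x => f x - g x)%C p.
Proof. intros Hf Hg. apply ccont_plus; auto using ccont_opp. Qed.

Lemma ccont_Cmod f p : ccont f p -> continuous (fun x => Cmod (f x)) p.
Proof.
  intros Hf. unfold Cmod.
  apply (continuous_comp (fun x => fst (f x) ^ 2 + snd (f x) ^ 2) sqrt).
  - apply (continuous_plus (V := R_NormedModule)).
    + apply continuous_ext with (f := fun x => fst (f x) * fst (f x)).
      * intros x. simpl. ring.
      * apply (continuous_mult (K := R_AbsRing)); auto using ccont_re.
    + apply continuous_ext with (f := fun x => snd (f x) * snd (f x)).
      * intros x. simpl. ring.
      * apply (continuous_mult (K := R_AbsRing)); auto using ccont_im.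
  - apply continuous_sqrt.
Qed.

Lemma ccont_inv f p : ccont f p -> f p <> 0%C -> ccont (fun x => / f x)%C p.
Proof.
  intros Hf H0.
  assert (Hn : continuous (fun x => / (fst (f x) ^ 2 + snd (f x) ^ 2)) p).
  { apply (continuous_comp (fun x => fst (f x) ^ 2 + snd (f x) ^ 2) Rinv).
    - apply continuous_ext with (f := fun x => Cmod (f x) * Cmod (f x)).
      + intros x. rewrite <- Cmod_sqr. simpl. ring.
      + apply (continuous_mult (K := R_AbsRing)); auto using ccont_Cmod.
    - apply continuous_Rinv. rewrite <- Cmod_sqr.
      apply Cmod_gt_0 in H0. apply pow_nonzero. lra. }
  apply ccont_pair; unfold Rdiv.
  - apply (continuous_mult (K := R_AbsRing)); auto using ccont_re.
  - apply (continuous_mult (K := R_AbsRing)); auto.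
    apply (continuous_opp (V := R_NormedModule)). now apply ccont_im.
Qed.

End ContinuityC.

Lemma ccont_id (p : C) : ccont (fun z : C => z) p.
Proof. apply continuous_id. Qed.

Lemma ccont_comp {T : UniformSpace} (f : T -> C) (g : C -> C) (p : T) :
  ccont f p -> ccont g (f p) -> ccont (fun x => g (f x)) p.
Proof. intros Hf Hg. now apply (continuous_comp f g). Qed.

Lemma ball_Cmod (z w : C) (e : R) : Cmod (w - z) < e -> @ball C_UniformSpace z e w.
Proof. intros H. now apply C_NormedModule_mixin_compat1. Qed.

Lemma Cmod_ball (z w : C) (e : posreal) :
  @ball C_UniformSpace z e w -> Cmod (w - z) < 2 * e.
Proof.
  intros [H1 H2].
  eapply Rle_lt_trans; [apply Cmod_lt_sum|].
  apply Rlt_le_trans with (e + e); [|lra].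
  apply Rplus_lt_compat; [exact H1|exact H2].
Qed.

Lemma locally_Cmod (z : C) (P : C -> Prop) :
  @locally C_UniformSpace z P <->
  exists d : R, 0 < d /\ forall w, Cmod (w - z) < d -> P w.
Proof.
  split.
  - intros [d Hd]. exists d. split; [apply cond_pos|].
    intros w Hw. apply Hd. now apply ball_Cmod.
  - intros [d [Hd H]].
    assert (Hd2 : 0 < d / 2) by lra.
    exists (mkposreal _ Hd2). intros w Hw. apply H.
    apply Cmod_ball in Hw. simpl in Hw. lra.
Qed.

Lemma ccont_eps (f : C -> C) (z : C) :
  ccont f z <-> forall e, 0 < e -> exists d, 0 < d /\
    forall w, Cmod (w - z) < d -> Cmod (f w - f z) < e.
Proof.
  split.
  - intros H e He.
    assert (He2 : 0 < e / 2) by lra.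
    apply locally_Cmod.
    apply (H (fun y => Cmod (y - f z) < e)).
    exists (mkposreal _ He2). intros y Hy. apply Cmod_ball in Hy. simpl in Hy. lra.
  - intros H P [e HP].
    destruct (H e (cond_pos e)) as [d [Hd Hw]].
    apply locally_Cmod. exists d. split; auto.
    intros w Hwd. apply HP. apply ball_Cmod. now apply Hw.
Qed.

(* Caratheodory's form of complex differentiability: the difference quotient extends continuously to [z]. *)
Definition cderiv (f : C -> C) (z l : C) : Prop :=
  exists q : C -> C, q z = l /\ ccont q z /\
    forall w, f w = (f z + q w * (w - z))%C.

Lemma cderiv_ccont f z l : cderiv f z l -> ccont f z.
Proof.
  intros [q [_ [Hq E]]].
  apply ccont_ext with (f := fun w => (f z + q w * (w - z))%C).
  - intros w. symmetry. apply E.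
  - apply ccont_plus; [apply ccont_const|]. apply ccont_mult; auto.
    apply ccont_minus; [apply ccont_id | apply ccont_const].
Qed.

Lemma cderiv_const c z : cderiv (fun _ => c) z 0%C.
Proof.
  exists (fun _ => RtoC 0). split; [|split]; auto using ccont_const.
  intros; ring.
Qed.

Lemma cderiv_id z : cderiv (fun w => w) z 1%C.
Proof.
  exists (fun _ => RtoC 1). split; [|split]; auto using ccont_const.
  intros; ring.
Qed.

Lemma cderiv_plus f g z l m :
  cderiv f z l -> cderiv g z m -> cderiv (fun w => f w + g w)%C z (l + m)%C.
Proof.
  intros [q [Ql [Qc Qe]]] [r [Rl [Rc Re]]].
  exists (fun w => q w + r w)%C. split; [now rewrite Ql, Rl|split].
  - now apply ccont_plus.
  - intros w. rewrite (Qe w), (Re w). ring.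
Qed.

Lemma cderiv_mult f g z l m :
  cderiv f z l -> cderiv g z m ->
  cderiv (fun w => f w * g w)%C z (l * g z + f z * m)%C.
Proof.
  intros [q [Ql [Qc Qe]]] Hg. pose proof (cderiv_ccont _ _ _ Hg) as Gc.
  destruct Hg as [r [Rl [Rc Re]]].
  exists (fun w => q w * g w + f z * r w)%C. split; [now rewrite Ql, Rl|split].
  - apply ccont_plus; apply ccont_mult; auto using ccont_const.
  - intros w. rewrite (Qe w).
    replace ((f z + q w * (w - z)) * g w)%C
      with (f z * g w + q w * g w * (w - z))%C by ring.
    rewrite (Re w) at 1. ring.
Qed.

Lemma cderiv_ext f g z l :
  (forall w, f w = g w) -> cderiv f z l -> cderiv g z l.
Proof.
  intros H [q [Ql [Qc Qe]]]. exists q. repeat split; auto.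
  intros w. now rewrite <- !H.
Qed.

Lemma cderiv_comp f g z l m :
  cderiv f z l -> cderiv g (f z) m -> cderiv (fun w => g (f w)) z (m * l)%C.
Proof.
  intros Hf [r [Rl [Rc Re]]]. pose proof (cderiv_ccont _ _ _ Hf) as Fc.
  destruct Hf as [q [Ql [Qc Qe]]].
  exists (fun w => r (f w) * q w)%C. split; [now rewrite Ql, Rl|split].
  - apply ccont_mult; auto. now apply ccont_comp.
  - intros w. rewrite (Re (f w)). rewrite (Qe w) at 2. ring.
Qed.

Lemma cderiv_inv_id (z : C) : z <> 0%C ->
  exists q, q z = (- / (z * z))%C /\ ccont q z /\
   locally (z : C_UniformSpace) (fun w => / w = / z + q w * (w - z))%C.
Proof.
  intros Hz. exists (fun w => - / (z * w))%C. repeat split.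
  - apply ccont_opp. apply ccont_inv.
    + apply ccont_mult; auto using ccont_const, ccont_id.
    + now apply Cmult_neq_0.
  - apply locally_Cmod. exists (Cmod z). split; [now apply Cmod_gt_0|].
    intros w Hw. assert (w <> 0%C).
    { intros ->. replace (0 - z)%C with (- z)%C in Hw by ring.
      rewrite Cmod_opp in Hw. lra. }
    field. now split.
Qed.

(* Only the germ of [f] at [z] matters. *)
Lemma cderiv_local (f q : C -> C) (z l : C) :
  q z = l -> ccont q z ->
  locally (z : C_UniformSpace) (fun w => f w = f z + q w * (w - z))%C ->
  cderiv f z l.
Proof.
  intros Ql Qc Hloc.
  exists (fun w => if excluded_middle_informative (w = z) then l
                   else ((f w - f z) / (w - z))%C).
  assert (E : forall w : C, w <> z -> (w - z)%C <> 0%C).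
  { intros w Hw H. apply Hw. replace w with (w - z + z)%C by ring. rewrite H. ring. }
  split; [|split].
  - cbv beta; destruct (excluded_middle_informative (z = z)); congruence.
  - apply continuous_ext_loc with (g := q); [|exact Qc].
    apply (filter_imp (fun w => f w = (f z + q w * (w - z))%C)); [|exact Hloc].
    intros w Hw. cbv beta; destruct (excluded_middle_informative (w = z)) as [->|Hn]; auto.
    rewrite Hw. ceq. field. now apply E.
  - intros w. cbv beta; destruct (excluded_middle_informative (w = z)) as [->|Hn]; [ring|].
    field. now apply E.
Qed.

Lemma cderiv_inv (z : C) : z <> 0%C -> cderiv Cinv z (- / (z * z))%C.
Proof.
  intros Hz. destruct (cderiv_inv_id z Hz) as [q [H1 [H2 H3]]].
  now apply cderiv_local with q.
Qed.

Lemma caratheodory_is_derive (f q : R -> R) (x l : R) :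
  q x = l -> continuous q x -> (forall t, f t = f x + q t * (t - x)) ->
  is_derive f x l.
Proof.
  intros <- Hq E. apply is_derive_Reals. intros e He.
  destruct (Hq (fun y => Rabs (y - q x) < e)) as [d Hd].
  { exists (mkposreal e He). now intros y Hy. }
  exists d. intros k Hk Hkd. rewrite (E (x + k)).
  replace ((f x + q (x + k) * (x + k - x) - f x) / k - q x) with (q (x + k) - q x)
    by (field; auto).
  apply Hd. unfold ball; simpl. unfold AbsRing_ball, abs, minus, plus, opp; simpl.
  now replace (x + k + - x) with k by ring.
Qed.

Lemma continuous_hline (x y : R) :
  continuous (fun t : R => ((t, y) : C_UniformSpace)) x.
Proof. apply ccont_pair; [apply continuous_id|apply continuous_const]. Qed.

Lemma continuous_vline (x y : R) :
  continuous (fun t : R => ((x, t) : C_UniformSpace)) y.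
Proof. apply ccont_pair; [apply continuous_const|apply continuous_id]. Qed.

(** Cauchy-Riemann equations, by restricting the quotient [q] to the two coordinate lines. On the
    vertical line the increment is i (t - y), which exchanges the components of [q] and produces the
    minus sign. *)
Lemma cderiv_partials f (x y : R) (l : C) : cderiv f (x, y) l ->
  is_derive (fun t => fst (f (t, y))) x (fst l) /\
  is_derive (fun t => snd (f (t, y))) x (snd l) /\
  is_derive (fun t => fst (f (x, t))) y (- snd l) /\
  is_derive (fun t => snd (f (x, t))) y (fst l).
Proof.
  intros [q [<- [Qc Qe]]].
  assert (Qx : ccont (fun t : R => q (t, y)) x)
    by (apply (continuous_comp (fun t : R => ((t, y) : C_UniformSpace)) q);
        [apply continuous_hline|exact Qc]).
  assert (Qy : ccont (fun t : R => q (x, t)) y)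
    by (apply (continuous_comp (fun t : R => ((x, t) : C_UniformSpace)) q);
        [apply continuous_vline|exact Qc]).
  split; [|split; [|split]].
  - apply caratheodory_is_derive with (q := fun t => fst (q (t, y))).
    + reflexivity.
    + now apply (ccont_re (fun t : R => q (t, y))).
    + intros t. rewrite (Qe (t, y)) at 1. simpl. ring.
  - apply caratheodory_is_derive with (q := fun t => snd (q (t, y))).
    + reflexivity.
    + now apply (ccont_im (fun t : R => q (t, y))).
    + intros t. rewrite (Qe (t, y)) at 1. simpl. ring.
  - apply caratheodory_is_derive with (q := fun t => - snd (q (x, t))).
    + reflexivity.
    + apply (continuous_opp (V := R_NormedModule)).
      now apply (ccont_im (fun t : R => q (x, t))).
    + intros t. rewrite (Qe (x, t)) at 1. simpl. ring.
  - apply caratheodory_is_derive with (q := fun t => fst (q (x, t))).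
    + reflexivity.
    + now apply (ccont_re (fun t : R => q (x, t))).
    + intros t. rewrite (Qe (x, t)) at 1. simpl. ring.
Qed.

(** Real differentiability with gradient (a, b). The error is measured by [Cmod] so that two real
    estimates combine into one for a complex quotient. *)
Definition differentiable2 (f : R -> R -> R) (z : C) (a b : R) : Prop :=
  forall e, 0 < e -> exists d, 0 < d /\ forall w : C, Cmod (w - z) < d ->
    Rabs (f (fst w) (snd w) - f (fst z) (snd z)
          - (a * (fst w - fst z) + b * (snd w - snd z))) <= e * Cmod (w - z).

(** The increment splits into a vertical step at the fixed abscissa [x] and a horizontal step
    handled by the mean value theorem; this explains the asymmetry between the two partial
    derivatives. *)
Lemma C1_differentiable2 (f a b : R -> R -> R) (x y : R) :
  locally ((x, y) : C_UniformSpace) (fun z =>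
    is_derive (fun t => f t (snd z)) (fst z) (a (fst z) (snd z))) ->
  is_derive (fun t => f x t) y (b x y) ->
  cont2 a x y -> differentiable2 f (x, y) (a x y) (b x y).
Proof.
  intros Hx Hy Ha e He.
  pose proof (is_derive_filterdiff f x y a (b x y) Hx Hy Ha) as [_ H].
  specialize (H (x, y) (fun P HP => HP) (mkposreal e He)). simpl in H.
  apply locally_Cmod in H. destruct H as [d [Hd H]].
  exists d. split; auto. intros [w1 w2] Hw. specialize (H (w1, w2) Hw).
  change (Rabs (f w1 w2 + - f x y + - ((w1 + - x) * a x y + (w2 + - y) * b x y))
    <= e * sqrt (Rabs (w1 + - x) ^ 2 + Rabs (w2 + - y) ^ 2)) in H.
  rewrite !pow2_abs in H.
  simpl fst; simpl snd.
  replace (f w1 w2 - f x y - (a x y * (w1 - x) + b x y * (w2 - y)))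
    with (f w1 w2 + - f x y + - ((w1 + - x) * a x y + (w2 + - y) * b x y)) by ring.
  exact H.
Qed.

(** The two gradients say that the real differential is multiplication by [l], so the error divided
    by w - z tends to 0. *)
Lemma CR_cderiv (A B : R -> R -> R) (z l : C) :
  differentiable2 A z (fst l) (- snd l) ->
  differentiable2 B z (snd l) (fst l) ->
  cderiv (fun w => (A (fst w) (snd w), B (fst w) (snd w))) z l.
Proof.
  intros HA HB. set (f := fun w : C => ((A (fst w) (snd w), B (fst w) (snd w)) : C)).
  exists (fun w => if excluded_middle_informative (w = z) then l
                   else ((f w - f z) / (w - z))%C).
  assert (E : forall w : C, w <> z -> (w - z)%C <> 0%C).
  { intros w Hw H. apply Hw. replace w with (w - z + z)%C by ring. rewrite H. ring. }
  split; [|split].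
  - cbv beta; destruct (excluded_middle_informative (z = z)); congruence.
  - apply ccont_eps. intros e He.
    destruct (HA (e / 4)) as [d1 [Hd1 H1]]; [lra|].
    destruct (HB (e / 4)) as [d2 [Hd2 H2]]; [lra|].
    exists (Rmin d1 d2). split; [now apply Rmin_pos|].
    intros w Hw. cbv beta; destruct (excluded_middle_informative (z = z)) as [_|]; [|congruence].
    cbv beta; destruct (excluded_middle_informative (w = z)) as [->|Hn].
    { replace (l - l)%C with (RtoC 0) by ring. rewrite Cmod_0. lra. }
    assert (Hp : 0 < Cmod (w - z)) by (apply Cmod_gt_0; auto).
    replace ((f w - f z) / (w - z) - l)%C with ((f w - f z - l * (w - z)) / (w - z))%C
      by (field; auto).
    rewrite Cmod_div by auto.
    apply Rle_lt_trans with (e / 2); [|lra].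
    apply Rmult_le_reg_r with (Cmod (w - z)); auto.
    unfold Rdiv at 1. rewrite Rmult_assoc, Rinv_l, Rmult_1_r by lra.
    eapply Rle_trans; [apply Cmod_lt_sum|].
    specialize (H1 w ltac:(eapply Rlt_le_trans; [exact Hw|apply Rmin_l])).
    specialize (H2 w ltac:(eapply Rlt_le_trans; [exact Hw|apply Rmin_r])).
    match goal with |- Rabs ?u + Rabs ?v <= _ =>
      replace u with (A (fst w) (snd w) - A (fst z) (snd z)
        - (fst l * (fst w - fst z) + - snd l * (snd w - snd z))) by (simpl; ring);
      replace v with (B (fst w) (snd w) - B (fst z) (snd z)
        - (snd l * (fst w - fst z) + fst l * (snd w - snd z))) by (simpl; ring)
    end. lra.
  - intros w. cbv beta; destruct (excluded_middle_informative (w = z)) as [->|Hn]; [ring|].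
    field. now apply E.
Qed.

Definition cexp (z : C) : C := (exp (fst z) * cos (snd z), exp (fst z) * sin (snd z)).

Lemma cexp_ccont z : ccont cexp z.
Proof.
  assert (H1 : continuous (fun w : C_UniformSpace => fst w) z)
    by exact (ccont_re _ _ (ccont_id z)).
  assert (H2 : continuous (fun w : C_UniformSpace => snd w) z)
    by exact (ccont_im _ _ (ccont_id z)).
  apply ccont_pair; apply (continuous_mult (K := R_AbsRing)).
  - exact (continuous_comp _ exp _ H1 (continuous_exp _)).
  - exact (continuous_comp _ cos _ H2 (continuous_cos _)).
  - exact (continuous_comp _ exp _ H1 (continuous_exp _)).
  - exact (continuous_comp _ sin _ H2 (continuous_sin _)).
Qed.

Lemma cexp_cderiv z : cderiv cexp z (cexp z).
Proof.
  destruct z as [x y].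
  apply (CR_cderiv (fun x y => exp x * cos y) (fun x y => exp x * sin y)).
  - apply (C1_differentiable2 _ (fun x y => exp x * cos y) (fun x y => - (exp x * sin y))).
    + apply filter_forall. intros w. auto_derive; auto. ring.
    + auto_derive; auto. ring.
    + exact (ccont_re _ _ (cexp_ccont (x, y))).
  - apply (C1_differentiable2 _ (fun x y => exp x * sin y) (fun x y => (exp x * cos y))).
    + apply filter_forall. intros w. auto_derive; auto. ring.
    + auto_derive; auto. ring.
    + exact (ccont_im _ _ (cexp_ccont (x, y))).
Qed.

Lemma Cmod_cexp z : Cmod (cexp z) = exp (fst z).
Proof.
  unfold Cmod, cexp. simpl fst; simpl snd.
  replace (_ + _) with (exp (fst z) ^ 2 * (Rsqr (sin (snd z)) + Rsqr (cos (snd z))))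
    by (unfold Rsqr; ring).
  rewrite sin2_cos2, Rmult_1_r, sqrt_pow2; auto. left; apply exp_pos.
Qed.

Lemma cexp_plus z w : cexp (z + w) = (cexp z * cexp w)%C.
Proof.
  unfold cexp. apply Ceq; simpl; rewrite exp_plus, ?cos_plus, ?sin_plus; ring.
Qed.

Lemma cexp_0 : cexp 0 = 1%C.
Proof. unfold cexp. apply Ceq; simpl; rewrite exp_0, ?cos_0, ?sin_0; ring. Qed.

Lemma cexp_neq_0 z : cexp z <> 0%C.
Proof. apply Cmod_gt_0. rewrite Cmod_cexp. apply exp_pos. Qed.

(** A relation on intervals that composes and holds between each point and its neighbours reaches
    from [a] to [b]: the supremum of the points reachable from [a] can be reached and passed. It
    serves both for adding up lengths and for moving poles. *)
Lemma real_induction (a b : R) (Q : R -> R -> Prop) :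
  a <= b ->
  (forall x y z, a <= x -> x <= y -> y <= z -> z <= b -> Q x y -> Q y z -> Q x z) ->
  (forall t, a <= t <= b -> exists d, 0 < d /\ forall s, a <= s <= b ->
     Rabs (s - t) < d -> (s <= t -> Q s t) /\ (t <= s -> Q t s)) ->
  Q a b.
Proof.
  intros Hab Htr Hloc.
  set (E := fun t => a <= t <= b /\ Q a t).
  assert (Ea : E a).
  { split; [lra|]. destruct (Hloc a) as [d [Hd H]]; [lra|].
    apply (H a); try lra. rewrite Rminus_diag, Rabs_R0. lra. }
  destruct (completeness E) as [s [Hub Hlub]].
  { exists b. intros t [Ht _]. lra. }
  { now exists a. }
  assert (Hs : a <= s <= b).
  { split; [now apply Hub|]. apply Hlub. intros t [Ht _]. lra. }
  destruct (Hloc s Hs) as [d [Hd H]].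
  assert (Hex : exists t, E t /\ s - d < t).
  { apply NNPP. intros Hn. assert (s <= s - d); [|lra].
    apply Hlub. intros t Ht. apply Rnot_lt_le. intros Hlt. apply Hn. now exists t. }
  destruct Hex as [t [[Ht Qt] Htd]].
  assert (Hts : t <= s) by (apply Hub; now split).
  assert (Qs : Q a s).
  { apply Htr with t; try lra; auto. apply H; try lra. apply Rabs_def1; lra. }
  (* A step beyond the supremum; u <= s is then possible only when [u] is [b] itself. *)
  set (u := Rmin b (s + d / 2)).
  assert (Hu : s <= u <= b).
  { split; [apply Rmin_glb; lra|apply Rmin_l]. }
  assert (Hu' : u <= s + d / 2) by apply Rmin_r.
  assert (Qu : Q a u).
  { apply Htr with s; try lra; auto. apply H; try lra. apply Rabs_def1; lra. }
  assert (u <= s) by (apply Hub; split; [lra|auto]).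
  unfold u in *. unfold Rmin in *. destruct (Rle_dec b (s + d / 2)).
  - auto.
  - lra.
Qed.

(** * Holomorphic functions, primitives and harmonic functions *)


Definition holo (Om : R -> R -> Prop) (f f' : C -> C) : Prop :=
  forall z : C, Om (fst z) (snd z) -> cderiv f z (f' z) /\ ccont f' z.

Lemma holo_ext Om (f g g' f' : C -> C) :
  (forall z, f z = g z) -> (forall z, f' z = g' z) -> holo Om f f' -> holo Om g g'.
Proof.
  intros E E' H z Hz. destruct (H z Hz) as [H1 H2]. rewrite <- E'. split.
  - now apply cderiv_ext with f.
  - now apply ccont_ext with f'.
Qed.

Lemma holo_ccont Om f f' (z : C) : holo Om f f' -> Om (fst z) (snd z) -> ccont f z.
Proof. intros H Hz. apply cderiv_ccont with (f' z). now apply H. Qed.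

Lemma holo_const Om c : holo Om (fun _ => c) (fun _ => 0%C).
Proof. intros z _. split; auto using cderiv_const, ccont_const. Qed.

Lemma holo_plus Om f f' g g' : holo Om f f' -> holo Om g g' ->
  holo Om (fun z => f z + g z)%C (fun z => f' z + g' z)%C.
Proof.
  intros Hf Hg z Hz. destruct (Hf z Hz), (Hg z Hz).
  auto using cderiv_plus, ccont_plus.
Qed.

Lemma holo_mult Om f f' g g' : holo Om f f' -> holo Om g g' ->
  holo Om (fun z => f z * g z)%C (fun z => f' z * g z + f z * g' z)%C.
Proof.
  intros Hf Hg z Hz. pose proof (holo_ccont _ _ _ _ Hf Hz).
  pose proof (holo_ccont _ _ _ _ Hg Hz). destruct (Hf z Hz), (Hg z Hz).
  auto using cderiv_mult, ccont_plus, ccont_mult.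
Qed.

Lemma holo_scal Om c f f' : holo Om f f' ->
  holo Om (fun z => c * f z)%C (fun z => c * f' z)%C.
Proof.
  intros Hf. eapply holo_ext; [| |apply holo_mult; [apply (holo_const Om c)|exact Hf]].
  - reflexivity.
  - intros z. simpl. ring.
Qed.

Lemma holo_cexp Om f f' : holo Om f f' ->
  holo Om (fun z => cexp (f z)) (fun z => cexp (f z) * f' z)%C.
Proof.
  intros Hf z Hz. pose proof (holo_ccont _ _ _ _ Hf Hz) as Hc.
  destruct (Hf z Hz). split.
  - apply cderiv_comp; auto using cexp_cderiv.
  - apply ccont_mult; auto. apply ccont_comp; auto using cexp_ccont.
Qed.

Lemma dom_open S (z : C) : dom S (fst z) (snd z) ->
  locally (z : C_UniformSpace) (fun w => dom S (fst w) (snd w)).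
Proof.
  destruct S; simpl; intros Hz.
  - now apply filter_forall.
  - rewrite <- Rplus_0_r in Hz.
    assert (Hm : Cmod z < 1).
    { pose proof (Cmod_sqr z). pose proof (Cmod_ge_0 z). simpl in *. nra. }
    apply locally_Cmod. exists (1 - Cmod z). split; [lra|].
    intros w Hw. pose proof (Cmod_triangle_inv w z).
    pose proof (Cmod_sqr w). pose proof (Cmod_ge_0 w). simpl in *. nra.
Qed.

(** Keeps inside the domain the path that runs from the origin along the real axis to (x, 0) and
    then vertically to (x, y); primitives are integrated along it. *)
Lemma dom_shrink S (x y x' y' : R) : Rabs x' <= Rabs x -> Rabs y' <= Rabs y ->
  dom S x y -> dom S x' y'.
Proof.
  destruct S; simpl; auto. intros H1 H2 H.
  apply Rsqr_le_abs_1 in H1. apply Rsqr_le_abs_1 in H2. unfold Rsqr in *. lra.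
Qed.

Lemma locally_hline (P : C -> Prop) (x y : R) :
  locally ((x, y) : C_UniformSpace) P -> locally x (fun t : R => P (t, y)).
Proof. intros H. exact (continuous_hline x y P H). Qed.

Lemma locally_vline (P : C -> Prop) (x y : R) :
  locally ((x, y) : C_UniformSpace) P -> locally y (fun t : R => P (x, t)).
Proof. intros H. exact (continuous_vline x y P H). Qed.

Lemma cont2_re (f : C -> C) (x y : R) :
  ccont f (x, y) -> cont2 (fun x y => fst (f (x, y))) x y.
Proof.
  intros H. apply continuous_ext with (f := fun p : C_UniformSpace => fst (f p)).
  - now intros [u v].
  - now apply ccont_re.
Qed.

Lemma cont2_im (f : C -> C) (x y : R) :
  ccont f (x, y) -> cont2 (fun x y => snd (f (x, y))) x y.
Proof.
  intros H. apply continuous_ext with (f := fun p : C_UniformSpace => snd (f p)).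
  - now intros [u v].
  - now apply ccont_im.
Qed.

Lemma cont2_opp (f : R -> R -> R) (x y : R) :
  cont2 f x y -> cont2 (fun x y => - f x y) x y.
Proof. intros H. now apply (continuous_opp (V := R_NormedModule)). Qed.

Lemma cont2_ext_dom S (f g : R -> R -> R) (x y : R) :
  (forall x y, dom S x y -> f x y = g x y) -> dom S x y ->
  cont2 g x y -> cont2 f x y.
Proof.
  intros E D. apply continuous_ext_loc.
  apply (filter_imp (fun w : C => dom S (fst w) (snd w))).
  - intros w Hw. symmetry. auto.
  - exact (dom_open S (x, y) D).
Qed.

Lemma is_derive_ext_dom_x S (f g : R -> R -> R) (x y l : R) :
  (forall x y, dom S x y -> f x y = g x y) -> dom S x y ->
  is_derive (fun t => g t y) x l -> is_derive (fun t => f t y) x l.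
Proof.
  intros E D. apply is_derive_ext_loc.
  apply (filter_imp (fun t => dom S t y)).
  - intros t Ht. symmetry. auto.
  - exact (locally_hline _ x y (dom_open S (x, y) D)).
Qed.

Lemma is_derive_ext_dom_y S (f g : R -> R -> R) (x y l : R) :
  (forall x y, dom S x y -> f x y = g x y) -> dom S x y ->
  is_derive (fun t => g x t) y l -> is_derive (fun t => f x t) y l.
Proof.
  intros E D. apply is_derive_ext_loc.
  apply (filter_imp (fun t => dom S x t)).
  - intros t Ht. symmetry. auto.
  - exact (locally_vline _ x y (dom_open S (x, y) D)).
Qed.

Lemma C1_on_intro S (f a b : R -> R -> R) :
  (forall x y, dom S x y -> cont2 f x y /\ is_derive (fun t => f t y) x (a x y) /\
    is_derive (fun t => f x t) y (b x y) /\ cont2 a x y /\ cont2 b x y) ->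
  C1_on (dom S) f /\ forall x y, dom S x y -> dx f x y = a x y /\ dy f x y = b x y.
Proof.
  intros H.
  assert (E : forall x y, dom S x y -> dx f x y = a x y /\ dy f x y = b x y).
  { intros x y D. destruct (H x y D) as [_ [Hx [Hy _]]].
    split; now apply is_derive_unique. }
  split; auto. intros x y D. destruct (H x y D) as [Hc [Hx [Hy [Ha Hb]]]].
  split; [exact Hc|split; [now exists (a x y)|split; [now exists (b x y)|split]]].
  - apply cont2_ext_dom with S a; auto. intros; now apply E.
  - apply cont2_ext_dom with S b; auto. intros; now apply E.
Qed.

Lemma holo_re_C1 S f f' : holo (dom S) f f' ->
  C1_on (dom S) (fun x y => fst (f (x, y))) /\
  forall x y, dom S x y -> dx (fun x y => fst (f (x, y))) x y = fst (f' (x, y)) /\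
    dy (fun x y => fst (f (x, y))) x y = - snd (f' (x, y)).
Proof.
  intros H. apply (C1_on_intro S (fun x y => fst (f (x, y))) (fun x y => fst (f' (x, y)))
    (fun x y => - snd (f' (x, y)))).
  intros x y D. pose proof (holo_ccont _ _ _ (x, y) H D) as Hc.
  destruct (H (x, y) D) as [Hd Hc']. apply cderiv_partials in Hd.
  destruct Hd as [H1 [H2 [H3 H4]]].
  split; [|split; [|split; [|split]]]; auto using cont2_re, cont2_opp, cont2_im.
Qed.

Lemma holo_im_C1 S f f' : holo (dom S) f f' ->
  C1_on (dom S) (fun x y => - snd (f (x, y))) /\
  forall x y, dom S x y -> dx (fun x y => - snd (f (x, y))) x y = - snd (f' (x, y)) /\
    dy (fun x y => - snd (f (x, y))) x y = - fst (f' (x, y)).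
Proof.
  intros H. apply (C1_on_intro S (fun x y => - snd (f (x, y)))
    (fun x y => - snd (f' (x, y))) (fun x y => - fst (f' (x, y)))).
  intros x y D. pose proof (holo_ccont _ _ _ (x, y) H D) as Hc.
  destruct (H (x, y) D) as [Hd Hc']. apply cderiv_partials in Hd.
  destruct Hd as [H1 [H2 [H3 H4]]].
  split; [|split; [|split; [|split]]]; auto using cont2_re, cont2_opp, cont2_im.
  - now apply (is_derive_opp (fun t => snd (f (t, y)))).
  - now apply (is_derive_opp (fun t => snd (f (x, t)))).
Qed.

Lemma between_Rabs (a t : R) : Rmin 0 a <= t <= Rmax 0 a -> Rabs t <= Rabs a.
Proof.
  unfold Rmin, Rmax. destruct (Rle_dec 0 a); intros; unfold Rabs;
    destruct (Rcase_abs t), (Rcase_abs a); lra.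
Qed.

Lemma ex_RInt_vline S (g : R -> R -> R) (x y : R) :
  (forall x y, dom S x y -> cont2 g x y) -> dom S x y ->
  ex_RInt (fun s => g x s) 0 y.
Proof.
  intros Hg D. apply (ex_RInt_continuous (V := R_CompleteNormedModule)).
  intros t Ht.
  apply (continuous_comp (fun t : R => ((x, t) : C_UniformSpace))
    (fun p => g (fst p) (snd p))); [apply continuous_vline|].
  apply Hg. apply dom_shrink with x y; auto using between_Rabs; lra.
Qed.

Lemma ex_RInt_hline S (g : R -> R -> R) (x y : R) :
  (forall x y, dom S x y -> cont2 g x y) -> dom S x y ->
  ex_RInt (fun s => g s y) 0 x.
Proof.
  intros Hg D. apply (ex_RInt_continuous (V := R_CompleteNormedModule)).
  intros t Ht.
  apply (continuous_comp (fun t : R => ((t, y) : C_UniformSpace))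
    (fun p => g (fst p) (snd p))); [apply continuous_hline|].
  apply Hg. apply dom_shrink with x y; auto using between_Rabs; lra.
Qed.

(** The form Re f dx - Im f dy is closed by Cauchy-Riemann; [c] is the common value of the y
    derivative of [a] and the x derivative of [b]. *)
Lemma holo_primitive S f f' : holo (dom S) f f' ->
  exists Y : R -> R -> R, forall x y, dom S x y ->
    is_derive (fun t => Y t y) x (fst (f (x, y))) /\
    is_derive (fun t => Y x t) y (- snd (f (x, y))).
Proof.
  intros H.
  set (a := fun x y => fst (f (x, y))). set (b := fun x y => - snd (f (x, y))).
  set (c := fun x y => - snd (f' (x, y))).
  assert (Ca : forall x y, dom S x y -> cont2 a x y).
  { intros x y D. apply cont2_re. now apply (holo_ccont _ _ _ (x, y) H). }
  assert (Cb : forall x y, dom S x y -> cont2 b x y).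
  { intros x y D. apply (cont2_opp (fun x y => snd (f (x, y)))). apply cont2_im.
    now apply (holo_ccont _ _ _ (x, y) H). }
  assert (Cc : forall x y, dom S x y -> cont2 c x y).
  { intros x y D. apply (cont2_opp (fun x y => snd (f' (x, y)))). apply cont2_im.
    now apply (H (x, y)). }
  assert (Day : forall x y, dom S x y -> is_derive (fun t => a x t) y (c x y)).
  { intros x y D. now apply (cderiv_partials f x y), (H (x, y)). }
  assert (Dbx : forall x y, dom S x y -> is_derive (fun t => b t y) x (c x y)).
  { intros x y D. apply (is_derive_opp (fun t => snd (f (t, y)))).
    now apply (cderiv_partials f x y), (H (x, y)). }
  (* The y derivative is immediate. The x derivative is a(x, 0) plus the integral of b_x = a_y over
     [0, y], which adds up to a(x, y). *)
  exists (fun x y => RInt (fun s => a s 0) 0 x + RInt (fun s => b x s) 0 y).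
  intros x y D.
  assert (D0 : dom S x 0).
  { apply dom_shrink with x y; auto; [lra|]. rewrite Rabs_R0. apply Rabs_pos. }
  split.
  - replace (fst (f (x, y))) with (a x 0 + RInt (fun t => Derive (fun u => b u t) x) 0 y).
    + apply (is_derive_plus (V := R_NormedModule) (fun t => RInt (fun s => a s 0) 0 t)).
      * apply (is_derive_RInt (fun s => a s 0) _ 0).
        -- apply (filter_imp (fun t => dom S t 0)).
           ++ intros t Ht. apply (RInt_correct (V := R_CompleteNormedModule)).
              now apply (ex_RInt_hline S).
           ++ exact (locally_hline _ x 0 (dom_open S (x, 0) D0)).
        -- apply (continuous_comp (fun t : R => ((t, 0) : C_UniformSpace))
            (fun p => a (fst p) (snd p))); [apply continuous_hline|]. now apply Ca.
      * apply (is_derive_RInt_param b 0 y x).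
        -- apply (filter_imp (fun t => dom S t y)).
           ++ intros u Hu t Ht. exists (c u t). apply Dbx.
              apply dom_shrink with u y; auto using between_Rabs; lra.
           ++ exact (locally_hline _ x y (dom_open S (x, y) D)).
        -- intros t Ht.
           assert (Dt : dom S x t)
             by (apply dom_shrink with x y; auto using between_Rabs; lra).
           apply continuity_2d_pt_filterlim.
           apply (cont2_ext_dom S (fun u v => Derive (fun z => b z v) u) c); auto.
           intros u v Duv. now apply is_derive_unique, Dbx.
        -- apply (filter_imp (fun t => dom S t y)).
           ++ intros u Hu. now apply (ex_RInt_vline S).
           ++ exact (locally_hline _ x y (dom_open S (x, y) D)).
    + rewrite (RInt_ext _ (Derive (fun t => a x t))).
      * rewrite RInt_Derive.
        -- unfold a. ring.
        -- intros t Ht. exists (c x t). apply Day.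
           apply dom_shrink with x y; auto using between_Rabs; lra.
        -- intros t Ht.
           assert (Dt : dom S x t)
             by (apply dom_shrink with x y; auto using between_Rabs; lra).
           apply (continuous_comp (fun t : R => ((x, t) : C_UniformSpace))
            (fun p => Derive (a (fst p)) (snd p))); [apply continuous_vline|].
           apply (cont2_ext_dom S (fun x y => Derive (a x) y) c); auto.
           intros u v Duv. now apply is_derive_unique, (Day u v).
      * intros t Ht.
        assert (Dt : dom S x t).
        { apply dom_shrink with x y; auto; [lra|]. apply between_Rabs; lra. }
        transitivity (c x t); [|symmetry]; apply is_derive_unique; auto.
  - replace (- snd (f (x, y))) with (plus 0 (b x y)) by (unfold b, plus; simpl; ring).
    apply (is_derive_plus (V := R_NormedModule) (fun t => RInt (fun s => a s 0) 0 x)).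
    + apply (is_derive_const (V := R_NormedModule)).
    + apply (is_derive_RInt (fun s => b x s) _ 0).
      * apply (filter_imp (fun t => dom S x t)).
        -- intros t Ht. apply (RInt_correct (V := R_CompleteNormedModule)).
           now apply (ex_RInt_vline S).
        -- exact (locally_vline _ x y (dom_open S (x, y) D)).
      * apply (continuous_comp (fun t : R => ((x, t) : C_UniformSpace))
            (fun p => b (fst p) (snd p))); [apply continuous_vline|]. now apply Cb.
Qed.

Lemma differentiable2_cont2 (f : R -> R -> R) (x y a b : R) :
  differentiable2 f (x, y) a b -> cont2 f x y.
Proof.
  intros H. apply continuity_2d_pt_filterlim. intros e.
  destruct (H 1) as [d [Hd Hw]]; [lra|].
  set (K := 1 + Rabs a + Rabs b).
  assert (HK : 0 < K) by (unfold K; pose proof (Rabs_pos a); pose proof (Rabs_pos b); lra).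
  set (r := Rmin d (e / K)).
  assert (Hr : 0 < r).
  { apply Rmin_pos; auto. apply Rdiv_lt_0_compat; auto. apply cond_pos. }
  apply locally_2d_locally. apply locally_Cmod. exists r. split; auto.
  intros [w1 w2] Hwr. simpl in Hwr |- *. simpl in Hw.
  assert (Hwd : Cmod ((w1, w2) - (x, y)) < d) by (eapply Rlt_le_trans; [exact Hwr|apply Rmin_l]).
  assert (Hwe : Cmod ((w1, w2) - (x, y)) < e / K) by (eapply Rlt_le_trans; [exact Hwr|apply Rmin_r]).
  specialize (Hw (w1, w2) Hwd). simpl in Hw.
  pose proof (re_le_Cmod ((w1, w2) - (x, y))) as B1. pose proof (im_le_Cmod ((w1, w2) - (x, y))) as B2.
  simpl in B1, B2.
  set (m := Cmod ((w1, w2) - (x, y))) in *.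
  apply Rle_lt_trans with (K * m).
  - replace (f w1 w2 - f x y) with
      ((f w1 w2 - f x y - (a * (w1 - x) + b * (w2 - y)))
       + (a * (w1 - x) + b * (w2 - y))) by ring.
    eapply Rle_trans; [apply Rabs_triang|].
    pose proof (Rabs_triang (a * (w1 - x)) (b * (w2 - y))) as T.
    rewrite !Rabs_mult in T.
    pose proof (Rmult_le_compat_l _ _ _ (Rabs_pos a) B1).
    pose proof (Rmult_le_compat_l _ _ _ (Rabs_pos b) B2).
    unfold K, Rminus in *. lra.
  - apply Rmult_lt_compat_l with (r := K) in Hwe; auto.
    replace (K * (e / K)) with (pos e) in Hwe by (field; lra). exact Hwe.
Qed.

(** Differentiating Re f in x and - Im f in y gives Re f' and - Re f', whose sum is the
    Laplacian. *)
Lemma holo_harmonic_primitive S f f' : holo (dom S) f f' ->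
  exists Y : R -> R -> R, harmonic (dom S) Y /\ forall x y, dom S x y ->
    dx Y x y = fst (f (x, y)) /\ dy Y x y = - snd (f (x, y)).
Proof.
  intros H. destruct (holo_primitive S f f' H) as [Y HY]. exists Y.
  assert (Cf : forall x y, dom S x y -> ccont f (x, y)).
  { intros x y D. now apply (holo_ccont _ _ _ (x, y) H). }
  destruct (C1_on_intro S Y (fun x y => fst (f (x, y))) (fun x y => - snd (f (x, y))))
    as [C1 E].
  { intros x y D. destruct (HY x y D) as [Y1 Y2].
    split; [|split; [|split; [|split]]]; auto using cont2_re, cont2_opp, cont2_im.
    apply differentiable2_cont2 with (fst (f (x, y))) (- snd (f (x, y))).
    apply (C1_differentiable2 Y (fun x y => fst (f (x, y))) (fun x y => - snd (f (x, y)))); auto using cont2_re.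
    apply (filter_imp (fun w : C => dom S (fst w) (snd w))).
    - intros w Dw. exact (proj1 (HY _ _ Dw)).
    - exact (dom_open S (x, y) D). }
  destruct (holo_re_C1 S f f' H) as [R1 R2].
  destruct (holo_im_C1 S f f' H) as [I1 I2].
  assert (Ex : forall x y, dom S x y -> dx Y x y = fst (f (x, y))) by (intros; now apply E).
  assert (Ey : forall x y, dom S x y -> dy Y x y = - snd (f (x, y))) by (intros; now apply E).
  destruct (C1_on_intro S (dx Y) (fun x y => fst (f' (x, y))) (fun x y => - snd (f' (x, y))))
    as [Cx Exx].
  { intros x y D. destruct (R1 x y D) as [A1 [A2 [A3 [A4 A5]]]].
    destruct (R2 x y D) as [B1 B2]. destruct (H (x, y) D) as [Hd Hc].
    apply cderiv_partials in Hd. destruct Hd as [H1 [H2 [H3 H4]]].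
    split; [|split; [|split; [|split]]]; auto using cont2_re, cont2_opp, cont2_im.
    - now apply cont2_ext_dom with S (fun x y => fst (f (x, y))).
    - now apply (is_derive_ext_dom_x S _ (fun x y => fst (f (x, y)))).
    - now apply (is_derive_ext_dom_y S _ (fun x y => fst (f (x, y)))). }
  destruct (C1_on_intro S (dy Y) (fun x y => - snd (f' (x, y))) (fun x y => - fst (f' (x, y))))
    as [Cy Eyy].
  { intros x y D. destruct (I1 x y D) as [A1 [A2 [A3 [A4 A5]]]].
    destruct (H (x, y) D) as [Hd Hc].
    apply cderiv_partials in Hd. destruct Hd as [H1 [H2 [H3 H4]]].
    split; [|split; [|split; [|split]]]; auto using cont2_re, cont2_opp, cont2_im.
    - now apply cont2_ext_dom with S (fun x y => - snd (f (x, y))).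
    - apply (is_derive_ext_dom_x S _ (fun x y => - snd (f (x, y)))); auto.
      now apply (is_derive_opp (fun t => snd (f (t, y)))).
    - apply (is_derive_ext_dom_y S _ (fun x y => - snd (f (x, y)))); auto.
      now apply (is_derive_opp (fun t => snd (f (x, t)))). }
  split; [|exact E]. split; [exact (conj C1 (conj Cx Cy))|].
  intros x y D. destruct (Exx x y D) as [-> _]. destruct (Eyy x y D) as [_ ->]. ring.
Qed.

Lemma C1_on_differentiable2 S f x y : C1_on (dom S) f -> dom S x y ->
  differentiable2 f (x, y) (dx f x y) (dy f x y).
Proof.
  intros H D. destruct (H x y D) as [Hc [Hx [Hy [Hcx Hcy]]]].
  apply (C1_differentiable2 f (dx f) (dy f)); auto.
  - apply (filter_imp (fun w : C => dom S (fst w) (snd w))).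
    + intros w Dw. exact (Derive_correct _ _ (proj1 (proj2 (H _ _ Dw)))).
    + exact (dom_open S (x, y) D).
  - now apply Derive_correct.
Qed.

(** Twice the Wirtinger derivative of [u] in z, that is, the derivative of any holomorphic function
    with real part [u]. *)
Definition wirtinger (u : R -> R -> R) (z : C) : C :=
  (dx u (fst z) (snd z), - dy u (fst z) (snd z)).

(** The two Cauchy-Riemann equations for u_x - i u_y are the Laplace equation and the symmetry of
    the mixed second derivatives. *)
Lemma harmonic_holo S u : harmonic (dom S) u ->
  exists h', holo (dom S) (wirtinger u) h'.
Proof.
  intros [[C1 [Cx Cy]] L].
  exists (fun z => (dx (dx u) (fst z) (snd z), - dx (dy u) (fst z) (snd z))).
  assert (Sch : forall x y, dom S x y -> dx (dy u) x y = dy (dx u) x y).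
  { intros x y D. apply (Schwarz u x y).
    - apply locally_2d_locally.
      apply (filter_imp (fun w : C => dom S (fst w) (snd w))).
      + intros w Dw. destruct (C1 _ _ Dw) as [_ [A1 [A2 _]]].
        destruct (Cx _ _ Dw) as [_ [_ [A3 _]]]. destruct (Cy _ _ Dw) as [_ [A4 _]].
        auto.
      + exact (dom_open S (x, y) D).
    - apply continuity_2d_pt_filterlim. now apply (Cy x y D).
    - apply continuity_2d_pt_filterlim. now apply (Cx x y D). }
  intros [x y] D. simpl in D. split.
  - apply (CR_cderiv (dx u) (fun x y => - dy u x y)); simpl.
    + rewrite Ropp_involutive, (Sch x y D). now apply C1_on_differentiable2 with S.
    + pose proof (C1_on_differentiable2 S _ x y Cy D) as Hd.
      intros e He. destruct (Hd e He) as [d [Hd0 Hw]]. exists d. split; auto.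
      intros w Hwd. specialize (Hw w Hwd). specialize (L x y D). simpl in *.
      rewrite <- Rabs_Ropp.
      match goal with |- Rabs ?u <= _ => match type of Hw with Rabs ?v <= _ =>
        replace u with v; [exact Hw|] end end.
      replace (dy (dy u) x y) with (- dx (dx u) x y) by lra. ring.
  - apply ccont_pair; [now apply (Cx x y D)|].
    apply (cont2_opp (dx (dy u)) x y). now apply (Cy x y D).
Qed.

(** * Weierstrass data and lengths of image curves *)


(** Since |e| |g| = |h|^2, the squared length of Y_x is exactly ((|e| + |g|) / 2)^2. This dominates
    (|e| / 2)^2 and, by the inequality between arithmetic and geometric means, |h|^2. The first
    bound is positive because exp F has no zeros, so Y is an immersion even where h vanishes. *)
Lemma weierstrass S u F F' : harmonic (dom S) u -> holo (dom S) F F' ->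
  exists Y1 Y2, conformal_minimal_immersion (dom S) Y1 Y2 u /\
    forall x y, dom S x y ->
      let s := dx Y1 x y ^ 2 + dx Y2 x y ^ 2 + dx u x y ^ 2 in
      (Cmod (cexp (F (x, y))) / 2) ^ 2 <= s /\ Cmod (wirtinger u (x, y)) ^ 2 <= s.
Proof.
  intros Hu HF. destruct (harmonic_holo S u Hu) as [h' Hh].
  set (h := wirtinger u) in *.
  set (e := fun z => cexp (F z)).
  set (g := fun z => (h z * h z * cexp (RtoC (-1) * F z))%C).
  pose proof (holo_cexp _ _ _ HF) as He.
  pose proof (holo_mult _ _ _ _ _ (holo_mult _ _ _ _ _ Hh Hh)
    (holo_cexp _ _ _ (holo_scal _ (RtoC (-1)) _ _ HF))) as Hg.
  destruct (holo_harmonic_primitive _ _ _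
    (holo_scal _ (RtoC (/ 2)) _ _ (holo_plus _ _ _ _ _ He (holo_scal _ (RtoC (-1)) _ _ Hg))))
    as [Y1 [H1 E1]].
  destruct (holo_harmonic_primitive _ _ _
    (holo_scal _ (0, / 2) _ _ (holo_plus _ _ _ _ _ He Hg)))
    as [Y2 [H2 E2]].
  assert (K : forall z, (e z * g z = h z * h z)%C).
  { intros z. unfold e, g. rewrite Cmult_comm, <- Cmult_assoc, <- cexp_plus.
    replace (RtoC (-1) * F z + F z)%C with (RtoC 0) by ring.
    rewrite cexp_0. ring. }
  assert (Main : forall x y, dom S x y ->
    let s := dx Y1 x y ^ 2 + dx Y2 x y ^ 2 + dx u x y ^ 2 in
    s = dy Y1 x y ^ 2 + dy Y2 x y ^ 2 + dy u x y ^ 2 /\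
    dx Y1 x y * dy Y1 x y + dx Y2 x y * dy Y2 x y + dx u x y * dy u x y = 0 /\
    (Cmod (e (x, y)) / 2) ^ 2 <= s /\ Cmod (h (x, y)) ^ 2 <= s).
  { intros x y D s. unfold s.
    destruct (E1 x y D) as [-> ->]. destruct (E2 x y D) as [-> ->].
    pose proof (K (x, y)) as Kz.
    replace (dx u x y) with (fst (h (x, y))) by reflexivity.
    replace (dy u x y) with (- snd (h (x, y)))
      by (unfold h, wirtinger; simpl; ring).
    change (cexp (F (x, y))) with (e (x, y)).
    change (h (x, y) * h (x, y) * cexp (RtoC (-1) * F (x, y)))%C with (g (x, y)).
    assert (Km : Cmod (e (x, y)) * Cmod (g (x, y)) = Cmod (h (x, y)) ^ 2).
    { rewrite <- Cmod_mult, Kz, Cmod_mult. ring. }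
    pose proof (Cmod_sqr (e (x, y))) as Me. pose proof (Cmod_sqr (g (x, y))) as Mg.
    pose proof (Cmod_sqr (h (x, y))) as Mh.
    destruct (e (x, y)) as [e1 e2], (g (x, y)) as [g1 g2], (h (x, y)) as [h1 h2].
    unfold Cmult in Kz. simpl fst in *. simpl snd in *. injection Kz as K1 K2.
    set (me := Cmod (e1, e2)) in *. set (mg := Cmod (g1, g2)) in *.
    set (mh := Cmod (h1, h2)) in *.
    pose proof (pow2_ge_0 (me - mg)) as P.
    pose proof (pow2_ge_0 mg). pose proof (pow2_ge_0 mh).
    repeat split; simpl fst; simpl snd; nra. }
  exists Y1, Y2. split.
  - split; [exact H1|split; [exact H2|split; [exact Hu|]]].
    intros x y D. destruct (Main x y D) as [M1 [M2 [M3 M4]]].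
    split; [exact M1|split; [exact M2|]].
    assert (0 < Cmod (e (x, y))) by (apply Cmod_gt_0, cexp_neq_0).
    simpl in *. nra.
  - intros x y D. now apply (Main x y D).
Qed.

(** * Lower bounds for the length of image curves *)

Fixpoint endpoint (a : R) (l : list R) : R :=
  match l with nil => a | t :: l' => endpoint t l' end.

(** A lower bound for the length over [a, b], kept as a witnessing polygon. Such bounds concatenate,
    and rectifiability of the image curve never has to be discussed. *)
Definition gain (c : R -> R * R * R) (a b x : R) : Prop :=
  exists l, increasing_from a l /\ endpoint a l = b /\ x <= poly_len c a l.

Lemma dist3_nonneg p q : 0 <= dist3 p q.
Proof. destruct p as [[p1 p2] p3], q as [[q1 q2] q3]. apply sqrt_pos. Qed.

Lemma gain_le c a b x y : y <= x -> gain c a b x -> gain c a b y.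
Proof. intros H [l [H1 [H2 H3]]]. exists l. repeat split; auto; lra. Qed.

Lemma gain_trans c a b d x y : gain c a b x -> gain c b d y -> gain c a d (x + y).
Proof.
  intros [l [H1 [H2 H3]]] [l' [H1' [H2' H3']]]. exists (l ++ l').
  revert a x H1 H2 H3. induction l as [|t l IH]; simpl; intros a x H1 H2 H3.
  - subst. repeat split; auto; lra.
  - destruct H1 as [Hat Hl].
    destruct (IH t (x - dist3 (c a) (c t)) Hl H2) as [A1 [A2 A3]]; [lra|].
    repeat split; auto. lra.
Qed.

(** Vertices increase strictly, so a degenerate interval is witnessed by the empty list and
    contributes 0. *)
Lemma gain_step c a b : a <= b -> gain c a b (if Req_EM_T a b then 0 else dist3 (c a) (c b)).
Proof.
  intros H. destruct (Req_EM_T a b) as [->|Hn].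
  - exists nil. simpl. repeat split; lra.
  - exists (b :: nil). simpl. repeat split; lra.
Qed.

Lemma gain_0 c a b : a <= b -> gain c a b 0.
Proof.
  intros H. eapply gain_le; [|now apply gain_step].
  destruct (Req_EM_T a b); [lra|apply dist3_nonneg].
Qed.

Lemma gain_order c a b x : gain c a b x -> a <= b.
Proof.
  intros [l [H1 [H2 _]]]. revert a H1 H2. induction l as [|t l IH]; simpl; intros.
  - lra.
  - destruct H1. specialize (IH t). intuition lra.
Qed.

Lemma gain_infinite_length c :
  (forall M, exists a b, 0 <= a /\ b < 1 /\ gain c a b M) -> infinite_length c.
Proof.
  intros H M. destruct (H (M + 1)) as [a [b [Ha [Hb [l [H1 [H2 H3]]]]]]].
  exists a, l. repeat split; auto; [|lra].
  clear Ha H3. revert a H1 H2. induction l as [|t l IH]; intros a H1 H2; constructor.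
  - destruct H1 as [_ H1].
    (* The rest of the polygon runs from [t] to [b], which gives t <= b and hence t < 1. *)
    assert (gain c t b 0); [|apply gain_order in H0; lra].
    exists l. repeat split; auto. clear -H1. revert t H1.
    induction l as [|s l IH]; simpl; intros; [lra|].
    pose proof (dist3_nonneg (c t) (c s)). destruct H1 as [_ H1]. specialize (IH s H1). lra.
  - destruct H1 as [_ H1]. now apply IH with t.
Qed.

Definition curve (Y1 Y2 Y3 : R -> R -> R) (g : R -> R * R) (t : R) : R * R * R :=
  (Y1 (fst (g t)) (snd (g t)), Y2 (fst (g t)) (snd (g t)), Y3 (fst (g t)) (snd (g t))).

(** A conformal differential stretches all vectors by one factor, here at least [mu]; close to [p]
    the linearisation error costs at most half of it. *)
Lemma conformal_local_expansion Y1 Y2 Y3 (p : C) a1 a2 a3 b1 b2 b3 mu : 0 < mu ->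
  differentiable2 Y1 p a1 b1 -> differentiable2 Y2 p a2 b2 -> differentiable2 Y3 p a3 b3 ->
  a1 ^ 2 + a2 ^ 2 + a3 ^ 2 = b1 ^ 2 + b2 ^ 2 + b3 ^ 2 ->
  a1 * b1 + a2 * b2 + a3 * b3 = 0 ->
  mu ^ 2 <= a1 ^ 2 + a2 ^ 2 + a3 ^ 2 ->
  exists d, 0 < d /\ forall w : C, Cmod (w - p) < d ->
    mu / 2 * Cmod (w - p) <=
    dist3 (Y1 (fst w) (snd w), Y2 (fst w) (snd w), Y3 (fst w) (snd w))
          (Y1 (fst p) (snd p), Y2 (fst p) (snd p), Y3 (fst p) (snd p)).
Proof.
  intros Hmu D1 D2 D3 Hc Ho Hs.
  destruct (D1 (mu / 4)) as [d1 [P1 Q1]]; [lra|].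
  destruct (D2 (mu / 4)) as [d2 [P2 Q2]]; [lra|].
  destruct (D3 (mu / 4)) as [d3 [P3 Q3]]; [lra|].
  exists (Rmin d1 (Rmin d2 d3)). split; [repeat apply Rmin_pos; auto|].
  intros w Hw.
  assert (W1 : Cmod (w - p) < d1) by (eapply Rlt_le_trans; [exact Hw|apply Rmin_l]).
  assert (W2 : Cmod (w - p) < d2)
    by (eapply Rlt_le_trans; [exact Hw|eapply Rle_trans; [apply Rmin_r|apply Rmin_l]]).
  assert (W3 : Cmod (w - p) < d3)
    by (eapply Rlt_le_trans; [exact Hw|eapply Rle_trans; [apply Rmin_r|apply Rmin_r]]).
  specialize (Q1 w W1). specialize (Q2 w W2). specialize (Q3 w W3).
  pose proof (Cmod_sqr (w - p)) as M. simpl fst in M; simpl snd in M.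
  pose proof (Cmod_ge_0 (w - p)) as M0.
  set (m := Cmod (w - p)) in *.
  unfold dist3. rewrite <- (sqrt_pow2 (mu / 2 * m)) by nra.
  apply sqrt_le_1_alt.
  set (v1 := fst w - fst p) in *. set (v2 := snd w - snd p) in *.
  replace (fst w + - fst p) with v1 in M by (unfold v1; ring).
  replace (snd w + - snd p) with v2 in M by (unfold v2; ring).
  set (k1 := Y1 (fst w) (snd w) - Y1 (fst p) (snd p)) in *.
  set (k2 := Y2 (fst w) (snd w) - Y2 (fst p) (snd p)) in *.
  set (k3 := Y3 (fst w) (snd w) - Y3 (fst p) (snd p)) in *.
  (* This is (2 k - l)^2 >= 0. Summed over three coordinates, the lower bound in units of (mu m)^2
     is 1/2 - 3/16 = 5/16, above the required 1/4. *)
  assert (B : forall k l, Rabs (k - l) <= mu / 4 * m ->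
    l ^ 2 / 2 - (mu / 4 * m) ^ 2 <= k ^ 2).
  { intros k l H.
    assert ((k - l) ^ 2 <= (mu / 4 * m) ^ 2).
    { rewrite <- (pow2_abs (k - l)). apply pow_incr. split; [apply Rabs_pos|exact H]. }
    pose proof (pow2_ge_0 (k + (k - l))). simpl in *. nra. }
  apply B in Q1. apply B in Q2. apply B in Q3.
  assert (L : (a1 * v1 + b1 * v2) ^ 2 + (a2 * v1 + b2 * v2) ^ 2 + (a3 * v1 + b3 * v2) ^ 2
    = (a1 ^ 2 + a2 ^ 2 + a3 ^ 2) * m ^ 2).
  { rewrite M.
    replace (_ + _ + _) with ((a1 ^ 2 + a2 ^ 2 + a3 ^ 2) * v1 ^ 2
      + (b1 ^ 2 + b2 ^ 2 + b3 ^ 2) * v2 ^ 2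
      + 2 * (a1 * b1 + a2 * b2 + a3 * b3) * (v1 * v2)) by ring.
    rewrite <- Hc, Ho. ring. }
  assert (mu ^ 2 * m ^ 2 <= (a1 ^ 2 + a2 ^ 2 + a3 ^ 2) * m ^ 2).
  { apply Rmult_le_compat_r; auto. apply pow2_ge_0. }
  pose proof (pow2_ge_0 (mu * m)).
  replace ((mu / 2 * m) ^ 2) with (mu ^ 2 * m ^ 2 / 4) by field.
  replace ((mu / 4 * m) ^ 2) with (mu ^ 2 * m ^ 2 / 16) in * by field.
  replace ((mu * m) ^ 2) with (mu ^ 2 * m ^ 2) in * by ring.
  lra.
Qed.

(** Lower bounds by the displacement |g b - g a| survive subdivision because of the triangle
    inequality, and the local expansion supplies them between [t] and nearby parameters. Real
    induction joins the two. *)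
Lemma gain_of_conformal S Y1 Y2 Y3 g a b mu : 0 < mu -> a <= b ->
  conformal_minimal_immersion (dom S) Y1 Y2 Y3 ->
  (forall t, a <= t <= b -> continuous g t /\ dom S (fst (g t)) (snd (g t)) /\
    mu ^ 2 <= dx Y1 (fst (g t)) (snd (g t)) ^ 2 + dx Y2 (fst (g t)) (snd (g t)) ^ 2
      + dx Y3 (fst (g t)) (snd (g t)) ^ 2) ->
  gain (curve Y1 Y2 Y3 g) a b (mu / 2 * Cmod (g b - g a)).
Proof.
  intros Hmu Hab [[[H1 _] _] [[[H2 _] _] [[[H3 _] _] Hc]]] Hg.
  apply (real_induction a b (fun s t => gain (curve Y1 Y2 Y3 g) s t (mu / 2 * Cmod (g t - g s)))); auto.
  - intros x y z _ _ _ _ G1 G2. eapply gain_le; [|eapply gain_trans; eauto].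
    rewrite <- Rmult_plus_distr_l. apply Rmult_le_compat_l; [lra|].
    replace (g z - g x)%C with ((g y - g x) + (g z - g y))%C by ring.
    apply Cmod_triangle.
  - intros t Ht. destruct (Hg t Ht) as [Gc [Gd Gm]].
    destruct (Hc _ _ Gd) as [C1 [C2 _]].
    destruct (conformal_local_expansion Y1 Y2 Y3 (g t) _ _ _ _ _ _ mu Hmu
      (eq_ind_r (fun p => differentiable2 Y1 p _ _) (C1_on_differentiable2 S _ _ _ H1 Gd) (Ceta (g t)))
      (eq_ind_r (fun p => differentiable2 Y2 p _ _) (C1_on_differentiable2 S _ _ _ H2 Gd) (Ceta (g t)))
      (eq_ind_r (fun p => differentiable2 Y3 p _ _) (C1_on_differentiable2 S _ _ _ H3 Gd) (Ceta (g t)))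
      C1 C2 Gm) as [r [Hr Hw]].
    assert (L : locally (g t : C_UniformSpace) (fun w : C => Cmod (w - g t) < r)).
    { apply locally_Cmod. now exists r. }
    destruct (Gc _ L) as [d Hd]. exists d. split; [apply cond_pos|].
    intros s Hs Hsd. specialize (Hd s Hsd).
    specialize (Hw (g s) Hd).
    assert (Sym : forall p q, dist3 p q = dist3 q p).
    { intros [[p1 p2] p3] [[q1 q2] q3]. unfold dist3. f_equal. ring. }
    split; intros Hst; (eapply gain_le; [|apply gain_step; exact Hst]).
    + destruct (Req_EM_T s t) as [->|_].
      * replace (g t - g t)%C with (RtoC 0) by ring. rewrite Cmod_0. lra.
      * rewrite Cmod_minus_sym. exact Hw.
    + destruct (Req_EM_T t s) as [->|_].
      * replace (g s - g s)%C with (RtoC 0) by ring. rewrite Cmod_0. lra.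
      * rewrite Sym. exact Hw.
Qed.

(** * Compactness of closed disks and divergent curves *)

Lemma Bolzano_Weierstrass_subseq (s : nat -> R) B : (forall n, Rabs (s n) <= B) ->
  exists (phi : nat -> nat) l, (forall n, (phi n < phi (S n))%nat) /\
    forall e, 0 < e -> exists N, forall n, (N <= n)%nat -> Rabs (s (phi n) - l) < e.
Proof.
  intros HB.
  destruct (Bolzano_Weierstrass s (fun c => - B <= c <= B) (compact_P3 (- B) B)) as [l Hl].
  { intros n. now apply Rabs_le_between. }
  assert (Hex : forall Nk : nat * nat, exists p : nat,
    (fst Nk <= p)%nat /\ Rabs (s p - l) < / (INR (snd Nk) + 1)).
  { intros [N k]. simpl.
    assert (P : 0 < / (INR k + 1)).
    { apply Rinv_0_lt_compat. pose proof (pos_INR k). lra. }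
    destruct (Hl (fun x => Rabs (x - l) < / (INR k + 1)) N) as [p [Hp Hp']].
    - exists (mkposreal _ P). intros x Hx. exact Hx.
    - now exists p. }
  set (f := fun Nk => proj1_sig (constructive_indefinite_description _ (Hex Nk))).
  assert (Hf : forall N k, (N <= f (N, k))%nat /\ Rabs (s (f (N, k)) - l) < / (INR k + 1)).
  { intros N k. exact (proj2_sig (constructive_indefinite_description _ (Hex (N, k)))). }
  (* Searching from [S (phi k)] onwards makes the indices strictly increasing, while the tolerance
     shrinks with the step number. *)
  set (phi := fix phi n := match n with
    | O => f (O, O) | S k => f (S (phi k), S k) end).
  exists phi, l. split.
  - intros n. simpl. destruct (Hf (S (phi n)) (S n)). lia.
  - intros e He. destruct (nfloor_ex (/ e)) as [N HN].
    { left. now apply Rinv_0_lt_compat. }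
    exists N. intros n Hn.
    assert (Hphi : Rabs (s (phi n) - l) < / (INR n + 1)).
    { destruct n; apply Hf. }
    eapply Rlt_trans; [exact Hphi|].
    rewrite <- (Rinv_inv e). apply Rinv_lt_contravar.
    + apply Rmult_lt_0_compat; [now apply Rinv_0_lt_compat|].
      pose proof (pos_INR n). lra.
    + apply le_INR in Hn. lra.
Qed.

Lemma strictly_increasing_ge (phi : nat -> nat) :
  (forall n, (phi n < phi (S n))%nat) -> forall n, (n <= phi n)%nat.
Proof. intros H n. induction n; [lia|]. specialize (H n). lia. Qed.

Lemma strictly_increasing_lt (phi : nat -> nat) :
  (forall n, (phi n < phi (S n))%nat) -> forall m n, (m < n)%nat -> (phi m < phi n)%nat.
Proof. intros H m n Hmn. induction Hmn; [apply H|]. specialize (H m0). lia. Qed.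

Lemma Bolzano_Weierstrass_C (s : nat -> C) B : (forall n, Cmod (s n) <= B) ->
  exists (phi : nat -> nat) (p : C), (forall n, (phi n < phi (S n))%nat) /\
    forall e, 0 < e -> exists N, forall n, (N <= n)%nat -> Cmod (s (phi n) - p) < e.
Proof.
  intros HB.
  destruct (Bolzano_Weierstrass_subseq (fun n => fst (s n)) B) as [f [x [Hf Lx]]].
  { intros n. eapply Rle_trans; [apply re_le_Cmod|apply HB]. }
  destruct (Bolzano_Weierstrass_subseq (fun n => snd (s (f n))) B) as [g [y [Hg Ly]]].
  { intros n. eapply Rle_trans; [apply im_le_Cmod|apply HB]. }
  exists (fun n => f (g n)), (x, y). split.
  - intros n. now apply strictly_increasing_lt.
  - intros e He. destruct (Lx (e / 2)) as [N1 H1]; [lra|].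
    destruct (Ly (e / 2)) as [N2 H2]; [lra|].
    exists (max N1 N2). intros n Hn.
    pose proof (strictly_increasing_ge g Hg n).
    specialize (H1 (g n) ltac:(lia)). specialize (H2 n ltac:(lia)).
    eapply Rle_lt_trans; [apply Cmod_lt_sum|]. simpl. unfold Rminus in *. lra.
Qed.

Lemma Cmod_limit_le (s : nat -> C) (phi : nat -> nat) p B :
  (forall n, Cmod (s n) <= B) ->
  (forall e, 0 < e -> exists N, forall n, (N <= n)%nat -> Cmod (s (phi n) - p) < e) ->
  Cmod p <= B.
Proof.
  intros HB HL. apply Rnot_lt_le. intros H.
  destruct (HL (Cmod p - B)) as [N HN]; [lra|].
  specialize (HN N (le_n _)). specialize (HB (phi N)).
  rewrite Cmod_minus_sym in HN. pose proof (Cmod_triangle_inv p (s (phi N))). lra.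
Qed.

Lemma compact2_disk B : compact2 (fun x y => Cmod (x, y) <= B).
Proof.
  intros s Hs.
  assert (Hs' : forall n, Cmod (s n) <= B) by (intros n; rewrite (Ceta (s n)); apply Hs).
  destruct (Bolzano_Weierstrass_C s B Hs') as [phi [p [Hphi HL]]].
  exists phi, p. split; [exact Hphi|split].
  - rewrite <- (Ceta p). now apply Cmod_limit_le with s phi.
  - intros P HP. apply (proj1 (locally_Cmod p P)) in HP. destruct HP as [d [Hd HP]].
    destruct (HL d Hd) as [N HN]. exists N. intros n Hn. now apply HP, HN.
Qed.

Lemma divergent_leaves_disk Om g B : divergent_curve Om g ->
  (forall x y, Cmod (x, y) <= B -> Om x y) ->
  forall a, 0 <= a < 1 -> exists b, a <= b < 1 /\ B < Cmod (g b).
Proof.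
  intros [_ Hd] HB a Ha. destruct (Hd _ (compact2_disk B) HB) as [t0 [Ht0 H]].
  exists (Rmax a t0). unfold Rmax. destruct (Rle_dec a t0).
  - split; [lra|]. apply Rnot_le_lt. intros Hc. apply (H t0); [lra|].
    now rewrite <- (Ceta (g t0)).
  - split; [lra|]. apply Rnot_le_lt. intros Hc. apply (H a); [lra|].
    now rewrite <- (Ceta (g a)).
Qed.

Lemma plane_complete Y1 Y2 Y3 mu : 0 < mu ->
  conformal_minimal_immersion (dom PlaneC) Y1 Y2 Y3 ->
  (forall x y, mu ^ 2 <= dx Y1 x y ^ 2 + dx Y2 x y ^ 2 + dx Y3 x y ^ 2) ->
  complete_immersion (dom PlaneC) Y1 Y2 Y3.
Proof.
  intros Hmu HY Hm g Hg. apply gain_infinite_length. intros M.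
  (* The radius is such that the displacement from [g 0], multiplied by mu / 2, exceeds |M|. *)
  destruct (divergent_leaves_disk _ g (Cmod (g 0) + 2 * Rabs M / mu) Hg ltac:(simpl; auto) 0)
    as [b [Hb Hbig]]; [lra|].
  exists 0, b. split; [lra|split; [lra|]].
  eapply gain_le; [|apply (gain_of_conformal PlaneC Y1 Y2 Y3 g 0 b mu); auto; try lra].
  - pose proof (Cmod_triangle_inv (g b) (g 0)). pose proof (Rle_abs M).
    assert (E : mu / 2 * (2 * Rabs M / mu) = Rabs M) by (field; lra).
    assert (mu / 2 * (2 * Rabs M / mu) <= mu / 2 * Cmod (g b - g 0))
      by (apply Rmult_le_compat_l; lra).
    lra.
  - intros t Ht. split; [apply Hg; lra|split; [exact I|apply Hm]].
Qed.

(** * Crossing times of continuous functions *)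

Lemma continuous_lt_locally (f : R -> R) t c : continuous f t -> f t < c ->
  exists d, 0 < d /\ forall s, Rabs (s - t) < d -> f s < c.
Proof.
  intros Hf H. destruct (Hf (fun y => y < c)) as [d Hd].
  - now apply open_lt.
  - exists d. split; [apply cond_pos|]. intros s Hs. now apply Hd.
Qed.

Lemma continuous_gt_locally (f : R -> R) t c : continuous f t -> c < f t ->
  exists d, 0 < d /\ forall s, Rabs (s - t) < d -> c < f s.
Proof.
  intros Hf H. destruct (Hf (fun y => c < y)) as [d Hd].
  - now apply open_gt.
  - exists d. split; [apply cond_pos|]. intros s Hs. now apply Hd.
Qed.

Lemma last_time_below (f : R -> R) a b c : a <= b ->
  (forall t, a <= t <= b -> continuous f t) -> f a <= c -> c <= f b ->
  exists s, a <= s <= b /\ f s = c /\ forall t, s <= t <= b -> c <= f t.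
Proof.
  intros Hab Hf Ha Hb.
  destruct (completeness (fun t => a <= t <= b /\ f t <= c)) as [s [Hub Hlub]].
  { exists b. intros t [Ht _]. lra. }
  { exists a. split; lra. }
  assert (Hs : a <= s <= b).
  { split; [apply Hub; split; lra|]. apply Hlub. intros t [Ht _]. lra. }
  assert (H1 : f s <= c).
  { apply Rnot_lt_le. intros H. destruct (continuous_gt_locally f s c (Hf s Hs) H) as [d [Hd Hw]].
    assert (s <= s - d); [|lra]. apply Hlub. intros t [Ht Hc].
    apply Rnot_lt_le. intros Hlt.
    assert (t <= s) by (apply Hub; now split).
    assert (c < f t); [|lra]. apply Hw. apply Rabs_def1; lra. }
  assert (H2 : forall t, s < t <= b -> c < f t).
  { intros t Ht. apply Rnot_le_lt. intros H.
    assert (t <= s); [|lra]. apply Hub. split; lra. }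
  assert (H3 : c <= f s).
  { destruct (Rle_lt_or_eq_dec s b) as [Hlt|E]; [lra| |now rewrite E].
    apply Rnot_lt_le. intros H.
    destruct (continuous_lt_locally f s c (Hf s Hs) H) as [d [Hd Hw]].
    set (t := Rmin b (s + d / 2)).
    assert (Hst : s < t) by (apply Rmin_glb_lt; lra).
    assert (Htb : t <= b) by apply Rmin_l.
    assert (t <= s + d / 2) by apply Rmin_r.
    assert (f t < c) by (apply Hw; apply Rabs_def1; lra).
    specialize (H2 t ltac:(lra)). lra. }
  exists s. split; [exact Hs|split; [lra|]].
  intros t Ht. destruct (Rle_lt_or_eq_dec s t) as [Hlt|<-]; [lra| |exact H3].
  left. apply H2. lra.
Qed.

Lemma first_time_above (f : R -> R) a b c : a <= b ->
  (forall t, a <= t <= b -> continuous f t) -> f a <= c -> c <= f b ->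
  exists s, a <= s <= b /\ f s = c /\ forall t, a <= t <= s -> f t <= c.
Proof.
  intros Hab Hf Ha Hb.
  (* Reversing both time and values turns a first time above [c] into a last time below -c. *)
  destruct (last_time_below (fun t => - f (- t)) (- b) (- a) (- c)) as [s [Hs [E H]]]; try lra.
  - intros t Ht. apply (continuous_opp (V := R_NormedModule)).
    apply (continuous_comp (fun t => - t) f).
    + apply (continuous_opp (V := R_NormedModule)). apply continuous_id.
    + apply Hf. lra.
  - rewrite Ropp_involutive. lra.
  - rewrite Ropp_involutive. lra.
  - exists (- s). split; [lra|split; [lra|]]. intros t Ht.
    specialize (H (- t)). rewrite Ropp_involutive in H. lra.
Qed.

(** Starting at the last time at level [c] and stopping at the first later time at level [d]
    confines the values to the band in between. *)
Lemma crossing (f : R -> R) a b c d : a <= b -> c <= d ->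
  (forall t, a <= t <= b -> continuous f t) -> f a <= c -> d <= f b ->
  exists s t, a <= s /\ s <= t /\ t <= b /\ f s = c /\ f t = d /\
    forall r, s <= r <= t -> c <= f r <= d.
Proof.
  intros Hab Hcd Hf Ha Hb.
  destruct (last_time_below f a b c) as [s [Hs [Es Ps]]]; auto; [lra|].
  destruct (first_time_above f s b d) as [t [Ht [Et Pt]]]; try lra.
  - intros t Ht. apply Hf. lra.
  - exists s, t. repeat split; try lra; [apply Ps|apply Pt]; lra.
Qed.

(** * Maximum principle and zeros *)


Definition circ (p : C) (s t : R) : C := (p + RtoC s * cexp (0%R, t))%C.

Lemma Cmod_unit t : Cmod (cexp (0, t)) = 1.
Proof. rewrite Cmod_cexp. apply exp_0. Qed.

Lemma Cmod_circ p s t : Cmod (circ p s t - p) = Rabs s.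
Proof.
  unfold circ. replace (p + RtoC s * cexp (0%R, t) - p)%C with (RtoC s * cexp (0%R, t))%C by ring.
  rewrite Cmod_mult, Cmod_unit, Cmod_R. ring.
Qed.

Lemma circ_ccont p (w : C) : ccont (fun w : C => circ p (fst w) (snd w)) w.
Proof.
  assert (H1 : continuous (fun w : C_UniformSpace => fst w) w) by exact (ccont_re _ _ (ccont_id w)).
  assert (H2 : continuous (fun w : C_UniformSpace => snd w) w) by exact (ccont_im _ _ (ccont_id w)).
  unfold circ. apply ccont_plus; [apply ccont_const|]. apply ccont_mult.
  - apply ccont_pair; [exact H1|apply continuous_const].
  - apply (ccont_comp (fun w : C => ((0, snd w) : C)) cexp); [|apply cexp_ccont].
    apply ccont_pair; [apply continuous_const|exact H2].
Qed.

(** The integral J(s) over the circle has derivative the integral of Re (f' e^(it)). Times s, this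
    integrand is the t derivative of Im f along the circle, which integrates to 0 over a period. So
    J is constant and equals its value at s = 0. *)
Lemma mean_value (f f' : C -> C) (p : C) (r s : R) : 0 < s < r ->
  (forall z, Cmod (z - p) < r -> cderiv f z (f' z) /\ ccont f' z) ->
  RInt (fun t => fst (f (circ p s t))) 0 (2 * PI) = 2 * PI * fst (f p).
Proof.
  intros Hs Hf.
  set (g := fun s t => fst (f (circ p s t))).
  set (D := fun s t => fst (f' (circ p s t) * cexp (0, t))%C).
  assert (Hin : forall s t, Rabs s < r -> Cmod (circ p s t - p) < r)
    by (intros; now rewrite Cmod_circ).
  assert (Dg : forall s t, Rabs s < r -> is_derive (fun s => g s t) s (D s t)).
  { intros u t Hu. destruct (Hf _ (Hin u t Hu)) as [Hd _].
    assert (Hc : cderiv (fun w => f (p + w * cexp (0, t))%C) (u, 0) (f' (circ p u t) * cexp (0, t))%C).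
    { eapply (cderiv_comp (fun w => p + w * cexp (0, t))%C f); [|exact Hd].
      exists (fun _ => cexp (0, t)). repeat split; auto using ccont_const. intros w. ring. }
    exact (proj1 (cderiv_partials _ _ _ _ Hc)). }
  assert (Dc : forall s t, Rabs s < r -> cont2 D s t).
  { intros u t Hu. destruct (Hf _ (Hin u t Hu)) as [_ Hc].
    apply (ccont_re (fun w : C => f' (circ p (fst w) (snd w)) * cexp (0%R, snd w))%C (u, t)).
    apply ccont_mult.
    - apply ccont_comp; [apply circ_ccont|exact Hc].
    - apply (ccont_comp (fun w : C => ((0, snd w) : C)) cexp); [|apply cexp_ccont].
      apply ccont_pair; [apply continuous_const|exact (ccont_im _ _ (ccont_id _))]. }
  assert (Cg : forall s t, Rabs s < r -> ccont (fun t => f (circ p s t)) t).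
  { intros u t Hu. destruct (Hf _ (Hin u t Hu)) as [Hd _].
    apply (ccont_comp (fun t => circ p u t) f); [|now apply cderiv_ccont in Hd].
    apply (continuous_comp (fun t : R => ((u, t) : C_UniformSpace)) (fun w : C => circ p (fst w) (snd w))).
    - apply continuous_vline.
    - apply (circ_ccont p (u, t)). }
  assert (Loc : forall s, Rabs s < r -> locally s (fun s => Rabs s < r)).
  { intros u Hu. assert (P : 0 < r - Rabs u) by lra. exists (mkposreal _ P).
    intros v Hv. change (Rabs (v - u) < r - Rabs u) in Hv.
    pose proof (Rabs_triang (v - u) u). rewrite Rplus_comm, Rplus_minus in H. lra. }
  assert (DJ : forall s, Rabs s < r ->
    is_derive (fun s => RInt (fun t => g s t) 0 (2 * PI)) s (RInt (fun t => D s t) 0 (2 * PI))).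
  { intros u Hu.
    replace (RInt (fun t => D u t) 0 (2 * PI)) with
      (RInt (fun t => Derive (fun s => g s t) u) 0 (2 * PI)).
    - apply (is_derive_RInt_param g 0 (2 * PI) u).
      + apply (filter_imp (fun s => Rabs s < r)); [|now apply Loc].
        intros v Hv t _. exists (D v t). now apply Dg.
      + intros t _. apply continuity_2d_pt_filterlim.
        change (cont2 (fun u v => Derive (fun z => g z v) u) u t).
        apply continuous_ext_loc with (g := fun w : C_UniformSpace => D (fst w) (snd w));
          [|now apply Dc].
        apply (filter_imp (fun w : C => Rabs (fst w) < r)).
        * intros w Hw. symmetry. now apply is_derive_unique, Dg.
        * exact (continuous_fst u t _ (Loc u Hu)).
      + apply (filter_imp (fun s => Rabs s < r)); [|now apply Loc].
        intros v Hv. apply (ex_RInt_continuous (V := R_CompleteNormedModule)).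
        intros t _. exact (ccont_re _ _ (Cg v t Hv)).
    - apply RInt_ext. intros t _. now apply is_derive_unique, Dg. }
  assert (Zero : forall s, 0 < s < r -> RInt (fun t => D s t) 0 (2 * PI) = 0).
  { intros u Hu. assert (Hu' : Rabs u < r) by (rewrite Rabs_pos_eq; lra).
    assert (I : forall t, is_derive (fun t => snd (f (circ p u t))) t (u * D u t)).
    { intros t. destruct (Hf _ (Hin u t Hu')) as [Hd _].
      assert (Hc : cderiv (fun w => f (p + RtoC u * cexp w)%C) (0, t)
        (f' (circ p u t) * (RtoC u * cexp (0, t)))%C).
      { eapply (cderiv_comp (fun w => p + RtoC u * cexp w)%C f); [|exact Hd].
        destruct (cexp_cderiv (0, t)) as [q [E [Q H]]].
        exists (fun w => RtoC u * q w)%C. rewrite E. split; [reflexivity|split].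
        - apply ccont_mult; auto using ccont_const.
        - intros w. rewrite (H w). ring. }
      destruct (cderiv_partials _ _ _ _ Hc) as [_ [_ [_ H]]].
      replace (u * D u t) with (fst (f' (circ p u t) * (RtoC u * cexp (0, t)))%C); [exact H|].
      unfold D. simpl. ring. }
    assert (E : RInt (fun t => u * D u t) 0 (2 * PI) = 0).
    { rewrite (RInt_ext _ (Derive (fun t => snd (f (circ p u t))))).
      - rewrite RInt_Derive.
        + replace (circ p u (2 * PI)) with (circ p u 0); [apply Rminus_diag|].
          unfold circ, cexp. simpl fst; simpl snd. now rewrite cos_2PI, sin_2PI, cos_0, sin_0.
        + intros t _. exists (u * D u t). apply I.
        + intros t _. apply (continuous_ext (fun t => u * D u t)).
          * intros v. symmetry. now apply is_derive_unique.
          * apply (continuous_mult (K := R_AbsRing)); [apply continuous_const|].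
            apply (continuous_comp (fun t : R => ((u, t) : C_UniformSpace)) (fun w : C => D (fst w) (snd w)));
              [apply continuous_vline|now apply Dc].
      - intros t _. symmetry. now apply is_derive_unique. }
    assert (Ex : ex_RInt (fun t => D u t) 0 (2 * PI)).
    { apply (ex_RInt_continuous (V := R_CompleteNormedModule)). intros t _.
      apply (continuous_comp (fun t : R => ((u, t) : C_UniformSpace)) (fun w : C => D (fst w) (snd w)));
        [apply continuous_vline|now apply Dc]. }
    pose proof (RInt_scal (V := R_CompleteNormedModule) (fun t => D u t) 0 (2 * PI) u Ex) as Sc.
    change (RInt (fun t => u * D u t) 0 (2 * PI) = u * RInt (fun t => D u t) 0 (2 * PI)) in Sc.
    rewrite E in Sc. symmetry in Sc. apply Rmult_integral in Sc. destruct Sc; lra. }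
  destruct (MVT_gen (fun s => RInt (fun t => g s t) 0 (2 * PI)) 0 s (fun _ => 0)) as [c [_ Hc]].
  - rewrite Rmin_left, Rmax_right by lra. intros x Hx.
    assert (H : Rabs x < r) by (rewrite Rabs_pos_eq; lra).
    apply DJ in H. rewrite Zero in H by lra. exact H.
  - rewrite Rmin_left, Rmax_right by lra. intros x Hx.
    assert (H : Rabs x < r) by (rewrite Rabs_pos_eq; lra).
    apply continuity_pt_filterlim.
    apply (ex_derive_continuous (V := R_NormedModule) (fun s => RInt (fun t => g s t) 0 (2 * PI))).
    eexists. exact (DJ x H).
  - transitivity (RInt (fun t => g 0 t) 0 (2 * PI)); [unfold g in *; lra|].
    rewrite (RInt_ext _ (fun _ => fst (f p))).
    + rewrite RInt_const. unfold scal; simpl; unfold mult; simpl. ring.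
    + intros t _. unfold g, circ. f_equal. f_equal. ring.
Qed.

Lemma mean_value_le (f f' : C -> C) (p : C) (r s K : R) : 0 < s < r ->
  (forall z, Cmod (z - p) < r -> cderiv f z (f' z) /\ ccont f' z) ->
  (forall z, Cmod (z - p) = s -> fst (f z) <= K) -> fst (f p) <= K.
Proof.
  intros Hs Hf HK. pose proof (mean_value f f' p r s Hs Hf) as E.
  assert (L : RInt (fun t => fst (f (circ p s t))) 0 (2 * PI) <= RInt (fun _ => K) 0 (2 * PI)).
  { pose proof PI_RGT_0. apply RInt_le; [lra| | |].
    - apply (ex_RInt_continuous (V := R_CompleteNormedModule)). intros t _.
      apply (ccont_re (fun t => f (circ p s t))).
      apply (ccont_comp (fun t => circ p s t) f).
      + apply (continuous_comp (fun t : R => ((s, t) : C_UniformSpace)) (fun w : C => circ p (fst w) (snd w))).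
        * apply continuous_vline.
        * apply (circ_ccont p (s, t)).
      + apply cderiv_ccont with (f' (circ p s t)). apply Hf. rewrite Cmod_circ, Rabs_pos_eq; lra.
    - apply ex_RInt_const.
    - intros t _. apply HK. rewrite Cmod_circ, Rabs_pos_eq; lra. }
  rewrite E, RInt_const in L. unfold scal in L; simpl in L; unfold mult in L; simpl in L.
  pose proof PI_RGT_0. nra.
Qed.

Lemma disk_max (Phi : C -> R) (B : R) : 0 <= B ->
  (forall z : C, Cmod z <= B -> continuous (Phi : C_UniformSpace -> R) z) ->
  exists p, Cmod p <= B /\ forall z, Cmod z <= B -> Phi z <= Phi p.
Proof.
  intros HB HP.
  (* Composing with [atan] makes the values bounded in advance, so a supremum exists before [Phi] is
     known to be bounded. *)
  destruct (completeness (fun y => exists z, Cmod z <= B /\ y = atan (Phi z))) as [m [Hub Hlub]].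
  { exists (PI / 2). intros y [z [_ ->]]. left. apply atan_bound. }
  { exists (atan (Phi 0%C)), 0%C. split; [now rewrite Cmod_0|reflexivity]. }
  assert (Hseq : forall n : nat, exists z, Cmod z <= B /\ m - / (INR n + 1) < atan (Phi z)).
  { intros n. apply NNPP. intros Hn.
    assert (0 < / (INR n + 1)) by (apply Rinv_0_lt_compat; pose proof (pos_INR n); lra).
    assert (m <= m - / (INR n + 1)); [|lra]. apply Hlub. intros y [z [Hz ->]].
    apply Rnot_lt_le. intros Hlt. apply Hn. now exists z. }
  set (s := fun n => proj1_sig (constructive_indefinite_description _ (Hseq n))).
  assert (Hs : forall n, Cmod (s n) <= B /\ m - / (INR n + 1) < atan (Phi (s n))).
  { intros n. exact (proj2_sig (constructive_indefinite_description _ (Hseq n))). }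
  destruct (Bolzano_Weierstrass_C s B) as [phi [p [Hphi HL]]]; [intros; apply Hs|].
  assert (Hp : Cmod p <= B) by (apply Cmod_limit_le with s phi; auto; intros; apply Hs).
  exists p. split; [exact Hp|]. intros z Hz.
  assert (Hm : m <= atan (Phi p)).
  { apply Rnot_lt_le. intros Hlt.
    assert (Cp : continuous (fun w : C_UniformSpace => atan (Phi w)) p)
      by (apply (continuous_comp Phi atan); [now apply HP|apply continuous_atan]).
    set (e := (m - atan (Phi p)) / 2).
    assert (He : 0 < e) by (unfold e; lra).
    assert (Lc : locally (p : C_UniformSpace) (fun w => atan (Phi w) < m - e)).
    { apply (Cp (fun y => y < m - e)). apply open_lt. unfold e; lra. }
    apply locally_Cmod in Lc. destruct Lc as [d [Hd Lc]].
    destruct (HL d Hd) as [N HN].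
    destruct (nfloor_ex (/ e)) as [K HK].
    { left. now apply Rinv_0_lt_compat. }
    set (n := max N K).
    specialize (HN n ltac:(lia)). apply Lc in HN.
    destruct (Hs (phi n)) as [_ Hn].
    assert (/ (INR (phi n) + 1) <= e).
    { rewrite <- (Rinv_inv e). apply Rinv_le_contravar; [now apply Rinv_0_lt_compat|].
      pose proof (strictly_increasing_ge phi Hphi n).
      assert (K <= phi n)%nat as HKn by lia. apply le_INR in HKn. lra. }
    lra. }
  apply Rnot_lt_le. intros Hlt. apply atan_increasing in Hlt.
  assert (atan (Phi z) <= m); [|lra]. apply Hub. now exists z.
Qed.

(** A local notion beside [holo]: the Blaschke quotients below are holomorphic only away from
    finitely many points. *)
Definition holat (f : C -> C) (p : C) : Prop :=
  exists f', locally (p : C_UniformSpace) (fun z => cderiv f z (f' z) /\ ccont f' z).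

Lemma holat_ccont f p : holat f p -> ccont f p.
Proof.
  intros [f' H]. apply locally_singleton in H. simpl in H. now apply cderiv_ccont with (f' p).
Qed.

Lemma holo_holat S f f' (p : C) : holo (dom S) f f' -> dom S (fst p) (snd p) -> holat f p.
Proof.
  intros H D. exists f'. apply (filter_imp (fun w : C => dom S (fst w) (snd w))); auto.
  now apply dom_open.
Qed.

Lemma holat_mult f g p : holat f p -> holat g p -> holat (fun z => f z * g z)%C p.
Proof.
  intros [f' Hf] [g' Hg]. exists (fun z => f' z * g z + f z * g' z)%C.
  generalize (filter_and _ _ Hf Hg). apply filter_imp. intros z [[A1 A2] [B1 B2]].
  pose proof (cderiv_ccont _ _ _ A1). pose proof (cderiv_ccont _ _ _ B1).
  split; auto using cderiv_mult, ccont_plus, ccont_mult.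
Qed.

Lemma holat_affine (a b p : C) : holat (fun z => a + b * z)%C p.
Proof.
  exists (fun _ => b). apply filter_forall. intros z. split; [|apply ccont_const].
  exists (fun _ => b). split; [reflexivity|split; [apply ccont_const|intros; ring]].
Qed.

Lemma holat_ext f g p : (forall z, f z = g z) -> holat f p -> holat g p.
Proof.
  intros E [f' H]. exists f'. revert H. apply filter_imp. intros z [H1 H2].
  split; auto. now apply cderiv_ext with f.
Qed.

Lemma holat_inv f p : holat f p -> f p <> 0%C -> holat (fun z => / f z)%C p.
Proof.
  intros Hf H0. pose proof (holat_ccont _ _ Hf) as Hc. destruct Hf as [f' Hf].
  exists (fun z => - / (f z * f z) * f' z)%C.
  assert (Hn : locally (p : C_UniformSpace) (fun z => f z <> 0%C)).
  { apply ccont_Cmod in Hc. apply Cmod_gt_0 in H0.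
    apply (filter_imp (fun z => 0 < Cmod (f z))).
    - intros z Hz. now apply Cmod_gt_0.
    - exact (Hc (fun y => 0 < y) (open_gt 0 (Cmod (f p)) H0)). }
  generalize (filter_and _ _ Hf Hn). apply filter_imp. intros z [[A1 A2] A3]. split.
  - apply (cderiv_comp f Cinv); auto. now apply cderiv_inv.
  - apply cderiv_ccont in A1. apply ccont_mult; auto. apply ccont_opp.
    apply ccont_inv; [now apply ccont_mult|now apply Cmult_neq_0].
Qed.

(* Perturbing [|G|] by [eta |z|^2] makes an interior maximum violate the mean value inequality. *)
Lemma maximum_principle (G : C -> C) (B M : R) : 0 < B -> 0 <= M ->
  (forall z, Cmod z <= B -> ccont G z) ->
  (forall z, Cmod z < B -> G z = 0%C \/ holat G z) ->
  (forall z, Cmod z = B -> Cmod (G z) <= M) ->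
  forall z, Cmod z <= B -> Cmod (G z) <= M.
Proof.
  intros HB HM Hc Hh Hbd z0 Hz0. apply Rnot_lt_le. intros Hlt.
  (* Small enough that eta |z|^2 stays below the assumed excess |G z0| - M on the disk, so the
     perturbed maximum cannot lie on the boundary. *)
  set (eta := (Cmod (G z0) - M) / (2 * (B ^ 2 + 1))).
  assert (HB2 : 0 < B ^ 2 + 1) by nra.
  assert (Heta : 0 < eta) by (unfold eta; apply Rdiv_lt_0_compat; lra).
  assert (HetaB : eta * B ^ 2 < Cmod (G z0) - M).
  { assert (eta * (2 * (B ^ 2 + 1)) = Cmod (G z0) - M) by (unfold eta; field; lra). nra. }
  destruct (disk_max (fun z => Cmod (G z) + eta * (Cmod z * Cmod z)) B) as [p [Hp Hmax]]; [lra| |].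
  { intros z Hz. apply (continuous_plus (V := R_NormedModule)).
    - now apply ccont_Cmod, Hc.
    - apply (continuous_mult (K := R_AbsRing)); [apply continuous_const|].
      apply (continuous_mult (K := R_AbsRing)); apply ccont_Cmod, ccont_id. }
  pose proof (Hmax z0 Hz0) as H0. cbv beta in H0.
  pose proof (Cmod_ge_0 z0). pose proof (Cmod_ge_0 p).
  assert (0 <= eta * (Cmod z0 * Cmod z0)) by nra.
  assert (eta * (Cmod p * Cmod p) <= eta * B ^ 2) by (apply Rmult_le_compat_l; nra).
  destruct (Rle_lt_or_eq_dec _ _ Hp) as [Hin|E]; [|specialize (Hbd p E); lra].
  (* The same excess excludes zeros of [G] as maximum points, which is why holomorphy may fail at
     them. *)
  destruct (classic (G p = 0%C)) as [E|Hne]; [rewrite E, Cmod_0 in H0; lra|].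
  destruct (Hh p Hin) as [E|[f' Hf]]; [contradiction|].
  apply locally_Cmod in Hf. destruct Hf as [r [Hr Hf]].
  set (s := Rmin (r / 2) ((B - Cmod p) / 2)).
  assert (Hs : 0 < s) by (apply Rmin_pos; lra).
  assert (Hsr : s <= r / 2) by apply Rmin_l.
  assert (HsB : s <= (B - Cmod p) / 2) by apply Rmin_r.
  assert (Hg : 0 < Cmod (G p)) by now apply Cmod_gt_0.
  (* A rotation that makes c G(p) real and positive: Re (c G) <= |G|, with equality at [p]. *)
  set (c := (Cconj (G p) / RtoC (Cmod (G p)))%C).
  assert (Hgc : RtoC (Cmod (G p)) <> 0%C) by (intros E; apply RtoC_inj in E; lra).
  assert (Hc1 : Cmod c = 1).
  { unfold c. rewrite Cmod_div by exact Hgc. rewrite Cmod_conj, Cmod_R, Rabs_pos_eq by lra.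
    field. lra. }
  assert (Hcp : (c * G p)%C = RtoC (Cmod (G p))).
  { unfold c. replace (Cconj (G p) / RtoC (Cmod (G p)) * G p)%C
      with (G p * Cconj (G p) / RtoC (Cmod (G p)))%C by (field; exact Hgc).
    rewrite <- Cmod2_conj. rewrite RtoC_pow. field. exact Hgc. }
  (* Since |z|^2 = 2 Re (conj p z) - |p|^2 + |z - p|^2, a linear holomorphic term can replace eta
     |z|^2. On the circle of radius [s] this leaves Re f below its value at the centre by at least
     eta s^2. *)
  set (f := fun z => (c * G z + RtoC (2 * eta) * (Cconj p * z))%C).
  assert (Hfp : fst (f p) = Cmod (G p) + 2 * eta * (Cmod p * Cmod p)).
  { unfold f. rewrite Hcp. pose proof (Cmod_sqr p) as E.
    replace (Cmod p * Cmod p) with (fst p ^ 2 + snd p ^ 2) by (rewrite <- E; ring).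
    simpl. ring. }
  assert (fst (f p) <= Cmod (G p) + 2 * eta * (Cmod p * Cmod p) - eta * s ^ 2).
  2:{ assert (0 < eta * s ^ 2) by (apply Rmult_lt_0_compat; [|apply pow_lt]; assumption). lra. }
  apply (mean_value_le f (fun z => c * f' z + RtoC (2 * eta) * Cconj p)%C p r s); [lra| |].
  - intros z Hz. destruct (Hf z Hz) as [A1 A2]. split.
    + replace (c * f' z + RtoC (2 * eta) * Cconj p)%C with
        ((0 * G z + c * f' z) + (0 * (Cconj p * z)
          + RtoC (2 * eta) * (0 * z + Cconj p * 1)))%C by ring.
      apply cderiv_plus; [apply cderiv_mult; auto using cderiv_const|].
      apply (cderiv_mult (fun _ => RtoC (2 * eta)) (fun z => Cconj p * z)%C); auto using cderiv_const.
      apply (cderiv_mult (fun _ => Cconj p) (fun z => z)%C); auto using cderiv_const, cderiv_id.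
    + auto using ccont_plus, ccont_mult, ccont_const.
  - intros z Hz.
    assert (HzB : Cmod z <= B) by (pose proof (Cmod_triangle_inv z p); lra).
    specialize (Hmax z HzB). cbv beta in Hmax.
    assert (R1 : fst (c * G z)%C <= Cmod (G z)).
    { eapply Rle_trans; [apply Rle_abs|]. eapply Rle_trans; [apply re_le_Cmod|].
      rewrite Cmod_mult, Hc1. lra. }
    assert (R2 : 2 * fst (Cconj p * z)%C = Cmod z * Cmod z + Cmod p * Cmod p - s ^ 2).
    { rewrite <- Hz. pose proof (Cmod_sqr z). pose proof (Cmod_sqr p).
      rewrite Cmod_sqr. simpl in *. nra. }
    unfold f. change (fst (c * G z)%C + fst (RtoC (2 * eta) * (Cconj p * z))%C
      <= Cmod (G p) + 2 * eta * (Cmod p * Cmod p) - eta * s ^ 2).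
    replace (fst (RtoC (2 * eta) * (Cconj p * z))%C) with (eta * (2 * fst (Cconj p * z)%C))
      by (simpl; ring).
    rewrite R2. lra.
Qed.

(* Inverse Blaschke factor of the disk of radius [B]; it takes the junk value [0] at its pole [a]. *)
Definition blaschke_inv (B : R) (a z : C) : C :=
  ((RtoC (B ^ 2) - Cconj a * z) / (RtoC B * (z - a)))%C.

Lemma Cinv_0 : (/ 0)%C = 0%C.
Proof. apply Ceq; simpl; unfold Rdiv; ring. Qed.

Lemma Cminus_neq_0 (z a : C) : z <> a -> (z - a)%C <> 0%C.
Proof. intros H E. apply H. replace z with (z - a + a)%C by ring. rewrite E. ring. Qed.

Lemma blaschke_inv_pole B a : blaschke_inv B a a = 0%C.
Proof.
  unfold blaschke_inv, Cdiv. replace (RtoC B * (a - a))%C with (RtoC 0) by ring.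
  rewrite Cinv_0. ring.
Qed.

Lemma RtoC_neq_0 (B : R) : B <> 0 -> RtoC B <> 0%C.
Proof. intros H E. now apply RtoC_inj in E. Qed.

Lemma blaschke_inv_holat B a z : B <> 0 -> z <> a -> holat (blaschke_inv B a) z.
Proof.
  intros HB Hz. apply holat_mult.
  - eapply holat_ext; [|apply (holat_affine (RtoC (B ^ 2)) (- Cconj a))].
    intros w. simpl. ring.
  - apply holat_inv.
    + eapply holat_ext; [|apply (holat_affine (- (RtoC B * a)) (RtoC B))].
      intros w. simpl. ring.
    + apply Cmult_neq_0; [now apply RtoC_neq_0|now apply Cminus_neq_0].
Qed.

(** Rests on |B^2 - conj a z|^2 = B^2 |z - a|^2 + (B^2 - |z|^2) (B^2 - |a|^2). Both uses can be read
    off: modulus 1 on |z| = B, and a definite excess over 1 when z and a are inside. *)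
Lemma blaschke_inv_Cmod B a z : B <> 0 -> z <> a ->
  Cmod (blaschke_inv B a z) ^ 2 =
  1 + (B ^ 2 - Cmod z ^ 2) * (B ^ 2 - Cmod a ^ 2) / (B ^ 2 * Cmod (z - a) ^ 2).
Proof.
  intros HB Hz.
  assert (Hd : (z - a)%C <> 0%C) by now apply Cminus_neq_0.
  assert (Hm : Cmod (z - a) <> 0) by (apply Cmod_gt_0 in Hd; lra).
  unfold blaschke_inv. rewrite Cmod_div by (apply Cmult_neq_0; auto using RtoC_neq_0).
  rewrite Cmod_mult, Cmod_R.
  replace ((Cmod (RtoC (B ^ 2) - Cconj a * z) / (Rabs B * Cmod (z - a))) ^ 2) with
    (Cmod (RtoC (B ^ 2) - Cconj a * z) ^ 2 / (Rabs B ^ 2 * Cmod (z - a) ^ 2)).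
  2:{ field. split; auto. now apply Rabs_no_R0. }
  rewrite pow2_abs.
  replace (Cmod (RtoC (B ^ 2) - Cconj a * z) ^ 2) with
    (B ^ 2 * Cmod (z - a) ^ 2 + (B ^ 2 - Cmod z ^ 2) * (B ^ 2 - Cmod a ^ 2)).
  - field. auto.
  - rewrite !Cmod_sqr. simpl. ring.
Qed.

(* [h] vanishes at [a], so [h^2] cancels the pole. *)
Lemma blaschke_inv_cancel B (h : C -> C) (a l : C) : B <> 0 -> cderiv h a l -> h a = 0%C ->
  ccont (fun z => h z * h z * blaschke_inv B a z)%C a.
Proof.
  intros HB [q [_ [Qc E]]] H0.
  (* One factor z - a survives and gives the value 0 at [a], in agreement with the junk value. With
     a single [h] the limit at a simple zero would be nonzero and the function would jump. *)
  apply ccont_ext with (f := fun z => (q z * q z * (z - a)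
    * ((RtoC (B ^ 2) - Cconj a * z) * / RtoC B))%C).
  - intros z. destruct (classic (z = a)) as [->|Hn].
    + rewrite blaschke_inv_pole. ring.
    + rewrite (E z), H0. unfold blaschke_inv. field.
      split; [now apply Cminus_neq_0|now apply RtoC_neq_0].
  - apply ccont_mult; [apply ccont_mult; [now apply ccont_mult|]|apply ccont_mult].
    + apply ccont_minus; [apply ccont_id|apply ccont_const].
    + apply ccont_minus; [apply ccont_const|].
      apply ccont_mult; [apply ccont_const|apply ccont_id].
    + apply ccont_const.
Qed.

Fixpoint blaschke_prod (B : R) (a : nat -> C) (k : nat) (z : C) : C :=
  match k with
  | O => 1%C
  | S k => (blaschke_prod B a k z * blaschke_inv B (a k) z)%C
  end.

Lemma blaschke_prod_pole B a k j : (j < k)%nat -> blaschke_prod B a k (a j) = 0%C.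
Proof.
  induction k as [|k IH]; [lia|]. intros Hj. simpl.
  destruct (PeanoNat.Nat.eq_dec j k) as [->|Hn].
  - rewrite blaschke_inv_pole. ring.
  - rewrite IH by lia. ring.
Qed.

Lemma blaschke_prod_holat B a k z : B <> 0 -> (forall j, (j < k)%nat -> z <> a j) ->
  holat (blaschke_prod B a k) z.
Proof.
  intros HB. induction k as [|k IH]; intros Hz; simpl.
  - eapply holat_ext; [|apply (holat_affine 1%C 0%C)]. intros w. simpl. ring.
  - apply holat_mult.
    + apply IH. intros j Hj. apply Hz. lia.
    + apply blaschke_inv_holat; auto.
Qed.

(** Distinctness of the zeros ensures that only one factor has its pole at a given zero; all others
    are continuous there. *)
Lemma blaschke_prod_cancel B a k (h : C -> C) : B <> 0 ->
  (forall i j, a i = a j -> i = j) ->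
  (forall j, exists l, cderiv h (a j) l) -> (forall j, h (a j) = 0%C) ->
  forall j, (j < k)%nat -> ccont (fun z => h z * h z * blaschke_prod B a k z)%C (a j).
Proof.
  intros HB Inj Hd H0. induction k as [|k IH]; [lia|]. intros j Hj.
  destruct (PeanoNat.Nat.eq_dec j k) as [->|Hn]; simpl.
  - destruct (Hd k) as [l Hl].
    apply ccont_ext with (f := fun z => (h z * h z * blaschke_inv B (a k) z * blaschke_prod B a k z)%C).
    + intros z. ring.
    + apply ccont_mult; [now apply blaschke_inv_cancel with l|].
      apply holat_ccont, blaschke_prod_holat; auto.
      intros i Hi E. apply Inj in E. lia.
  - apply ccont_ext with (f := fun z => (h z * h z * blaschke_prod B a k z * blaschke_inv B (a k) z)%C).
    + intros z. ring.
    + apply ccont_mult; [apply IH; lia|].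
      apply holat_ccont, blaschke_inv_holat; auto.
Qed.

Lemma blaschke_prod_ge B a k z Q : B <> 0 -> 0 <= Q ->
  (forall j, Q <= Cmod (blaschke_inv B (a j) z) ^ 2) ->
  Q ^ k <= Cmod (blaschke_prod B a k z) ^ 2.
Proof.
  intros HB HQ H. induction k as [|k IH]; simpl blaschke_prod.
  - rewrite Cmod_1. simpl. lra.
  - rewrite Cmod_mult, Rpow_mult_distr, <- tech_pow_Rmult, Rmult_comm.
    apply Rmult_le_compat; auto using pow_le.
Qed.

Lemma blaschke_prod_circle B a k z : B <> 0 -> Cmod z = Rabs B ->
  (forall j, z <> a j) -> Cmod (blaschke_prod B a k z) = 1.
Proof.
  intros HB Hz Ha. induction k as [|k IH]; simpl.
  - apply Cmod_1.
  - rewrite Cmod_mult, IH, Rmult_1_l.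
    assert (E : Cmod (blaschke_inv B (a k) z) ^ 2 = 1 ^ 2).
    { rewrite blaschke_inv_Cmod by auto. rewrite Hz, pow2_abs.
      rewrite Rminus_diag. unfold Rdiv. ring. }
    pose proof (Cmod_ge_0 (blaschke_inv B (a k) z)). nra.
Qed.

Lemma dom_disk_Cmod (z : C) : Cmod z < 1 -> dom DiskD (fst z) (snd z).
Proof.
  intros H. pose proof (Cmod_sqr z). pose proof (Cmod_ge_0 z). simpl in *. nra.
Qed.

(** Blaschke's argument. Dividing out zeros keeps the bound M^2 of h^2 on the circle |z| = B, hence
    inside, while at [z0] every factor multiplies the modulus by a fixed amount above 1. Infinitely
    many factors are incompatible with h(z0) <> 0. *)
Lemma holo_few_zeros h h' (a : nat -> C) r : holo (dom DiskD) h h' ->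
  (forall i j, a i = a j -> i = j) -> (forall j, Cmod (a j) <= r) -> r < 1 ->
  (forall j, h (a j) = 0%C) -> forall z, Cmod z < 1 -> h z = 0%C.
Proof.
  intros Hh Inj Ha Hr H0 z0 Hz0. apply NNPP. intros Hne.
  set (B := (1 + Rmax r (Cmod z0)) / 2).
  assert (B1 : B < 1 /\ r < B /\ Cmod z0 < B).
  { pose proof (Rmax_l r (Cmod z0)). pose proof (Rmax_r r (Cmod z0)).
    assert (Rmax r (Cmod z0) < 1) by now apply Rmax_lub_lt. unfold B. lra. }
  pose proof (Cmod_ge_0 z0) as P0. pose proof (Cmod_ge_0 (a O)) as Pa. pose proof (Ha O).
  assert (HB : B <> 0) by lra.
  assert (Hcont : forall z, Cmod z <= B -> ccont h z).
  { intros z Hz. apply (holo_ccont _ _ _ z Hh), dom_disk_Cmod. lra. }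
  destruct (disk_max (fun z => Cmod (h z)) B) as [pm [_ Hmax]]; [lra| |].
  { intros z Hz. now apply ccont_Cmod, Hcont. }
  set (M := Cmod (h pm)) in *.
  assert (HM : 0 <= M) by apply Cmod_ge_0.
  assert (Main : forall k, Cmod (h z0 * h z0 * blaschke_prod B a k z0) <= M * M).
  { intros k. apply (maximum_principle (fun z => h z * h z * blaschke_prod B a k z)%C B); try lra.
    - apply Rmult_le_pos; auto.
    - intros z Hz. destruct (classic (exists j, (j < k)%nat /\ z = a j)) as [[j [Hj ->]]|Hn].
      + apply blaschke_prod_cancel; auto. intros i. exists (h' (a i)).
        apply Hh, dom_disk_Cmod. specialize (Ha i). lra.
      + apply ccont_mult; [apply ccont_mult; auto|].
        apply holat_ccont, blaschke_prod_holat; auto.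
        intros j Hj E. apply Hn. now exists j.
    - intros z Hz. destruct (classic (exists j, (j < k)%nat /\ z = a j)) as [[j [Hj ->]]|Hn].
      + left. rewrite blaschke_prod_pole by auto. ring.
      + right. assert (holat h z).
        { apply (holo_holat DiskD h h'); auto. apply dom_disk_Cmod. lra. }
        apply holat_mult; [now apply holat_mult|].
        apply blaschke_prod_holat; auto. intros j Hj E. apply Hn. now exists j.
    - intros z Hz. rewrite !Cmod_mult, (blaschke_prod_circle B a k z), Rmult_1_r; auto.
      + apply Rmult_le_compat; auto using Cmod_ge_0; apply Hmax; lra.
      + rewrite Rabs_pos_eq; lra.
      + intros j ->. specialize (Ha j). lra. }
  (* A lower bound, uniform in j, for the squared modulus of the factors at [z0], from |a j| <= r
     and |z0 - a j| <= 2 B. *)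
  set (Q := 1 + (B ^ 2 - Cmod z0 ^ 2) * (B ^ 2 - r ^ 2) / (B ^ 2 * (2 * B) ^ 2)).
  assert (D1 : 0 < B ^ 2 - Cmod z0 ^ 2) by nra.
  assert (D2 : 0 < B ^ 2 - r ^ 2) by nra.
  assert (HQ : 1 < Q).
  { unfold Q. assert (0 < (B ^ 2 - Cmod z0 ^ 2) * (B ^ 2 - r ^ 2) / (B ^ 2 * (2 * B) ^ 2)); [|lra].
    apply Rdiv_lt_0_compat; [nra|]. apply Rmult_lt_0_compat; apply pow_lt; lra. }
  assert (HQb : forall j, Q <= Cmod (blaschke_inv B (a j) z0) ^ 2).
  { intros j. assert (Hn : z0 <> a j) by (intros ->; apply Hne, H0).
    rewrite blaschke_inv_Cmod by auto. unfold Q. apply Rplus_le_compat_l.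
    assert (Pd : 0 < Cmod (z0 - a j)) by now apply Cmod_gt_0, Cminus_neq_0.
    assert (Cmod (z0 - a j) <= 2 * B).
    { unfold Cminus. pose proof (Cmod_triangle z0 (- a j)). rewrite Cmod_opp in H1.
      specialize (Ha j). lra. }
    pose proof (Ha j). pose proof (Cmod_ge_0 (a j)).
    unfold Rdiv. apply Rmult_le_compat.
    - apply Rmult_le_pos; lra.
    - left. apply Rinv_0_lt_compat. apply Rmult_lt_0_compat; apply pow_lt; lra.
    - apply Rmult_le_compat_l; [lra|]. nra.
    - apply Rinv_le_contravar.
      + apply Rmult_lt_0_compat; apply pow_lt; lra.
      + apply Rmult_le_compat_l; [apply pow2_ge_0|]. apply pow_incr. lra. }
  assert (Hh0 : 0 < Cmod (h z0)) by now apply Cmod_gt_0.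
  (* N is so large that |h(z0)|^4 Q^N exceeds M^4. *)
  destruct (Pow_x_infinity Q) with (b := (M * M) ^ 2 / (Cmod (h z0) * Cmod (h z0)) ^ 2 + 1) as [N HN].
  { rewrite Rabs_pos_eq; lra. }
  specialize (HN N (le_n _)).
  pose proof (blaschke_prod_ge B a N z0 Q HB ltac:(lra) HQb) as Hge.
  specialize (Main N). rewrite !Cmod_mult in Main.
  rewrite Rabs_pos_eq in HN by (apply pow_le; lra).
  set (b := Cmod (blaschke_prod B a N z0)) in *. set (k := Cmod (h z0) * Cmod (h z0)) in *.
  assert (Hk : 0 < k) by (unfold k; nra).
  assert ((k * b) ^ 2 <= (M * M) ^ 2).
  { apply pow_incr. split; auto. apply Rmult_le_pos; [lra|apply Cmod_ge_0]. }
  assert (k ^ 2 * ((M * M) ^ 2 / k ^ 2 + 1) <= (M * M) ^ 2).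
  { apply Rle_trans with (k ^ 2 * b ^ 2); [|nra].
    apply Rmult_le_compat_l; [apply pow2_ge_0|lra]. }
  replace (k ^ 2 * ((M * M) ^ 2 / k ^ 2 + 1)) with ((M * M) ^ 2 + k ^ 2) in H2 by (field; lra).
  assert (0 < k ^ 2) by now apply pow_lt. lra.
Qed.

(** Otherwise every radius above [rho] carries a zero. Zeros on different circles are different, and
    radii taken at most (1 + rho) / 2 keep infinitely many of them in a smaller disk. *)
Lemma zero_free_circle h h' z0 rho : holo (dom DiskD) h h' ->
  Cmod z0 < 1 -> h z0 <> 0%C -> 0 <= rho < 1 ->
  exists r, rho < r < 1 /\ forall z, Cmod z = r -> h z <> 0%C.
Proof.
  intros Hh Hz0 Hne Hrho. apply NNPP. intros Hn.
  set (t := fun n : nat => rho + (1 - rho) / (INR n + 2)).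
  assert (Ht : forall n, rho < t n <= (1 + rho) / 2).
  { intros n. unfold t. pose proof (pos_INR n). split.
    - assert (0 < (1 - rho) / (INR n + 2)) by (apply Rdiv_lt_0_compat; lra). lra.
    - assert ((1 - rho) / (INR n + 2) <= (1 - rho) / 2); [|lra].
      apply Rmult_le_compat_l; [lra|]. apply Rinv_le_contravar; lra. }
  assert (Hex : forall n, exists z, Cmod z = t n /\ h z = 0%C).
  { intros n. apply NNPP. intros Hz. apply Hn. exists (t n). specialize (Ht n).
    split; [lra|]. intros z E E0. apply Hz. now exists z. }
  set (a := fun n => proj1_sig (constructive_indefinite_description _ (Hex n))).
  assert (Ha : forall n, Cmod (a n) = t n /\ h (a n) = 0%C).
  { intros n. exact (proj2_sig (constructive_indefinite_description _ (Hex n))). }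
  apply Hne. apply (holo_few_zeros h h' a ((1 + rho) / 2)); auto; try lra.
  - intros i j E. apply (f_equal Cmod) in E.
    rewrite (proj1 (Ha i)), (proj1 (Ha j)) in E. unfold t in E.
    apply Rplus_eq_reg_l in E. pose proof (pos_INR i). pose proof (pos_INR j).
    apply INR_eq. apply Rmult_eq_reg_l in E; [|lra].
    apply Rinv_eq_reg in E. lra.
  - intros j. rewrite (proj1 (Ha j)). apply Ht.
  - intros j. apply Ha.
Qed.

Definition has_good_annuli (h : C -> C) : Prop := forall rho, 0 <= rho < 1 ->
  exists r r' m, rho < r /\ r < r' /\ r' < 1 /\ 0 < m /\
    forall z, r <= Cmod z <= r' -> m <= Cmod (h z).

(** A zero-free circle thickens by compactness: points whose distance to the circle and whose value
    under [h] both tend to 0 would accumulate at a zero on the circle. The same 1 / (n + 1) scales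
    the width of the annulus and is the candidate for [m]. *)
Lemma good_annuli h h' z0 : holo (dom DiskD) h h' ->
  Cmod z0 < 1 -> h z0 <> 0%C -> has_good_annuli h.
Proof.
  intros Hh Hz0 Hne rho Hrho.
  destruct (zero_free_circle h h' z0 rho Hh Hz0 Hne Hrho) as [r [Hr Hz]].
  set (d := Rmin (r - rho) (1 - r) / 2).
  assert (Hd : 0 < d /\ rho < r - d /\ r + d < 1).
  { unfold d. pose proof (Rmin_l (r - rho) (1 - r)). pose proof (Rmin_r (r - rho) (1 - r)).
    assert (0 < Rmin (r - rho) (1 - r)) by (apply Rmin_pos; lra). lra. }
  apply NNPP. intros Hn.
  assert (Pn : forall n, 0 < / (INR n + 1) <= 1).
  { intros n. pose proof (pos_INR n). split; [apply Rinv_0_lt_compat; lra|].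
    rewrite <- Rinv_1 at 2. apply Rinv_le_contravar; lra. }
  assert (Hex : forall n, exists z, Rabs (Cmod z - r) <= d * / (INR n + 1)
    /\ Cmod (h z) < / (INR n + 1)).
  { intros n. specialize (Pn n). apply NNPP. intros Hz'. apply Hn.
    exists (r - d * / (INR n + 1)), (r + d * / (INR n + 1)), (/ (INR n + 1)).
    repeat split; try nra.
    intros z Hzr. apply Rnot_lt_le. intros Hlt. apply Hz'. exists z. split; auto.
    apply Rabs_le. lra. }
  set (s := fun n => proj1_sig (constructive_indefinite_description _ (Hex n))).
  assert (Hs : forall n, Rabs (Cmod (s n) - r) <= d * / (INR n + 1)
    /\ Cmod (h (s n)) < / (INR n + 1)).
  { intros n. exact (proj2_sig (constructive_indefinite_description _ (Hex n))). }
  assert (HsB : forall n, Cmod (s n) <= r + d).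
  { intros n. destruct (Hs n) as [H1 _]. specialize (Pn n). apply Rabs_le_between in H1. nra. }
  destruct (Bolzano_Weierstrass_C s (r + d) HsB) as [phi [p [Hphi HL]]].
  assert (Hp : Cmod p <= r + d) by (apply Cmod_limit_le with s phi; auto).
  assert (Small : forall e, 0 < e -> exists N, forall n, (N <= n)%nat -> / (INR (phi n) + 1) < e).
  { intros e He. destruct (nfloor_ex (/ e)) as [N HN].
    { left. now apply Rinv_0_lt_compat. }
    exists N. intros n Hn'. pose proof (strictly_increasing_ge phi Hphi n).
    assert (N <= phi n)%nat as HNn by lia. apply le_INR in HNn.
    rewrite <- (Rinv_inv e). apply Rinv_lt_contravar; [|lra].
    apply Rmult_lt_0_compat; [now apply Rinv_0_lt_compat|]. pose proof (pos_INR (phi n)). lra. }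
  apply (Hz p).
  - apply Rminus_diag_uniq. apply NNPP. intros Hc.
    assert (He : 0 < Rabs (Cmod p - r)) by now apply Rabs_pos_lt.
    set (e := Rabs (Cmod p - r)) in *.
    destruct (HL (e / 2)) as [N1 H1]; [lra|].
    destruct (Small (e / (2 * d))) as [N2 H2]; [apply Rdiv_lt_0_compat; lra|].
    specialize (H1 (max N1 N2) ltac:(lia)). specialize (H2 (max N1 N2) ltac:(lia)).
    destruct (Hs (phi (max N1 N2))) as [H3 _]. set (w := s (phi (max N1 N2))) in *.
    apply Rmult_lt_compat_l with (r := d) in H2; [|lra].
    replace (d * (e / (2 * d))) with (e / 2) in H2 by (field; lra).
    pose proof (Cmod_triangle_inv w p). pose proof (Cmod_triangle_inv p w) as H4.
    rewrite Cmod_minus_sym in H4.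
    assert (Rabs (Cmod p - Cmod w) < e / 2) by (apply Rabs_def1; lra).
    pose proof (Rabs_triang (Cmod p - Cmod w) (Cmod w - r)) as T.
    replace (Cmod p - Cmod w + (Cmod w - r)) with (Cmod p - r) in T by ring.
    fold e in T. lra.
  - apply NNPP. intros Hc. apply Cmod_gt_0 in Hc.
    assert (Hcp : ccont h p) by (apply (holo_ccont _ _ _ p Hh), dom_disk_Cmod; lra).
    destruct (proj1 (ccont_eps h p) Hcp (Cmod (h p) / 2)) as [d' [Hd' Hw]]; [lra|].
    destruct (HL d' Hd') as [N1 H1].
    destruct (Small (Cmod (h p) / 2)) as [N2 H2]; [lra|].
    specialize (H1 (max N1 N2) ltac:(lia)). specialize (H2 (max N1 N2) ltac:(lia)).
    destruct (Hs (phi (max N1 N2))) as [_ H3]. specialize (Hw _ H1).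
    rewrite Cmod_minus_sym in Hw.
    pose proof (Cmod_triangle_inv (h p) (h (s (phi (max N1 N2))))). lra.
Qed.

(** * Runge approximation *)


(* A polynomial [f] together with its divided difference [q z w = (f w - f z) / (w - z)]: a uniform bound on [q] controls [f'] along with the Lipschitz constant of [f]. *)
Inductive cpoly : (C -> C) -> (C -> C -> C) -> Prop :=
| cpoly_const c : cpoly (fun _ => c) (fun _ _ => 0%C)
| cpoly_id : cpoly (fun z => z) (fun _ _ => 1%C)
| cpoly_plus f q g r : cpoly f q -> cpoly g r ->
    cpoly (fun z => f z + g z)%C (fun z w => q z w + r z w)%C
| cpoly_mult f q g r : cpoly f q -> cpoly g r ->
    cpoly (fun z => f z * g z)%C (fun z w => q z w * g w + f z * r z w)%C.

Lemma cpoly_quotient f q : cpoly f q -> forall z w, f w = (f z + q z w * (w - z))%C.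
Proof.
  induction 1 as [c| |f q g r _ IHf _ IHg|f q g r _ IHf _ IHg]; intros z w; try ring.
  - rewrite (IHf z w), (IHg z w). ring.
  - replace (f z * g z + (q z w * g w + f z * r z w) * (w - z))%C with
      (q z w * (w - z) * g w + f z * (g z + r z w * (w - z)))%C by ring.
    rewrite <- IHg, (IHf z w). ring.
Qed.

Lemma cpoly_ccont f q : cpoly f q -> (forall z, ccont f z) /\
  forall p : C_UniformSpace * C_UniformSpace,
    ccont (fun p : prod_UniformSpace C_UniformSpace C_UniformSpace => q (fst p) (snd p)) p.
Proof.
  induction 1 as [c| |f q g r _ [F1 F2] _ [G1 G2]|f q g r _ [F1 F2] _ [G1 G2]];
    (split; [intros z|intros [z w]]).
  - apply ccont_const.
  - apply ccont_const.
  - apply ccont_id.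
  - apply ccont_const.
  - now apply ccont_plus.
  - apply ccont_plus; auto.
  - now apply ccont_mult.
  - apply ccont_plus; apply ccont_mult; auto.
    + apply ccont_comp; [apply continuous_snd|apply G1].
    + apply ccont_comp; [apply continuous_fst|apply F1].
Qed.

Definition bounded_by (X : C -> Prop) (f : C -> C) (q : C -> C -> C) (B : R) : Prop :=
  forall z w, X z -> X w -> Cmod (f z) <= B /\ Cmod (q z w) <= B.

Lemma Cmod_mult_le a b x y : Cmod a <= x -> Cmod b <= y -> Cmod (a * b) <= x * y.
Proof. intros. rewrite Cmod_mult. apply Rmult_le_compat; auto using Cmod_ge_0. Qed.

Lemma Cmod_plus_le a b x y : Cmod a <= x -> Cmod b <= y -> Cmod (a + b) <= x + y.
Proof. intros. eapply Rle_trans; [apply Cmod_triangle|lra]. Qed.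

Lemma cpoly_bounded B f q : cpoly f q ->
  exists M, 1 <= M /\ bounded_by (fun z => Cmod z <= B) f q M.
Proof.
  induction 1 as [c| |f q g r _ [M [HM HF]] _ [N [HN HG]]|f q g r _ [M [HM HF]] _ [N [HN HG]]].
  - exists (1 + Cmod c). pose proof (Cmod_ge_0 c). split; [lra|].
    intros z w _ _. rewrite Cmod_0. lra.
  - exists (1 + Rabs B). pose proof (Rabs_pos B). split; [lra|].
    intros z w Hz _. rewrite Cmod_1. pose proof (Rle_abs B). lra.
  - exists (M + N). split; [lra|]. intros z w Hz Hw.
    destruct (HF z w Hz Hw), (HG z w Hz Hw). auto using Cmod_plus_le.
  - exists (2 * (M * N)). split; [nra|]. intros z w Hz Hw.
    destruct (HF z w Hz Hw), (HG z w Hz Hw), (HG w z Hw Hz). split.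
    + apply Rle_trans with (M * N); [now apply Cmod_mult_le|nra].
    + replace (2 * (M * N)) with (M * N + M * N) by ring.
      apply Cmod_plus_le; now apply Cmod_mult_le.
Qed.

(** The divided difference is prescribed along with [f]: on the diagonal it is a derivative, which
    the values of [f] on [X] need not determine. *)
Definition appr (X : C -> Prop) (f : C -> C) (q : C -> C -> C) : Prop :=
  forall e, 0 < e -> exists p r, cpoly p r /\
    bounded_by X (fun z => f z - p z)%C (fun z w => q z w - r z w)%C e.

Section Approximation.
Variable X : C -> Prop.
Hypothesis X1 : forall z, X z -> Cmod z <= 1.

Lemma appr_poly f q : cpoly f q -> appr X f q.
Proof.
  intros H e He. exists f, q. split; auto. intros z w _ _.
  replace (f z - f z)%C with (RtoC 0) by ring.
  replace (q z w - q z w)%C with (RtoC 0) by ring.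
  rewrite Cmod_0. lra.
Qed.

Lemma appr_ext f q g r : (forall z, X z -> f z = g z) ->
  (forall z w, X z -> X w -> q z w = r z w) -> appr X f q -> appr X g r.
Proof.
  intros E1 E2 H e He. destruct (H e He) as [p [s [Hp Hb]]]. exists p, s.
  split; auto. intros z w Hz Hw. rewrite <- E1, <- E2 by auto. now apply Hb.
Qed.

Lemma appr_limit f q :
  (forall e, 0 < e -> exists p r, appr X p r /\
    bounded_by X (fun z => f z - p z)%C (fun z w => q z w - r z w)%C e) ->
  appr X f q.
Proof.
  intros H e He. destruct (H (e / 2)) as [p [r [Hp Hb]]]; [lra|].
  destruct (Hp (e / 2)) as [p' [r' [Hp' Hb']]]; [lra|].
  exists p', r'. split; auto. intros z w Hz Hw.
  destruct (Hb z w Hz Hw), (Hb' z w Hz Hw).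
  replace (f z - p' z)%C with ((f z - p z) + (p z - p' z))%C by ring.
  replace (q z w - r' z w)%C with ((q z w - r z w) + (r z w - r' z w))%C by ring.
  replace e with (e / 2 + e / 2) by field. auto using Cmod_plus_le.
Qed.

Lemma appr_bounded f q : appr X f q -> exists M, 1 <= M /\ bounded_by X f q M.
Proof.
  intros H. destruct (H 1) as [p [r [Hp Hb]]]; [lra|].
  destruct (cpoly_bounded 1 p r Hp) as [M [HM HB]].
  exists (1 + M). split; [lra|]. intros z w Hz Hw.
  destruct (Hb z w Hz Hw), (HB z w (X1 z Hz) (X1 w Hw)).
  replace (f z) with ((f z - p z) + p z)%C by ring.
  replace (q z w) with ((q z w - r z w) + r z w)%C by ring.
  auto using Cmod_plus_le.
Qed.

Lemma appr_plus f q g r : appr X f q -> appr X g r ->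
  appr X (fun z => f z + g z)%C (fun z w => q z w + r z w)%C.
Proof.
  intros Hf Hg e He. destruct (Hf (e / 2)) as [p [s [Hp Hb]]]; [lra|].
  destruct (Hg (e / 2)) as [p' [s' [Hp' Hb']]]; [lra|].
  exists (fun z => p z + p' z)%C, (fun z w => s z w + s' z w)%C.
  split; [now apply cpoly_plus|]. intros z w Hz Hw.
  destruct (Hb z w Hz Hw), (Hb' z w Hz Hw).
  replace (f z + g z - (p z + p' z))%C with ((f z - p z) + (g z - p' z))%C by ring.
  replace (q z w + r z w - (s z w + s' z w))%C with ((q z w - s z w) + (r z w - s' z w))%C by ring.
  replace e with (e / 2 + e / 2) by field. auto using Cmod_plus_le.
Qed.

Lemma Cmod_mult_approx a b a' b' M e : 0 <= e <= 1 -> Cmod a <= M -> Cmod b <= M ->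
  Cmod (a - a') <= e -> Cmod (b - b') <= e ->
  Cmod (a * b - a' * b') <= (2 * M + 1) * e.
Proof.
  intros He Ha Hb Ea Eb.
  assert (Hb' : Cmod b' <= M + e).
  { rewrite Cmod_minus_sym in Eb. pose proof (Cmod_triangle_inv b' b). lra. }
  replace (a * b - a' * b')%C with (a * (b - b') + (a - a') * b')%C by ring.
  eapply Rle_trans; [apply Cmod_plus_le; apply Cmod_mult_le; eauto|].
  pose proof (Cmod_ge_0 a). nra.
Qed.

Lemma appr_mult f q g r : appr X f q -> appr X g r ->
  appr X (fun z => f z * g z)%C (fun z w => q z w * g w + f z * r z w)%C.
Proof.
  intros Hf Hg e He.
  destruct (appr_bounded f q Hf) as [M1 [HM1 B1]].
  destruct (appr_bounded g r Hg) as [M2 [HM2 B2]].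
  set (M := M1 + M2).
  (* The divided difference of a product is a sum of two products, each with error (2 M + 1) d. *)
  set (d := Rmin 1 (e / (4 * M + 2))).
  assert (Hd : 0 < d).
  { apply Rmin_pos; [lra|]. apply Rdiv_lt_0_compat; unfold M; lra. }
  assert (Hd1 : d <= 1) by apply Rmin_l.
  assert (Hd2 : 2 * ((2 * M + 1) * d) <= e).
  { replace e with ((4 * M + 2) * (e / (4 * M + 2))) by (field; unfold M; lra).
    replace (2 * ((2 * M + 1) * d)) with ((4 * M + 2) * d) by ring.
    apply Rmult_le_compat_l; [unfold M; lra|apply Rmin_r]. }
  destruct (Hf d Hd) as [p [s [Hp Hb]]]. destruct (Hg d Hd) as [p' [s' [Hp' Hb']]].
  exists (fun z => p z * p' z)%C, (fun z w => s z w * p' w + p z * s' z w)%C.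
  split; [now apply cpoly_mult|]. intros z w Hz Hw.
  destruct (Hb z w Hz Hw) as [F1 F2], (Hb' z w Hz Hw) as [G1 G2], (Hb' w z Hw Hz) as [G3 _].
  destruct (B1 z w Hz Hw) as [F3 F4], (B2 z w Hz Hw) as [G4 G5], (B2 w z Hw Hz) as [G6 _].
  assert (Mp : forall a b a' b', Cmod a <= M1 -> Cmod b <= M2 ->
    Cmod (a - a') <= d -> Cmod (b - b') <= d -> Cmod (a * b - a' * b') <= (2 * M + 1) * d).
  { intros. apply Cmod_mult_approx; unfold M; lra. }
  split.
  - assert (Cmod (f z * g z - p z * p' z) <= (2 * M + 1) * d) by auto.
    assert (0 < (2 * M + 1) * d) by (apply Rmult_lt_0_compat; unfold M; lra). lra.
  - replace (q z w * g w + f z * r z w - (s z w * p' w + p z * s' z w))%C with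
      ((q z w * g w - s z w * p' w) + (f z * r z w - p z * s' z w))%C by ring.
    apply Rle_trans with ((2 * M + 1) * d + (2 * M + 1) * d); [|lra].
    apply Cmod_plus_le; auto.
Qed.

Lemma appr_const c : appr X (fun _ => c) (fun _ _ => 0%C).
Proof. apply appr_poly, cpoly_const. Qed.

Lemma appr_scal c f q : appr X f q ->
  appr X (fun z => c * f z)%C (fun z w => c * q z w)%C.
Proof.
  intros H. eapply appr_ext; [| |exact (appr_mult _ _ _ _ (appr_const c) H)].
  - reflexivity.
  - intros z w _ _. simpl. ring.
Qed.

Lemma Cmod_1_minus a t : Cmod a <= t -> 1 - t <= Cmod (1 - a).
Proof. intros H. pose proof (Cmod_triangle_inv 1 a). rewrite Cmod_1 in H0. lra. Qed.

(* The Horner iteration [S -> 1 + f S] for the geometric series contracts the error, measured as [c] times the error of the function plus the error of its divided difference. *)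
Lemma appr_inv f q t : t < 1 -> (forall z, X z -> Cmod (f z) <= t) -> appr X f q ->
  appr X (fun z => / (1 - f z))%C (fun z w => q z w * (/ (1 - f z) * / (1 - f w)))%C.
Proof.
  intros Ht Hft Hf.
  (* A point of [X] is what yields t >= 0; over an empty [X] any polynomial will do. *)
  destruct (classic (exists z, X z)) as [[z0 Hz0]|Hempty].
  2:{ intros e He. exists (fun _ => 0%C), (fun _ _ => 0%C). split; [apply cpoly_const|].
      intros z w Hz. exfalso. apply Hempty. now exists z. }
  assert (Ht0 : 0 <= t) by (eapply Rle_trans; [apply Cmod_ge_0|exact (Hft z0 Hz0)]).
  destruct (appr_bounded f q Hf) as [M [HM HB]].
  assert (Hinv : forall z, X z -> Cmod (/ (1 - f z)) <= / (1 - t) /\ (1 - f z)%C <> 0%C).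
  { intros z Hz. pose proof (Cmod_1_minus _ _ (Hft z Hz)).
    assert (Hn : (1 - f z)%C <> 0%C) by (apply Cmod_gt_0; lra).
    split; auto. rewrite Cmod_inv by auto. apply Rinv_le_contravar; lra. }
  set (K := / (1 - t)) in *.
  assert (HK : 0 < K) by (apply Rinv_0_lt_compat; lra).
  (* Chosen so that c (1 - t) = 2 M, hence c t + M = l c, and the weighted error c e + d shrinks by
     the factor [l] at each iteration. *)
  set (c := 2 * M * K). set (l := (1 + t) / 2).
  set (Q := fun z w => (q z w * (/ (1 - f z) * / (1 - f w)))%C).
  assert (HK1 : K * (1 - t) = 1) by (apply Rinv_l; lra).
  assert (Hc : 1 <= c) by (unfold c; nra).
  set (N0 := c * K + M * (K * K)).
  assert (Hn : forall n, exists p r, appr X p r /\ exists e d, 0 <= e /\ 0 <= d /\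
    c * e + d <= l ^ n * N0 /\
    (forall z, X z -> Cmod (/ (1 - f z) - p z) <= e) /\
    forall z w, X z -> X w -> Cmod (Q z w - r z w) <= d).
  { induction n as [|n [p [r [Hp [e [d [He [Hd [Hed [E1 E2]]]]]]]]]].
    - exists (fun _ => 0%C), (fun _ _ => 0%C). split; [apply appr_const|].
      exists K, (M * (K * K)). split; [lra|split; [nra|split; [simpl; unfold N0; lra|split]]].
      + intros z Hz. replace (/ (1 - f z) - 0)%C with (/ (1 - f z))%C by ring. now apply Hinv.
      + intros z w Hz Hw. replace (Q z w - 0)%C with (Q z w) by ring.
        apply Cmod_mult_le; [now apply HB|]. apply Cmod_mult_le; now apply Hinv.
    - eexists _, _. split; [exact (appr_plus _ _ _ _ (appr_const 1%C) (appr_mult _ _ _ _ Hf Hp))|].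
      exists (t * e), (M * e + t * d).
      split; [nra|split; [nra|split; [|split]]].
      + simpl. apply Rle_trans with (l * (c * e + d)).
        * assert (c * (1 - t) = 2 * M) by (unfold c; rewrite Rmult_assoc, HK1; ring).
          unfold l. nra.
        * rewrite Rmult_assoc. apply Rmult_le_compat_l; [unfold l; lra|exact Hed].
      + intros z Hz. destruct (Hinv z Hz) as [_ Hz1].
        replace (/ (1 - f z) - (1 + f z * p z))%C with (f z * (/ (1 - f z) - p z))%C
          by (field; exact Hz1).
        apply Cmod_mult_le; auto.
      + intros z w Hz Hw. destruct (Hinv z Hz) as [_ Hz1]. destruct (Hinv w Hw) as [_ Hw1].
        replace (Q z w - (0 + (q z w * p w + f z * r z w)))%C with
          (q z w * (/ (1 - f w) - p w) + f z * (Q z w - r z w))%C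
          by (unfold Q; field; auto).
        apply Cmod_plus_le; apply Cmod_mult_le; auto. now apply HB. }
  apply appr_limit. intros e He.
  assert (HN0 : 0 < N0) by (unfold N0; nra).
  destruct (pow_lt_1_zero l) with (y := e / N0) as [n Hn'].
  { unfold l. rewrite Rabs_pos_eq; lra. }
  { now apply Rdiv_lt_0_compat. }
  specialize (Hn' n (le_n n)).
  destruct (Hn n) as [p [r [Hp [e' [d' [He' [Hd' [Hed [E1 E2]]]]]]]]].
  exists p, r. split; auto.
  assert (Hsmall : l ^ n * N0 < e).
  { apply Rle_lt_trans with (Rabs (l ^ n) * N0).
    - apply Rmult_le_compat_r; [lra|apply Rle_abs].
    - apply Rmult_lt_compat_r with (r := N0) in Hn'; auto.
      replace (e / N0 * N0) with e in Hn' by (field; lra). exact Hn'. }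
  intros z w Hz Hw. specialize (E1 z Hz). specialize (E2 z w Hz Hw). fold (Q z w). split; nra.
Qed.

Definition pole_ok (b : C) : Prop :=
  appr X (fun z => / (z - b))%C (fun z w => - (/ (z - b) * / (w - b)))%C.

(** 1 / (z - b) = - (1 / b) / (1 - z / b), a geometric series with ratio at most 1/2 on [X]. *)
Lemma pole_ok_far b : 2 <= Cmod b -> pole_ok b.
Proof.
  intros Hb. assert (Hb0 : b <> 0%C) by (apply Cmod_gt_0; lra).
  assert (Hbi : Cmod (/ b) <= / 2) by (rewrite Cmod_inv by auto; apply Rinv_le_contravar; lra).
  assert (Hn : forall z, X z -> Cmod (/ b * z) <= / 2 /\ (z - b)%C <> 0%C).
  { intros z Hz. specialize (X1 z Hz). split.
    - replace (/ 2) with (/ 2 * 1) by ring. now apply Cmod_mult_le.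
    - apply Cminus_neq_0. intros ->. lra. }
  pose proof (appr_scal (/ b) _ _ (appr_poly _ _ cpoly_id)) as H1.
  apply appr_inv with (t := / 2) in H1; [|lra|intros; now apply Hn].
  apply (appr_scal (- / b)%C) in H1. revert H1. apply appr_ext.
  - intros z Hz. destruct (Hn z Hz) as [_ Hz1].
    assert ((b - z)%C <> 0%C).
    { intros E. apply Hz1. replace (z - b)%C with (- (b - z))%C by ring. rewrite E. ring. }
    field. repeat split; auto.
  - intros z w Hz Hw. destruct (Hn z Hz) as [_ Hz1]. destruct (Hn w Hw) as [_ Hw1].
    assert (forall z, (z - b)%C <> 0%C -> (b - z)%C <> 0%C).
    { intros u Hu E. apply Hu. replace (u - b)%C with (- (b - u))%C by ring. rewrite E. ring. }
    field. repeat split; auto.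
Qed.

(** 1 / (z - b') = (1 / (z - b)) / (1 - (b' - b) / (z - b)), again with ratio at most 1/2. *)
Lemma pole_ok_step b b' d : 0 < d -> (forall z, X z -> d <= Cmod (z - b)) ->
  Cmod (b' - b) <= d / 2 -> pole_ok b -> pole_ok b'.
Proof.
  intros Hd Hdist Hbb Hb.
  assert (Hn : forall z, X z -> (z - b)%C <> 0%C /\ (z - b')%C <> 0%C /\
    Cmod ((b' - b) * / (z - b)) <= / 2).
  { intros z Hz. specialize (Hdist z Hz).
    assert (Hzb : (z - b)%C <> 0%C) by (apply Cmod_gt_0; lra).
    split; [exact Hzb|split].
    - apply Cmod_gt_0. replace (z - b')%C with ((z - b) - (b' - b))%C by ring.
      pose proof (Cmod_triangle_inv (z - b) (b' - b)). lra.
    - replace (/ 2) with (d / 2 * / d) by (field; lra).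
      apply Cmod_mult_le; auto. rewrite Cmod_inv by auto. now apply Rinv_le_contravar. }
  pose proof (appr_scal (b' - b)%C _ _ Hb) as H1.
  apply appr_inv with (t := / 2) in H1; [|lra|intros; now apply Hn].
  pose proof (appr_mult _ _ _ _ Hb H1) as H2. revert H2. apply appr_ext.
  - intros z Hz. destruct (Hn z Hz) as [H2 [H3 _]]. field. repeat split; auto.
  - intros z w Hz Hw. destruct (Hn z Hz) as [H2 [H3 _]]. destruct (Hn w Hw) as [H4 [H5 _]].
    field. repeat split; auto.
Qed.

(** One lower bound [d] for the distance to [X] allows steps of size d / 2 all along the path, and
    real induction transports the pole. *)
Lemma pole_ok_path (g : R -> C) d : 0 < d -> (forall t, ccont g t) ->
  (forall t z, 0 <= t <= 1 -> X z -> d <= Cmod (z - g t)) ->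
  pole_ok (g 0) -> pole_ok (g 1).
Proof.
  intros Hd Hg Hdist.
  apply (real_induction 0 1 (fun s t => pole_ok (g s) -> pole_ok (g t))); [lra|auto|].
  intros t Ht.
  assert (L : locally (g t : C_UniformSpace) (fun w : C => Cmod (w - g t) < d / 2)).
  { apply locally_Cmod. exists (d / 2). split; auto. lra. }
  destruct (Hg t _ L) as [r Hr]. exists r. split; [apply cond_pos|].
  intros s Hs Hst. assert (Hc : Cmod (g s - g t) < d / 2) by exact (Hr s Hst).
  split; intros _ H.
  - apply pole_ok_step with (g s) d; auto. rewrite Cmod_minus_sym. lra.
  - apply pole_ok_step with (g t) d; auto. lra.
Qed.

End Approximation.

Lemma unit_path_ccont (k : C) (th t : R) : ccont (fun t : R => k * cexp (0%R, (t * th)%R))%C t.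
Proof.
  apply ccont_mult; [apply ccont_const|].
  apply (ccont_comp (fun t : R => ((0, t * th) : C)) cexp); [|apply cexp_ccont].
  apply ccont_pair; [apply continuous_const|].
  apply (continuous_mult (K := R_AbsRing)); [apply continuous_id|apply continuous_const].
Qed.

(** The power (z / k)^(2^n). Exponents that are powers of two let the poles of 1 / (1 - w^(2^n)) be
    separated by factoring differences of squares. *)
Fixpoint itsq (k : C) (n : nat) (z : C) : C :=
  match n with O => (/ k * z)%C | S n => (itsq k n z * itsq k n z)%C end.

Fixpoint itsq_quot (k : C) (n : nat) (z w : C) : C :=
  match n with
  | O => (/ k)%C
  | S n => (itsq_quot k n z w * (itsq k n z + itsq k n w))%C
  end.

Lemma itsq_neq (k : C) n (z : C) : k <> 0%C -> Cmod z <> Cmod k -> Cmod (itsq k n z) <> 1.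
Proof.
  intros Hk Hz. induction n as [|n IH]; simpl; rewrite Cmod_mult.
  - rewrite (Cmod_inv k Hk). apply Cmod_gt_0 in Hk. intros E. apply Hz.
    apply Rmult_eq_reg_l with (/ Cmod k); [|apply Rinv_neq_0_compat; lra].
    rewrite E, Rinv_l; lra.
  - pose proof (Cmod_ge_0 (itsq k n z)). intros E. apply IH. nra.
Qed.

Section Labyrinth_piece.
Variables (rho s e : R).
Hypotheses (Hrho : / 4 <= rho) (Hs : rho < s < 1) (He : e = 1 \/ e = -1).

(** An inner disk and a ring that is open where e Re z > 1/8. The circle of radius [sigma] lies
    midway in the gap between them, and its point [k] faces the opening. *)
Let X (z : C) : Prop := Cmod z <= rho \/ (s <= Cmod z <= 1 /\ e * fst z <= / 8).
Let sigma := (rho + s) / 2.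
Let k := RtoC (e * sigma).

Lemma piece_bounded z : X z -> Cmod z <= 1.
Proof. intros [H|[H _]]; lra. Qed.

Lemma piece_radius : Cmod k = sigma /\ k <> 0%C.
Proof.
  assert (E : Cmod k = sigma).
  { unfold k. rewrite Cmod_R. unfold sigma. destruct He as [-> | ->].
    - rewrite Rabs_pos_eq; lra.
    - rewrite <- Rabs_Ropp, Rabs_pos_eq; lra. }
  split; auto. apply Cmod_gt_0. rewrite E. unfold sigma. lra.
Qed.

(** The pole starts at distance 2 from the origin and moves inwards along the real axis through the
    opening. It stays at least sigma - rho away from the ring, because rho >= 1/4 exceeds 1/8. *)
Lemma piece_pole_ray : pole_ok X k.
Proof.
  set (g := fun t : R => RtoC (e * (2 + t * (sigma - 2)))).
  replace k with (g 1) by (unfold g, k; f_equal; ring).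
  apply (pole_ok_path X piece_bounded g (sigma - rho)).
  - unfold sigma; lra.
  - intros t. apply ccont_pair; [|apply continuous_const].
    apply (ex_derive_continuous (V := R_NormedModule) (fun t => e * (2 + t * (sigma - 2)))).
    auto_derive. auto.
  - intros t z Ht Hz.
    set (x := 2 + t * (sigma - 2)).
    assert (Hx : sigma <= x) by (unfold x, sigma; nra).
    assert (Hsr : rho < sigma) by (unfold sigma; lra).
    rewrite Cmod_minus_sym. destruct Hz as [Hz|[_ Hz]].
    + pose proof (Cmod_triangle_inv (g t) z) as H. unfold g in H at 1. fold x in H.
      rewrite Cmod_R in H. assert (Rabs (e * x) = x); [|lra].
      destruct He as [-> | ->].
      * rewrite Rabs_pos_eq; lra.
      * rewrite <- Rabs_Ropp, Rabs_pos_eq; lra.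
    + eapply Rle_trans; [|apply re_le_Cmod]. unfold g; simpl. fold x.
      destruct He as [-> | ->].
      * eapply Rle_trans; [|apply Rle_abs]. lra.
      * rewrite <- Rabs_Ropp. eapply Rle_trans; [|apply Rle_abs]. lra.
  - apply pole_ok_far; [exact piece_bounded|]. unfold g. rewrite Cmod_R.
    destruct He as [-> | ->].
    + rewrite Rabs_pos_eq; lra.
    + rewrite <- Rabs_Ropp, Rabs_pos_eq; lra.
Qed.

(** Within the gap the pole rotates freely, at distance at least sigma - rho = s - sigma from both
    pieces. *)
Lemma piece_pole_circle th : pole_ok X (k * cexp (0%R, th))%C.
Proof.
  replace th with (1 * th) by ring.
  apply (pole_ok_path X piece_bounded (fun t => k * cexp (0%R, (t * th)%R))%C (sigma - rho)).
  - unfold sigma; lra.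
  - intros t. apply unit_path_ccont.
  - intros t z Ht Hz. set (b := (k * cexp (0%R, (t * th)%R))%C).
    assert (Hb : Cmod b = sigma).
    { unfold b. rewrite Cmod_mult, Cmod_unit, (proj1 piece_radius). ring. }
    destruct Hz as [Hz|[Hz _]].
    + rewrite Cmod_minus_sym. pose proof (Cmod_triangle_inv b z). lra.
    + pose proof (Cmod_triangle_inv z b). unfold sigma in *. lra.
  - replace (k * cexp (0%R, (0 * th)%R))%C with k; [exact piece_pole_ray|].
    rewrite Rmult_0_l. fold (RtoC 0). rewrite cexp_0. ring.
Qed.

Lemma piece_itsq_neq n z : X z -> Cmod (itsq k n z) <> 1.
Proof.
  intros Hz. destruct piece_radius as [R1 R2]. apply itsq_neq; auto. rewrite R1.
  unfold sigma. destruct Hz as [Hz|[Hz _]]; lra.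
Qed.

Lemma piece_den n th z : X z -> (1 - cexp (0%R, th) * itsq k n z)%C <> 0%C.
Proof.
  intros Hz E. apply (piece_itsq_neq n z Hz).
  assert (E' : (cexp (0%R, th) * itsq k n z)%C = 1%C).
  { replace (cexp (0%R, th) * itsq k n z)%C
      with (1 - (1 - cexp (0%R, th) * itsq k n z))%C by ring. rewrite E. ring. }
  apply (f_equal Cmod) in E'. rewrite Cmod_mult, Cmod_unit, Cmod_1 in E'. lra.
Qed.

(* [1 - c^2 w^2 = (1 - c w) (1 + c w)] splits the poles recursively. *)
Lemma piece_appr_inverse n : forall th,
  appr X (fun z => / (1 - cexp (0%R, th) * itsq k n z))%C
    (fun z w => cexp (0%R, th) * itsq_quot k n z w *
      (/ (1 - cexp (0%R, th) * itsq k n z) * / (1 - cexp (0%R, th) * itsq k n w)))%C.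
Proof.
  induction n as [|n IH]; intros th.
  (* 1 / (1 - c z / k) = - (k / c) / (z - k / c), with its single pole on the circle of radius
     [sigma]. *)
  - pose proof (appr_scal X piece_bounded (- (k * cexp (0%R, (- th)%R)))%C _ _
      (piece_pole_circle (- th))) as H.
    revert H. destruct piece_radius as [_ Hk].
    assert (Hd : forall z, X z -> (1 - cexp (0%R, th) * (/ k * z))%C <> 0%C)
      by exact (piece_den O th).
    simpl itsq; simpl itsq_quot.
    set (c := cexp (0%R, th)) in *. set (c' := cexp (0%R, (- th)%R)).
    assert (Hcc : (c * c')%C = 1%C).
    { unfold c, c'. rewrite <- cexp_plus, <- cexp_0. f_equal. apply Ceq; simpl; ring. }
    assert (Hc : c <> 0%C) by apply cexp_neq_0.
    assert (E : c' = (/ c)%C) by (rewrite <- (Cmult_1_l (/ c)), <- Hcc; field; auto).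
    clearbody c c'. subst c'.
    assert (Hd' : forall z, X z -> (z * c - k)%C <> 0%C /\ (k - c * z)%C <> 0%C).
    { intros z Hz. specialize (Hd z Hz).
      assert (Hkz : (k - c * z)%C <> 0%C).
      { intros E. apply Hd. replace (1 - c * (/ k * z))%C with ((k - c * z) * / k)%C by (field; auto).
        rewrite E. ring. }
      split; auto. intros E. apply Hkz.
      replace (k - c * z)%C with (- (z * c - k))%C by ring. rewrite E. ring. }
    apply appr_ext.
    + intros z Hz. destruct (Hd' z Hz). field. repeat split; auto.
    + intros z w Hz Hw. destruct (Hd' z Hz), (Hd' w Hw). field. repeat split; auto.
  (* The angles th / 2 and th / 2 + PI give the two opposite square roots of the coefficient. *)
  - pose proof (appr_mult X piece_bounded _ _ _ _ (IH (th / 2)) (IH (th / 2 + PI))) as H.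
    revert H. simpl itsq; simpl itsq_quot.
    assert (E1 : cexp (0%R, th) = (cexp (0%R, (th / 2)%R) * cexp (0%R, (th / 2)%R))%C).
    { rewrite <- cexp_plus. f_equal. apply Ceq; simpl; field. }
    assert (E2 : cexp (0%R, (th / 2 + PI)%R) = (- cexp (0%R, (th / 2)%R))%C).
    { unfold cexp; apply Ceq; simpl; rewrite ?neg_cos, ?neg_sin; ring. }
    pose proof (fun z Hz => piece_den n (th / 2) z Hz) as D1.
    pose proof (fun z Hz => piece_den n (th / 2 + PI) z Hz) as D2.
    rewrite E1, E2 in *. set (c := cexp (0%R, (th / 2)%R)) in *. clearbody c.
    assert (D3 : forall z, X z -> (1 - c * c * (itsq k n z * itsq k n z))%C <> 0%C).
    { intros z Hz. replace (1 - c * c * (itsq k n z * itsq k n z))%C with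
        ((1 - c * itsq k n z) * (1 - - c * itsq k n z))%C by ring.
      apply Cmult_neq_0; auto. }
    assert (D4 : forall z, X z -> (1 + c * itsq k n z)%C <> 0%C).
    { intros z Hz. replace (1 + c * itsq k n z)%C with (1 - - c * itsq k n z)%C by ring. auto. }
    apply appr_ext.
    + intros z Hz. specialize (D1 z Hz). specialize (D2 z Hz). specialize (D3 z Hz).
      specialize (D4 z Hz). field. repeat split; auto.
    + intros z w Hz Hw.
      pose proof (D1 z Hz). pose proof (D2 z Hz). pose proof (D3 z Hz). pose proof (D4 z Hz).
      pose proof (D1 w Hw). pose proof (D2 w Hw). pose proof (D3 w Hw). pose proof (D4 w Hw).
      field. repeat split; auto.
Qed.

End Labyrinth_piece.

(** * The labyrinth *)


Fixpoint rsq (x : R) (n : nat) : R :=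
  match n with O => x | S n => rsq x n * rsq x n end.

Fixpoint rsq_quot (x y : R) (n : nat) : R :=
  match n with O => y | S n => rsq_quot x y n * (2 * rsq x n) end.

Lemma rsq_nonneg x n : 0 <= x -> 0 <= rsq x n.
Proof. intros H. induction n; simpl; nra. Qed.

Lemma rsq_quot_nonneg x y n : 0 <= x -> 0 <= y -> 0 <= rsq_quot x y n.
Proof.
  intros Hx Hy. induction n; simpl; auto.
  pose proof (rsq_nonneg x n Hx). apply Rmult_le_pos; lra.
Qed.

Lemma rsq_le_pow x n : 0 <= x <= 1 -> rsq x n <= x * x ^ n.
Proof.
  intros Hx. induction n as [|n IH]; simpl; [lra|].
  assert (P : 0 <= x ^ n <= 1).
  { split; [apply pow_le; lra|]. rewrite <- (pow1 n). apply pow_incr; lra. }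
  pose proof (rsq_nonneg x n ltac:(lra)).
  apply Rle_trans with (rsq x n * (x * x ^ n)); [nra|].
  assert (rsq x n <= x) by nra. nra.
Qed.

Lemma rsq_small x e : 0 <= x < 1 -> 0 < e -> exists N, forall n, (N <= n)%nat -> rsq x n <= e.
Proof.
  intros Hx He. destruct (pow_lt_1_zero x) with (y := e) as [N HN]; auto.
  { rewrite Rabs_pos_eq; lra. }
  exists N. intros n Hn. specialize (HN n Hn).
  pose proof (rsq_le_pow x n ltac:(lra)). pose proof (Rle_abs (x ^ n)).
  pose proof (pow_le x n ltac:(lra)). nra.
Qed.

(** Once [rsq] is at most 1/4, every further factor 2 [rsq] is at most 1/2 and the decay is
    geometric. *)
Lemma rsq_quot_small x y e : 0 <= x < 1 -> 0 <= y -> 0 < e ->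
  exists N, forall n, (N <= n)%nat -> rsq_quot x y n <= e.
Proof.
  intros Hx Hy He. destruct (rsq_small x (/ 4) Hx) as [N1 H1]; [lra|].
  set (b := rsq_quot x y N1).
  assert (Hb : 0 <= b) by (apply rsq_quot_nonneg; lra).
  assert (Hk : forall k, rsq_quot x y (N1 + k) <= b * (/ 2) ^ k).
  { induction k as [|k IH].
    - rewrite PeanoNat.Nat.add_0_r. simpl. unfold b. lra.
    - rewrite PeanoNat.Nat.add_succ_r. simpl.
      specialize (H1 (N1 + k)%nat ltac:(lia)).
      pose proof (rsq_quot_nonneg x y (N1 + k) ltac:(lra) Hy).
      pose proof (rsq_nonneg x (N1 + k) ltac:(lra)). nra. }
  destruct (pow_lt_1_zero (/ 2)) with (y := e / (b + 1)) as [N2 H2].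
  { rewrite Rabs_pos_eq; lra. }
  { apply Rdiv_lt_0_compat; lra. }
  exists (N1 + N2)%nat. intros n Hn.
  replace n with (N1 + (n - N1))%nat by lia.
  eapply Rle_trans; [apply Hk|].
  specialize (H2 (n - N1)%nat ltac:(lia)).
  pose proof (Rle_abs ((/ 2) ^ (n - N1))).
  pose proof (pow_le (/ 2) (n - N1) ltac:(lra)).
  assert (H3 : (b + 1) * (/ 2) ^ (n - N1) <= (b + 1) * (e / (b + 1)))
    by (apply Rmult_le_compat_l; lra).
  replace ((b + 1) * (e / (b + 1))) with e in H3 by (field; lra). nra.
Qed.

Lemma itsq_bound (k : C) x n (z : C) : k <> 0%C -> Cmod z <= x * Cmod k ->
  Cmod (itsq k n z) <= rsq x n.
Proof.
  intros Hk Hz. induction n as [|n IH]; simpl.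
  - rewrite Cmod_mult, (Cmod_inv k Hk). apply Cmod_gt_0 in Hk.
    apply Rmult_le_reg_l with (Cmod k); auto.
    rewrite <- Rmult_assoc, Rinv_r by lra. lra.
  - now apply Cmod_mult_le.
Qed.

Lemma itsq_quot_bound (k : C) x n (z w : C) : k <> 0%C -> Cmod z <= x * Cmod k -> Cmod w <= x * Cmod k ->
  Cmod (itsq_quot k n z w) <= rsq_quot x (/ Cmod k) n.
Proof.
  intros Hk Hz Hw. induction n as [|n IH]; simpl.
  - rewrite (Cmod_inv k Hk). lra.
  - apply Cmod_mult_le; auto. replace (2 * rsq x n) with (rsq x n + rsq x n) by ring.
    apply Cmod_plus_le; now apply itsq_bound.
Qed.

Lemma itsq_lower (k : C) x n (z : C) : k <> 0%C -> 0 <= x -> Cmod k <= x * Cmod z ->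
  1 <= rsq x n * Cmod (itsq k n z).
Proof.
  intros Hk Hx Hz. induction n as [|n IH]; simpl.
  - rewrite Cmod_mult, (Cmod_inv k Hk). apply Cmod_gt_0 in Hk.
    apply Rmult_le_reg_l with (Cmod k); auto.
    replace (Cmod k * (x * (/ Cmod k * Cmod z))) with (x * Cmod z * (Cmod k * / Cmod k)) by ring.
    rewrite Rinv_r by lra. lra.
  - rewrite Cmod_mult.
    replace (rsq x n * rsq x n * (Cmod (itsq k n z) * Cmod (itsq k n z)))
      with ((rsq x n * Cmod (itsq k n z)) * (rsq x n * Cmod (itsq k n z))) by ring.
    nra.
Qed.

(* Runge: [1 - 1 / (1 - (z/k)^(2^n))] is close to [0] on the disk of radius [rho] and to [1] on the C-shaped piece. *)
Lemma labyrinth_piece rho s e eps L : / 4 <= rho -> rho < s < 1 -> e = 1 \/ e = -1 -> 0 < eps ->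
  exists p r, cpoly p r /\ bounded_by (fun z => Cmod z <= rho) p r eps /\
    forall z, s <= Cmod z <= 1 -> e * fst z <= / 8 -> L <= fst (p z).
Proof.
  intros Hrho Hs He Heps.
  set (sigma := (rho + s) / 2). set (k := RtoC (e * sigma)).
  destruct (piece_radius rho s e Hrho Hs He) as [Hk Hk0]. fold sigma in Hk. fold sigma k in Hk, Hk0.
  assert (Hsig : rho < sigma < s) by (unfold sigma; lra).
  (* On the ring the real part before scaling is at least 1/2, so scaling by [K] gives |L| + 2, of
     which the approximation may consume 1. *)
  set (K := 2 * (Rabs L + 2)).
  assert (HK : 4 <= K) by (unfold K; pose proof (Rabs_pos L); lra).
  (* [d] bounds the power and its divided difference on the disk; there the function before scaling
     is at most 2 d and its divided difference at most 4 d. *)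
  set (d := Rmin (/ 4) (eps / (8 * K))).
  assert (Hd : 0 < d) by (apply Rmin_pos; [lra|apply Rdiv_lt_0_compat; lra]).
  assert (Hd1 : d <= / 4) by apply Rmin_l.
  assert (Hd2 : 4 * K * d <= eps / 2).
  { replace (eps / 2) with (4 * K * (eps / (8 * K))) by (field; lra).
    apply Rmult_le_compat_l; [lra|apply Rmin_r]. }
  assert (Hx : 0 <= rho / sigma < 1).
  { split; [apply Rdiv_le_0_compat; lra|]. apply Rmult_lt_reg_r with sigma; [lra|].
    unfold Rdiv. rewrite Rmult_assoc, Rinv_l; lra. }
  assert (Hx' : 0 <= sigma / s < 1).
  { split; [apply Rdiv_le_0_compat; lra|]. apply Rmult_lt_reg_r with s; [lra|].
    unfold Rdiv. rewrite Rmult_assoc, Rinv_l; lra. }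
  destruct (rsq_small _ d Hx Hd) as [N1 H1].
  destruct (rsq_quot_small _ (/ Cmod k) d Hx) as [N2 H2]; auto.
  { left. apply Rinv_0_lt_compat. lra. }
  destruct (rsq_small _ d Hx' Hd) as [N3 H3].
  set (n := (N1 + N2 + N3)%nat).
  specialize (H1 n ltac:(lia)). specialize (H2 n ltac:(lia)). specialize (H3 n ltac:(lia)).
  pose proof (piece_appr_inverse rho s e Hrho Hs He n 0) as HA. cbv zeta in HA.
  fold sigma k in HA.
  set (X := fun z => Cmod z <= rho \/ s <= Cmod z <= 1 /\ e * fst z <= / 8) in HA.
  assert (X1 : forall z, X z -> Cmod z <= 1) by (intros z [Hz|[Hz _]]; lra).
  assert (c1 : cexp (0%R, 0%R) = 1%C) by apply cexp_0.
  rewrite c1 in HA.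
  apply (appr_scal X X1 (RtoC (-1))) in HA.
  pose proof (appr_plus X _ _ _ _ (appr_const X 1%C) HA) as HB.
  apply (appr_scal X X1 (RtoC K)) in HB. clear HA.
  destruct (HB (Rmin (eps / 2) 1)) as [p [r [Hp Hb]]].
  { apply Rmin_pos; lra. }
  assert (Hm1 : Rmin (eps / 2) 1 <= eps / 2) by apply Rmin_l.
  assert (Hm2 : Rmin (eps / 2) 1 <= 1) by apply Rmin_r.
  exists p, r. split; auto. split.
  - assert (Hin : forall z, Cmod z <= rho -> Cmod (itsq k n z) <= d /\
      (1 - 1 * itsq k n z)%C <> 0%C /\ Cmod (/ (1 - 1 * itsq k n z)) <= 2).
    { intros z Hz.
      assert (B : Cmod (itsq k n z) <= d).
      { eapply Rle_trans; [apply (itsq_bound k (rho / sigma))|exact H1]; auto.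
        rewrite Hk. unfold Rdiv. rewrite Rmult_assoc, Rinv_l; lra. }
      assert (B1 : / 2 <= Cmod (1 - 1 * itsq k n z)).
      { replace (1 * itsq k n z)%C with (itsq k n z) by ring.
        pose proof (Cmod_1_minus _ _ B). lra. }
      assert (B2 : (1 - 1 * itsq k n z)%C <> 0%C) by (apply Cmod_gt_0; lra).
      split; [exact B|split; [exact B2|]].
      rewrite Cmod_inv by auto. rewrite <- (Rinv_inv 2). apply Rinv_le_contravar; lra. }
    intros z w Hz Hw. destruct (Hin z Hz) as [A1 [A2 A3]], (Hin w Hw) as [B1 [B2 B3]].
    destruct (Hb z w) as [E1 E2]; [now left|now left|]. cbv beta in E1, E2.
    replace eps with (K * (4 * d) + Rmin (eps / 2) 1 + (eps - (K * (4 * d) + Rmin (eps / 2) 1))) by ring.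
    assert (Hslack : 0 <= eps - (K * (4 * d) + Rmin (eps / 2) 1)) by lra.
    assert (HKm : Cmod (RtoC K) <= K) by (rewrite Cmod_R, Rabs_pos_eq; lra).
    split.
    + apply Rle_trans with (K * (4 * d) + Rmin (eps / 2) 1); [|lra].
      match type of E1 with Cmod (?u - p z) <= _ =>
        replace (p z) with (u + - (u - p z))%C by ring end.
      apply Cmod_plus_le; [|now rewrite Cmod_opp].
      apply Cmod_mult_le; auto.
      (* 1 - 1 / (1 - w) = - w / (1 - w), which is small with w. *)
      replace (1 + RtoC (-1) * / (1 - 1 * itsq k n z))%C
        with (itsq k n z * (RtoC (-1) * / (1 - 1 * itsq k n z)))%C
        by (field; rewrite Cmult_1_l in A2; exact A2).
      apply Rle_trans with (d * (1 * 2)); [|lra].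
      apply Cmod_mult_le; auto. apply Cmod_mult_le; auto. rewrite Cmod_R, Rabs_left; lra.
    + apply Rle_trans with (K * (4 * d) + Rmin (eps / 2) 1); [|lra].
      match type of E2 with Cmod (?u - r z w) <= _ =>
        replace (r z w) with (u + - (u - r z w))%C by ring end.
      apply Cmod_plus_le; [|now rewrite Cmod_opp].
      apply Cmod_mult_le; auto.
      rewrite Cplus_0_l, Cmult_1_l.
      apply Rle_trans with (1 * (d * (2 * 2))); [|lra].
      apply Cmod_mult_le; [rewrite Cmod_R, Rabs_left; lra|].
      apply Cmod_mult_le; [|now apply Cmod_mult_le].
      eapply Rle_trans; [apply (itsq_quot_bound k (rho / sigma))|exact H2]; auto;
        rewrite Hk; unfold Rdiv; rewrite Rmult_assoc, Rinv_l; lra.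
  - intros z Hz Hez.
    assert (Xz : X z) by (right; now split).
    destruct (Hb z z Xz Xz) as [E1 _].
    assert (B : 1 <= rsq (sigma / s) n * Cmod (itsq k n z)).
    { apply itsq_lower; auto; [lra|]. rewrite Hk.
      apply Rle_trans with (sigma / s * s); [unfold Rdiv; rewrite Rmult_assoc, Rinv_l; lra|].
      apply Rmult_le_compat_l; lra. }
    (* On the ring the power has modulus at least 1 / d >= 4, so 1 / (1 - w) is small there. *)
    assert (B4 : 4 <= Cmod (itsq k n z)).
    { pose proof (Cmod_ge_0 (itsq k n z)). nra. }
    assert (B5 : 2 <= Cmod (1 - 1 * itsq k n z)).
    { rewrite Cmod_minus_sym. replace (1 * itsq k n z - 1)%C with (itsq k n z - 1)%C by ring.
      pose proof (Cmod_triangle_inv (itsq k n z) 1). rewrite Cmod_1 in H. lra. }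
    assert (B6 : (1 - 1 * itsq k n z)%C <> 0%C) by (apply Cmod_gt_0; lra).
    assert (B7 : Cmod (/ (1 - 1 * itsq k n z)) <= / 2).
    { rewrite Cmod_inv by auto. apply Rinv_le_contravar; lra. }
    pose proof (re_le_Cmod (/ (1 - 1 * itsq k n z))) as B8.
    set (v := (/ (1 - 1 * itsq k n z))%C) in *.
    pose proof (re_le_Cmod (RtoC K * (1 + RtoC (-1) * v) - p z)) as E2.
    assert (B9 : fst v <= / 2) by (eapply Rle_trans; [apply Rle_abs|unfold Re in B8; lra]).
    assert (E3 : fst (RtoC K * (1 + RtoC (-1) * v) - p z)%C <= 1).
    { eapply Rle_trans; [apply Rle_abs|]. unfold Re in E2. lra. }
    assert (E4 : fst (RtoC K * (1 + RtoC (-1) * v) - p z)%C = K * (1 - fst v) - fst (p z))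
      by (simpl; ring).
    rewrite E4 in E3. pose proof (Rle_abs L).
    assert (K * (/ 2) <= K * (1 - fst v)) by (apply Rmult_le_compat_l; lra).
    unfold K in *. lra.
Qed.

Definition side (j : nat) : R := (-1) ^ j.

Lemma side_cases j : side j = 1 \/ side j = -1.
Proof.
  unfold side. induction j as [|j [IH|IH]]; simpl; rewrite ?IH; lra.
Qed.

(** Layers of thickness [d] are alternately empty and walls. The empty layer below each wall is the
    gap in which the poles of its piece rotate. *)
Definition in_wall (r d : R) (j : nat) (z : C) : Prop :=
  r + (2 * INR j + 1) * d <= Cmod z <= r + (2 * INR j + 2) * d /\ side j * fst z <= / 8.

(** Walls are added outwards. A new piece is small on the disk containing all earlier walls, and on
    its own wall it is large enough to outweigh the earlier sum. *)
Lemma labyrinth_block r d N : / 4 <= r -> 0 < d -> r + 2 * INR N * d < 1 ->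
  forall eps L, 0 < eps ->
  exists p q, cpoly p q /\ bounded_by (fun z => Cmod z <= r) p q eps /\
    forall j z, (j < N)%nat -> in_wall r d j z -> L <= fst (p z).
Proof.
  intros Hr Hd. induction N as [|N IH]; intros HN eps L Heps.
  - exists (fun _ => 0%C), (fun _ _ => 0%C). split; [apply cpoly_const|split].
    + intros z w _ _. rewrite Cmod_0. lra.
    + intros j z Hj. lia.
  - rewrite S_INR in HN. pose proof (pos_INR N) as PN.
    destruct (IH ltac:(nra) (eps / 2) (L + 1) ltac:(lra)) as [p [q [Hp [Hb Hw]]]].
    destruct (cpoly_bounded 1 p q Hp) as [M [HM HMb]].
    (* The target L + M absorbs the earlier sum, bounded by [M]; error at most 1 on the earlier
       walls is covered by the L + 1 asked of the induction hypothesis. *)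
    destruct (labyrinth_piece (r + 2 * INR N * d) (r + (2 * INR N + 1) * d) (side N)
      (Rmin (eps / 2) 1) (L + M)) as [p' [q' [Hp' [Hb' Hw']]]].
    { nra. } { nra. } { apply side_cases. } { apply Rmin_pos; lra. }
    assert (Hm1 : Rmin (eps / 2) 1 <= eps / 2) by apply Rmin_l.
    assert (Hm2 : Rmin (eps / 2) 1 <= 1) by apply Rmin_r.
    assert (Hre : forall c : C, - Cmod c <= fst c).
    { intros c. pose proof (re_le_Cmod c). unfold Re in *. apply Rabs_le_between in H. lra. }
    exists (fun z => p z + p' z)%C, (fun z w => q z w + q' z w)%C.
    split; [now apply cpoly_plus|split].
    + intros z w Hz Hzw. destruct (Hb z w Hz Hzw).
      destruct (Hb' z w) as [A1 A2]; [nra|nra|].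
      replace eps with (eps / 2 + eps / 2) by field.
      split; apply Cmod_plus_le; lra.
    + intros j z Hj [Hz Hs]. simpl fst.
      destruct (PeanoNat.Nat.eq_dec j N) as [->|Hn].
      * assert (HN1 : Cmod z <= 1) by nra.
        specialize (Hw' z ltac:(lra) Hs). destruct (HMb z z HN1 HN1) as [A _].
        pose proof (Hre (p z)). lra.
      * assert (HjN : (j < N)%nat) by lia.
        specialize (Hw j z HjN (conj Hz Hs)).
        assert (HjR : INR j + 1 <= INR N) by (rewrite <- S_INR; now apply le_INR).
        destruct (Hb' z z) as [A _]; [nra|nra|]. pose proof (Hre (p' z)). lra.
Qed.

(** * Limits of polynomial sequences *)

Lemma C_limit (u : nat -> C) n0 :
  (forall n, (n0 <= n)%nat -> Cmod (u (S n) - u n) <= (/ 2) ^ n) ->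
  exists l, forall n, (n0 <= n)%nat -> Cmod (u n - l) <= 2 * (/ 2) ^ n.
Proof.
  intros H.
  assert (Hk : forall n k, (n0 <= n)%nat ->
    Cmod (u (n + k)%nat - u n) <= 2 * (/ 2) ^ n - 2 * (/ 2) ^ (n + k)).
  { intros n k Hn. induction k as [|k IH].
    - rewrite PeanoNat.Nat.add_0_r. replace (u n - u n)%C with (RtoC 0) by ring.
      rewrite Cmod_0. lra.
    - rewrite PeanoNat.Nat.add_succ_r.
      replace (u (S (n + k)) - u n)%C with ((u (S (n + k)) - u (n + k)%nat) + (u (n + k)%nat - u n))%C by ring.
      specialize (H (n + k)%nat ltac:(lia)).
      eapply Rle_trans; [apply Cmod_plus_le; [exact H|exact IH]|]. simpl. lra. }
  assert (Hc : forall n m, (n0 <= n)%nat -> (n <= m)%nat -> Cmod (u m - u n) <= 2 * (/ 2) ^ n).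
  { intros n m Hn Hm. replace m with (n + (m - n))%nat by lia.
    eapply Rle_trans; [now apply Hk|].
    pose proof (pow_le (/ 2) (n + (m - n)) ltac:(lra)). lra. }
  destruct (Bolzano_Weierstrass_C (fun n => u (n0 + n)%nat) (Cmod (u n0) + 2 * (/ 2) ^ n0))
    as [phi [l [Hphi HL]]].
  { intros n. specialize (Hc n0 (n0 + n)%nat (le_n _) ltac:(lia)).
    pose proof (Cmod_triangle_inv (u (n0 + n)%nat) (u n0)). lra. }
  exists l. intros n Hn. apply Rnot_lt_le. intros Hlt.
  destruct (HL (Cmod (u n - l) - 2 * (/ 2) ^ n)) as [N HN]; [lra|].
  specialize (HN (max n N) ltac:(lia)).
  pose proof (strictly_increasing_ge phi Hphi (max n N)).
  specialize (Hc n (n0 + phi (max n N))%nat Hn ltac:(lia)).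
  set (m := (n0 + phi (max n N))%nat) in *.
  rewrite Cmod_minus_sym in Hc.
  pose proof (Cmod_triangle (u n - u m) (u m - l)).
  replace (u n - u m + (u m - l))%C with (u n - l)%C in H1 by ring. lra.
Qed.

Lemma ccont_uniform {T : UniformSpace} (f : T -> C) (p : T) :
  (forall e, 0 < e -> exists g, ccont g p /\ locally p (fun x => Cmod (f x - g x) <= e)) ->
  ccont f p.
Proof.
  intros H P [e HP].
  assert (He : 0 < e / 4) by (pose proof (cond_pos e); lra).
  destruct (H (e / 4) He) as [g [Hg Hl]].
  assert (Hgl : locally p (fun x => Cmod (g x - g p) < e / 4)).
  { apply (Hg (fun y => Cmod (y - g p) < e / 4)). apply locally_Cmod. exists (e / 4). auto. }
  pose proof (locally_singleton _ _ Hl) as Hp. simpl in Hp.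
  change (locally p (fun x => P (f x))).
  apply (filter_imp (fun x => Cmod (f x - g x) <= e / 4 /\ Cmod (g x - g p) < e / 4));
    [|now apply filter_and].
  intros x [A1 A2].
  apply HP. apply ball_Cmod.
  replace (f x - f p)%C with ((f x - g x) + ((g x - g p) + (g p - f p)))%C by ring.
  rewrite Cmod_minus_sym in Hp.
  pose proof (Cmod_plus_le (g x - g p) (g p - f p) _ _ (Rlt_le _ _ A2) Hp) as A3.
  pose proof (Cmod_plus_le _ _ _ _ A1 A3). lra.
Qed.

Lemma pow_half_small e : 0 < e -> exists N, forall n, (N <= n)%nat -> 2 * (/ 2) ^ n < e.
Proof.
  intros He. destruct (pow_lt_1_zero (/ 2)) with (y := e / 2) as [N HN]; [|lra|].
  - rewrite Rabs_pos_eq; lra.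
  - exists N. intros n Hn. specialize (HN n Hn). pose proof (Rle_abs ((/ 2) ^ n)). lra.
Qed.

Lemma locally_Cmod_lt (z : C) c : Cmod z < c ->
  locally (z : C_UniformSpace) (fun w => Cmod w < c).
Proof.
  intros H. apply locally_Cmod. exists (c - Cmod z). split; [lra|].
  intros w Hw. pose proof (Cmod_triangle_inv w z). lra.
Qed.

(** Polynomials and divided differences converge together, uniformly on smaller disks. The limit [Q]
    is jointly continuous and still a divided difference of [F], so [F] has the continuous
    derivative Q(z, z). *)
Lemma cpoly_sequence_limit (f : nat -> C -> C) (q : nat -> C -> C -> C) (rho : nat -> R) :
  (forall n, cpoly (f n) (q n)) -> (forall n, rho n < rho (S n)) ->
  (forall c, c < 1 -> exists n, c < rho n) ->
  (forall n, bounded_by (fun z => Cmod z <= rho n) (fun z => f (S n) z - f n z)%C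
     (fun z w => q (S n) z w - q n z w)%C ((/ 2) ^ n)) ->
  exists F F', holo (dom DiskD) F F' /\
    forall n z, Cmod z <= rho n -> Cmod z < 1 -> Cmod (F z - f n z) <= 2 * (/ 2) ^ n.
Proof.
  intros Hp Hinc Hex Hb.
  assert (Hmono : forall n m, (n <= m)%nat -> rho n <= rho m).
  { intros n m Hm. induction Hm; [lra|]. specialize (Hinc m). lra. }
  assert (LimF : forall z, exists l, Cmod z < 1 -> forall n, Cmod z <= rho n ->
    Cmod (f n z - l) <= 2 * (/ 2) ^ n).
  { intros z. destruct (classic (Cmod z < 1)) as [Hz|Hz]; [|exists 0%C; tauto].
    assert (Hl : forall n0, Cmod z <= rho n0 -> exists l, forall n, (n0 <= n)%nat ->
      Cmod (f n z - l) <= 2 * (/ 2) ^ n).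
    { intros n0 Hn0. apply C_limit. intros n Hn. specialize (Hmono n0 n Hn).
      now destruct (Hb n z z ltac:(lra) ltac:(lra)). }
    (* Starting from the least admissible index makes the one limit satisfy the estimate for every
       admissible n. *)
    destruct (dec_inh_nat_subset_has_unique_least_element (fun n => Cmod z <= rho n))
      as [n0 [[Hn0 Hmin] _]].
    { intros n. apply classic. }
    { destruct (Hex _ Hz) as [n Hn]. exists n. lra. }
    destruct (Hl n0 Hn0) as [l Hl0]. exists l. intros _ n Hn. now apply Hl0, Hmin. }
  assert (LimQ : forall zw : C * C, exists l, Cmod (fst zw) < 1 -> Cmod (snd zw) < 1 ->
    forall n, Cmod (fst zw) <= rho n -> Cmod (snd zw) <= rho n ->
    Cmod (q n (fst zw) (snd zw) - l) <= 2 * (/ 2) ^ n).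
  { intros [z w]. simpl.
    destruct (classic (Cmod z < 1 /\ Cmod w < 1)) as [[Hz Hw]|Hzw]; [|exists 0%C; tauto].
    assert (Hl : forall n0, Cmod z <= rho n0 /\ Cmod w <= rho n0 -> exists l, forall n, (n0 <= n)%nat ->
      Cmod (q n z w - l) <= 2 * (/ 2) ^ n).
    { intros n0 [Hn0 Hn1]. apply (C_limit (fun n => q n z w)). intros n Hn. specialize (Hmono n0 n Hn).
      now destruct (Hb n z w ltac:(lra) ltac:(lra)). }
    destruct (dec_inh_nat_subset_has_unique_least_element
      (fun n => Cmod z <= rho n /\ Cmod w <= rho n)) as [n0 [[Hn0 Hmin] _]].
    { intros n. apply classic. }
    { destruct (Hex (Rmax (Cmod z) (Cmod w))) as [n Hn]; [now apply Rmax_lub_lt|].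
      exists n. pose proof (Rmax_l (Cmod z) (Cmod w)). pose proof (Rmax_r (Cmod z) (Cmod w)). lra. }
    destruct (Hl n0 Hn0) as [l Hl0]. exists l. intros _ _ n Hn Hn'. now apply Hl0, Hmin. }
  set (F := fun z => proj1_sig (constructive_indefinite_description _ (LimF z))).
  assert (HF : forall z, Cmod z < 1 -> forall n, Cmod z <= rho n ->
    Cmod (f n z - F z) <= 2 * (/ 2) ^ n).
  { intros z. exact (proj2_sig (constructive_indefinite_description _ (LimF z))). }
  set (Q := fun z w => proj1_sig (constructive_indefinite_description _ (LimQ (z, w)))).
  assert (HQ : forall z w, Cmod z < 1 -> Cmod w < 1 -> forall n, Cmod z <= rho n -> Cmod w <= rho n ->
    Cmod (q n z w - Q z w) <= 2 * (/ 2) ^ n).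
  { intros z w. exact (proj2_sig (constructive_indefinite_description _ (LimQ (z, w)))). }
  assert (Quot : forall z w, Cmod z < 1 -> Cmod w < 1 -> F w = (F z + Q z w * (w - z))%C).
  { intros z w Hz Hw. apply NNPP. intros Hne.
    assert (Hpos : 0 < Cmod (F w - (F z + Q z w * (w - z)))) by now apply Cmod_gt_0, Cminus_neq_0.
    set (c := Cmod (F w - (F z + Q z w * (w - z)))) in *.
    (* The errors of F(w), F(z) and Q(z, w), the last multiplied by |w - z| <= 2, add up to less
       than 4 c / 5. *)
    destruct (pow_half_small (c / 5)) as [N HN]; [lra|].
    destruct (Hex (Rmax (Cmod z) (Cmod w))) as [n1 Hn1]; [now apply Rmax_lub_lt|].
    set (n := max N n1). specialize (HN n ltac:(lia)).
    specialize (Hmono n1 n ltac:(lia)).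
    pose proof (Rmax_l (Cmod z) (Cmod w)). pose proof (Rmax_r (Cmod z) (Cmod w)).
    pose proof (HF z Hz n ltac:(lra)) as A1. pose proof (HF w Hw n ltac:(lra)) as A2.
    pose proof (HQ z w Hz Hw n ltac:(lra) ltac:(lra)) as A3.
    assert (Hzw : Cmod (w - z) <= 2).
    { unfold Cminus. replace 2 with (1 + 1) by ring. apply Cmod_plus_le; [lra|].
      rewrite Cmod_opp. lra. }
    pose proof (Cmod_mult_le _ _ _ _ A3 Hzw) as A4.
    assert (E : (F w - (F z + Q z w * (w - z)))%C =
      (- (f n w - F w) + ((f n z - F z) + (q n z w - Q z w) * (w - z)))%C).
    { rewrite (cpoly_quotient _ _ (Hp n) z w). ring. }
    assert (Hc : c <= 2 * (/ 2) ^ n + (2 * (/ 2) ^ n + 2 * (/ 2) ^ n * 2)).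
    { unfold c. rewrite E. apply Cmod_plus_le; [now rewrite Cmod_opp|].
      now apply Cmod_plus_le. }
    lra. }
  assert (Qc : forall z w, Cmod z < 1 -> Cmod w < 1 ->
    ccont (fun p : prod_UniformSpace C_UniformSpace C_UniformSpace => Q (fst p) (snd p)) (z, w)).
  { intros z w Hz Hw. apply ccont_uniform. intros e He.
    destruct (pow_half_small e He) as [N HN].
    destruct (Hex (Rmax (Cmod z) (Cmod w))) as [n1 Hn1]; [now apply Rmax_lub_lt|].
    set (n := max N n1). specialize (HN n ltac:(lia)).
    specialize (Hmono n1 n ltac:(lia)).
    pose proof (Rmax_l (Cmod z) (Cmod w)). pose proof (Rmax_r (Cmod z) (Cmod w)).
    exists (fun p => q n (fst p) (snd p)). split.
    - exact (proj2 (cpoly_ccont _ _ (Hp n)) (z, w)).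
    - set (c := Rmin 1 (rho n)).
      assert (Hzc : Cmod z < c) by (apply Rmin_glb_lt; lra).
      assert (Hwc : Cmod w < c) by (apply Rmin_glb_lt; lra).
      assert (c <= 1) by apply Rmin_l. assert (c <= rho n) by apply Rmin_r.
      apply (filter_imp (fun p : prod_UniformSpace C_UniformSpace C_UniformSpace =>
        Cmod (fst p) < c /\ Cmod (snd p) < c)).
      + intros [z' w'] [B1 B2]. simpl in *. rewrite Cmod_minus_sym.
        left. eapply Rle_lt_trans; [apply HQ|exact HN]; lra.
      + apply filter_and.
        * exact (continuous_fst (U := C_UniformSpace) (V := C_UniformSpace) z w _
            (locally_Cmod_lt z c Hzc)).
        * exact (continuous_snd (U := C_UniformSpace) (V := C_UniformSpace) z w _
            (locally_Cmod_lt w c Hwc)). }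
  exists F, (fun z => Q z z). split.
  - intros z Hz.
    assert (Hz1 : Cmod z < 1).
    { pose proof (Cmod_sqr z). pose proof (Cmod_ge_0 z). simpl in *. nra. }
    split.
    + apply cderiv_local with (fun w => Q z w); [reflexivity| |].
      * apply (continuous_comp_2 (fun _ : C_UniformSpace => (z : C_UniformSpace))
          (fun w : C_UniformSpace => w) Q z); [apply continuous_const|apply continuous_id|].
        now apply Qc.
      * apply (filter_imp (fun w => Cmod w < 1)); [|now apply locally_Cmod_lt].
        intros w Hw. now apply Quot.
    + apply (continuous_comp_2 (fun w : C_UniformSpace => w)
        (fun w : C_UniformSpace => w) Q z); [apply continuous_id|apply continuous_id|].
      now apply Qc.
  - intros n z Hn Hz. rewrite Cmod_minus_sym. now apply HF.
Qed.

(** * Completeness on the disk *)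


(* [N] walls of thickness [d] in an annulus where [|h| >= m]; dodging all of them costs [m (N - 1) / 8] in the metric [|h| |dz|]. *)
Definition labyrinth (h f : C -> C) (lo hi c : R) : Prop :=
  exists r d m N, lo < r /\ 0 < d /\ 0 < m /\ r + (2 * INR N + 1) * d <= hi /\
    (forall z, r <= Cmod z <= r + (2 * INR N + 1) * d -> m <= Cmod (h z)) /\
    8 <= m * (INR N - 1) /\
    forall j z, (j < N)%nat -> in_wall r d j z -> 4 / d + c <= fst (f z).

Definition stage : Type := ((C -> C) * (C -> C -> C) * R)%type.

Definition stage_ok (x : stage) : Prop :=
  cpoly (fst (fst x)) (snd (fst x)) /\ / 4 <= snd x < 1.

(** The lower radius 1 - 1 / (n + 2) drives the stages to the boundary. The final 1 is slack for the
    later corrections, which lower Re F on these walls by at most 1 in total. *)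
Definition stage_step (h : C -> C) (n : nat) (x y : stage) : Prop :=
  snd x < snd y /\
  bounded_by (fun z => Cmod z <= snd x) (fun z => fst (fst y) z - fst (fst x) z)%C
    (fun z w => snd (fst y) z w - snd (fst x) z w)%C ((/ 2) ^ n) /\
  labyrinth h (fst (fst y)) (1 - / (INR n + 2)) (snd y) 1.

Lemma stage_step_ex h n x : has_good_annuli h -> stage_ok x ->
  exists y, stage_ok y /\ stage_step h n x y.
Proof.
  destruct x as [[f q] rho]. intros Hh [Hf Hrho]. simpl in Hf, Hrho.
  assert (Hn : 0 < / (INR n + 2)) by (apply Rinv_0_lt_compat; pose proof (pos_INR n); lra).
  set (lo := Rmax rho (1 - / (INR n + 2))).
  assert (Hlo1 : rho <= lo) by apply Rmax_l.
  assert (Hlo2 : 1 - / (INR n + 2) <= lo) by apply Rmax_r.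
  assert (Hlo3 : lo < 1) by (apply Rmax_lub_lt; lra).
  destruct (Hh lo) as [r [r' [m [Hr [Hr' [Hr1 [Hm Hhm]]]]]]]; [lra|].
  destruct (nfloor_ex (8 / m)) as [N0 HN0]; [apply Rdiv_le_0_compat; lra|].
  (* Two extra walls, since the first yields only a position and [nfloor_ex] rounds down. *)
  set (N := S (S N0)).
  assert (HN : 8 <= m * (INR N - 1)).
  { unfold N. rewrite !S_INR. apply Rle_trans with (m * (8 / m)); [right; field; lra|].
    apply Rmult_le_compat_l; lra. }
  (* The annulus is cut into N walls and N + 1 empty layers. *)
  set (d := (r' - r) / (2 * INR N + 1)).
  pose proof (pos_INR N) as PN.
  assert (Hd : 0 < d) by (apply Rdiv_lt_0_compat; lra).
  assert (Hdr : r + (2 * INR N + 1) * d = r') by (unfold d; field; lra).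
  destruct (cpoly_bounded 1 f q Hf) as [M [HM HMb]].
  (* [M] compensates for the present polynomial on the walls, and 1 is the slack kept for later
     stages. *)
  destruct (labyrinth_block r d N ltac:(lra) Hd ltac:(lra) ((/ 2) ^ n) (4 / d + 1 + M))
    as [p [s [Hp [Hb Hw]]]]; [apply pow_lt; lra|].
  exists ((fun z => f z + p z)%C, (fun z w => q z w + s z w)%C, r'). split; [split|].
  - now apply cpoly_plus.
  - simpl. lra.
  - split; [simpl; lra|split]; simpl fst; simpl snd.
    + intros z w Hz Hzw. destruct (Hb z w) as [A1 A2]; [lra|lra|].
      replace (f z + p z - f z)%C with (p z) by ring.
      replace (q z w + s z w - q z w)%C with (s z w) by ring. now split.
    + exists r, d, m, N. rewrite Hdr. repeat split; auto; try lra.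
      intros j z Hj Hz. specialize (Hw j z Hj Hz).
      assert (Hz1 : Cmod z <= 1).
      { destruct Hz as [[_ Hz] _].
        assert (INR j + 1 <= INR N) by (rewrite <- S_INR; now apply le_INR). nra. }
      destruct (HMb z z Hz1 Hz1) as [A _]. pose proof (re_le_Cmod (f z)) as B.
      unfold Re in B. apply Rabs_le_between in B. simpl. lra.
Qed.

Lemma dependent_choice {A : Type} (P : A -> Prop) (Rel : nat -> A -> A -> Prop) (x0 : A) :
  P x0 -> (forall n x, P x -> exists y, P y /\ Rel n x y) ->
  exists u : nat -> A, u O = x0 /\ forall n, P (u n) /\ Rel n (u n) (u (S n)).
Proof.
  intros H0 Hs.
  assert (Hs' : forall nx : nat * A, exists y, P (snd nx) -> P y /\ Rel (fst nx) (snd nx) y).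
  { intros [n x]. destruct (classic (P x)) as [Hx|Hx].
    - destruct (Hs n x Hx) as [y Hy]. now exists y.
    - exists x. simpl. tauto. }
  set (next := fun nx => proj1_sig (constructive_indefinite_description _ (Hs' nx))).
  assert (Hnext : forall n x, P x -> P (next (n, x)) /\ Rel n x (next (n, x))).
  { intros n x. exact (proj2_sig (constructive_indefinite_description _ (Hs' (n, x)))). }
  set (u := fix u n := match n with O => x0 | S n => next (n, u n) end).
  assert (Pu : forall n, P (u n)).
  { induction n as [|n IH]; [exact H0|]. now apply Hnext. }
  exists u. split; [reflexivity|]. intros n. split; [apply Pu|]. now apply Hnext.
Qed.

Lemma exists_labyrinth h : has_good_annuli h ->
  exists F F', holo (dom DiskD) F F' /\
    forall lo, lo < 1 -> exists hi, hi < 1 /\ labyrinth h F lo hi 0.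
Proof.
  intros Hh.
  destruct (dependent_choice stage_ok (stage_step h) ((fun _ => RtoC 0), (fun _ _ => RtoC 0), / 4))
    as [u [_ Hu]].
  { split; [exact (cpoly_const 0%C)|simpl; lra]. }
  { intros n x Hx. now apply stage_step_ex. }
  assert (Hnear : forall c, c < 1 -> exists n, c < 1 - / (INR n + 2)).
  { intros c Hc. destruct (nfloor_ex (/ (1 - c))) as [n Hn].
    { left. apply Rinv_0_lt_compat. lra. }
    exists n. assert (/ (INR n + 2) < 1 - c); [|lra].
    rewrite <- (Rinv_inv (1 - c)). apply Rinv_lt_contravar; [|lra].
    apply Rmult_lt_0_compat; [apply Rinv_0_lt_compat; lra|]. pose proof (pos_INR n). lra. }
  destruct (cpoly_sequence_limit (fun n => fst (fst (u n))) (fun n => snd (fst (u n)))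
    (fun n => snd (u n))) as [F [F' [HF Happ]]].
  - intros n. apply (Hu n).
  - intros n. apply (Hu n).
  - intros c Hc. destruct (Hnear c Hc) as [n Hn]. exists (S n).
    destruct (Hu n) as [_ [_ [_ [r [d [m [N [H1 [H2 [_ [H3 _]]]]]]]]]]].
    pose proof (pos_INR N). nra.
  - intros n. apply (Hu n).
  - exists F, F'. split; auto. intros lo Hlo. destruct (Hnear lo Hlo) as [n Hn].
    exists (snd (u (S n))). destruct (Hu (S n)) as [[_ Hrho] _]. split; [lra|].
    destruct (Hu n) as [_ [_ [_ [r [d [m [N [H1 [H2 [H3 [H4 [H5 [H6 H7]]]]]]]]]]]]].
    exists r, d, m, N. repeat split; auto; [lra|].
    (* The walls lie in the disk of stage n + 1, where [F] differs from the polynomial of that stage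
       by at most 2 (1/2)^(n+1) <= 1; this uses up the slack. *)
    intros j z Hj Hz. specialize (H7 j z Hj Hz).
    assert (Hzr : Cmod z <= snd (u (S n))).
    { destruct Hz as [[_ Hz] _].
      assert (INR j + 1 <= INR N) by (rewrite <- S_INR; now apply le_INR). nra. }
    pose proof (Happ (S n) z Hzr ltac:(lra)) as A.
    pose proof (re_le_Cmod (F z - fst (fst (u (S n))) z)) as B.
    assert (Hp : 2 * (/ 2) ^ S n <= 1).
    { simpl. assert ((/ 2) ^ n <= 1); [|lra]. rewrite <- (pow1 n). apply pow_incr. lra. }
    unfold Re in B. simpl in B. apply Rabs_le_between in B. cbv beta in A. lra.
Qed.

Lemma Cmod_lt_1_dom (z : C) : dom DiskD (fst z) (snd z) -> Cmod z < 1.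
Proof. intros H. pose proof (Cmod_sqr z). pose proof (Cmod_ge_0 z). simpl in *. nra. Qed.

Section Disk_completeness.
Variables (Y1 Y2 Y3 : R -> R -> R) (F h : C -> C) (g : R -> R * R).
Hypothesis Y_cmi : conformal_minimal_immersion (dom DiskD) Y1 Y2 Y3.
Hypothesis Y_metric : forall x y, dom DiskD x y ->
  let s := dx Y1 x y ^ 2 + dx Y2 x y ^ 2 + dx Y3 x y ^ 2 in
  (Cmod (cexp (F (x, y))) / 2) ^ 2 <= s /\ Cmod (h (x, y)) ^ 2 <= s.
Hypothesis g_div : divergent_curve (dom DiskD) g.

Let c := curve Y1 Y2 Y3 g.

Lemma gain_of_metric a b mu : 0 < mu -> 0 <= a -> a <= b -> b < 1 ->
  (forall t, a <= t <= b -> mu <= Cmod (cexp (F (g t))) / 2 \/ mu <= Cmod (h (g t))) ->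
  gain c a b (mu / 2 * Cmod (g b - g a)).
Proof.
  intros Hmu Ha Hab Hb Hm. apply (gain_of_conformal DiskD); auto.
  intros t Ht. destruct (proj1 g_div t ltac:(lra)) as [G1 G2].
  split; [exact G1|split; [exact G2|]].
  destruct (Y_metric _ _ G2) as [M1 M2]. rewrite <- (Ceta (g t)) in M1, M2.
  destruct (Hm t Ht) as [H|H].
  - eapply Rle_trans; [|exact M1]. apply pow_incr. lra.
  - eapply Rle_trans; [|exact M2]. apply pow_incr. lra.
Qed.

Lemma labyrinth_gain lo hi a0 : labyrinth h F lo hi 0 -> hi < 1 -> 0 <= a0 < 1 ->
  Cmod (g a0) <= lo -> exists b, a0 <= b < 1 /\ gain c a0 b 1.
Proof.
  intros [r [d [m [N [Hr [Hd [Hm [Hhi [Hh [HN Hw]]]]]]]]]] Hhi1 Ha0 Hlo.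
  pose proof (pos_INR N) as PN.
  destruct (divergent_leaves_disk _ g hi g_div) with (a := a0) as [b0 [Hb0 Hfar]]; auto.
  { intros x y Hxy. apply (dom_disk_Cmod (x, y)). lra. }
  set (f := fun t => Cmod (g t)).
  assert (Hf : forall t, 0 <= t < 1 -> continuous f t).
  { intros t Ht. apply ccont_Cmod. now apply g_div. }
  (* From here on the curve is confined to the annulus where |h| >= m. *)
  destruct (crossing f a0 b0 r (r + 2 * INR N * d)) as [a [b [Ha [Hab [Hb [Ea [Eb Hin]]]]]]];
    try lra.
  { nra. }
  { intros t Ht. apply Hf. lra. }
  { unfold f. lra. }
  { unfold f. nra. }
  (* Either length 1 is already reached, or the curve stands in the opening of wall j - 1 after j -
     1 changes of side worth m / 8 each. The bound is negative for j = 0 and becomes 0 at the first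
     opening. *)
  assert (Claim : forall j, (j <= N)%nat -> exists t, a <= t <= b /\
    f t <= r + 2 * INR j * d /\ (gain c a t 1 \/ (gain c a t ((INR j - 1) * (m / 8)) /\
      forall i, j = S i -> / 8 < side i * fst (g t)))).
  { induction j as [|j IH]; intros Hj.
    - exists a. split; [lra|split; [simpl; lra|right; split]]; [|discriminate].
      apply gain_le with 0; [simpl; nra|apply gain_0; lra].
    - destruct IH as [t [Ht [Hft Hg]]]; [lia|].
      assert (HjN : INR j + 1 <= INR N) by (rewrite <- S_INR; now apply le_INR).
      destruct (crossing f t b (r + (2 * INR j + 1) * d) (r + (2 * INR j + 2) * d))
        as [s [u [Hs [Hsu [Hu [Es [Eu Hsr]]]]]]]; try nra.
      { intros v Hv. apply Hf. lra. }
      destruct Hg as [Hg|[Hg Hside]].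
      + exists u. split; [lra|split; [rewrite S_INR; nra|left]].
        apply gain_le with (1 + 0); [lra|]. apply gain_trans with t; auto. apply gain_0. lra.
      (* While crossing the layer of wall j, the curve either visits the opening or stays in the
         wall throughout. *)
      + destruct (classic (exists v, s <= v <= u /\ / 8 < side j * fst (g v))) as [[v [Hv Hsv]]|Hnone].
        * exists v. split; [lra|split; [rewrite S_INR; specialize (Hsr v Hv); nra|right; split]].
          2:{ intros i E. injection E as <-. exact Hsv. }
          destruct j as [|i].
          -- apply gain_le with 0; [simpl; lra|apply gain_0; lra].
          -- specialize (Hside i eq_refl).
             assert (Hstep : gain c t v (m / 2 * Cmod (g v - g t))).
             { apply gain_of_metric; auto; try lra.
               intros w Hw'. right. apply Hh. specialize (Hin w ltac:(lra)). unfold f in Hin. nra. }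
             apply gain_le with ((INR (S i) - 1) * (m / 8) + m / 2 * Cmod (g v - g t));
               [|now apply gain_trans with t].
             (* Consecutive openings lie beyond Re z = 1/8 and Re z = -1/8. With the factor m / 2
                this gives m / 8. *)
             assert (Hdist : / 4 <= Cmod (g v - g t)).
             { eapply Rle_trans; [|apply re_le_Cmod]. simpl.
               change (side (S i)) with (-1 * side i) in Hsv.
               destruct (side_cases i) as [E|E]; rewrite E in Hsv, Hside.
               - rewrite <- Rabs_Ropp. eapply Rle_trans; [|apply Rle_abs]. lra.
               - eapply Rle_trans; [|apply Rle_abs]. lra. }
             rewrite (S_INR (S i)). nra.
        * exists u. split; [lra|split; [rewrite S_INR; nra|left]].
          (* On the wall |exp F| / 2 >= (1 + 4 / d) / 2 > 2 / d. Half of 2 / d times the thickness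
             [d] is length 1. *)
          assert (Hstep : gain c s u (2 / d / 2 * Cmod (g u - g s))).
          { apply gain_of_metric; try lra; [apply Rdiv_lt_0_compat; lra|].
            intros v Hv. left.
            assert (Hwall : in_wall r d j (g v)).
            { split; [exact (Hsr v Hv)|]. apply Rnot_lt_le. intros H. apply Hnone. now exists v. }
            specialize (Hw j (g v) ltac:(lia) Hwall). rewrite Cmod_cexp.
            pose proof (exp_ineq1_le (fst (F (g v)))).
            replace (2 / d) with (4 / d / 2) by (field; lra). lra. }
          apply gain_le with (0 + 2 / d / 2 * Cmod (g u - g s)).
          -- assert (Hdist : d <= Cmod (g u - g s)).
             { pose proof (Cmod_triangle_inv (g u) (g s)). unfold f in Es, Eu. lra. }
             replace 1 with (2 / d / 2 * d) by (field; lra). rewrite Rplus_0_l.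
             apply Rmult_le_compat_l; auto. left. repeat apply Rdiv_lt_0_compat; lra.
          -- apply gain_trans with s; auto. apply gain_0. lra. }
  destruct (Claim N (le_n N)) as [t [Ht [_ Hg]]].
  exists t. split; [lra|]. apply gain_le with (0 + 1); [lra|].
  apply gain_trans with a; [apply gain_0; lra|].
  destruct Hg as [Hg|[Hg _]]; auto. apply gain_le with ((INR N - 1) * (m / 8)); auto. lra.
Qed.

(** After each gain of 1 a new labyrinth is taken beyond the current radius |g b|, so the gains
    concatenate without limit. *)
Lemma labyrinth_infinite_length :
  (forall lo, lo < 1 -> exists hi, hi < 1 /\ labyrinth h F lo hi 0) -> infinite_length c.
Proof.
  intros HL. apply gain_infinite_length. intros M.
  assert (Hk : forall k : nat, exists b, 0 <= b < 1 /\ gain c 0 b (INR k)).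
  { induction k as [|k [b [Hb Hg]]].
    - exists 0. split; [lra|]. apply gain_0. lra.
    - destruct (HL (Cmod (g b))) as [hi [Hhi Hlab]].
      { apply Cmod_lt_1_dom. now apply g_div. }
      destruct (labyrinth_gain _ _ b Hlab Hhi Hb (Rle_refl _)) as [b' [Hb' Hg']].
      exists b'. split; [lra|]. rewrite S_INR. now apply gain_trans with b. }
  destruct (nfloor_ex (Rabs M)) as [k Hkf]; [apply Rabs_pos|].
  destruct (Hk (S k)) as [b [Hb Hg]]. exists 0, b. split; [lra|split; [lra|]].
  apply gain_le with (INR (S k)); auto. rewrite S_INR. pose proof (Rle_abs M). lra.
Qed.

End Disk_completeness.

(** The gradient vanishes, so [u] is constant along the axis-parallel path from the origin. *)
Lemma wirtinger_zero_constant u : harmonic (dom DiskD) u ->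
  (forall z, Cmod z < 1 -> wirtinger u z = 0%C) ->
  forall x y, dom DiskD x y -> u x y = u 0 0.
Proof.
  intros [[H1 _] _] H0 x y D.
  assert (Z : forall a b, dom DiskD a b -> dx u a b = 0 /\ dy u a b = 0).
  { intros a b Dab. specialize (H0 (a, b) (Cmod_lt_1_dom (a, b) Dab)).
    unfold wirtinger in H0. simpl in H0. injection H0 as E1 E2. split; [exact E1|].
    apply Ropp_eq_compat in E2. rewrite Ropp_involutive, Ropp_0 in E2. exact E2. }
  assert (Seg : forall (f : R -> R) a, (forall t, Rmin 0 a <= t <= Rmax 0 a -> is_derive f t 0) ->
    f a = f 0).
  { intros f a Hf. destruct (MVT_gen f 0 a (fun _ => 0)) as [c [_ Hc]]; [| |lra].
    - intros t Ht. apply Hf. lra.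
    - intros t Ht. apply continuity_pt_filterlim.
      apply (ex_derive_continuous (V := R_NormedModule)). eexists. now apply Hf. }
  assert (D0 : dom DiskD x 0).
  { apply dom_shrink with x y; auto; [lra|]. rewrite Rabs_R0. apply Rabs_pos. }
  transitivity (u x 0).
  - apply (Seg (fun t => u x t)). intros t Ht.
    assert (Dt : dom DiskD x t) by (apply dom_shrink with x y; auto using between_Rabs; lra).
    assert (E : is_derive (fun t => u x t) t (dy u x t))
      by exact (Derive_correct _ _ (proj1 (proj2 (proj2 (H1 x t Dt))))).
    rewrite (proj2 (Z x t Dt)) in E. exact E.
  - apply (Seg (fun t => u t 0)). intros t Ht.
    assert (Dt : dom DiskD t 0) by (apply dom_shrink with x 0; auto using between_Rabs; lra).
    assert (E : is_derive (fun t => u t 0) t (dx u t 0))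
      by exact (Derive_correct _ _ (proj1 (proj2 (H1 t 0 Dt)))).
    rewrite (proj1 (Z t 0 Dt)) in E. exact E.
Qed.

Theorem theorem4p1 (S : surface) (u : R -> R -> R) :
  harmonic (dom S) u ->
  (S = DiskD ->
     exists x1 y1 x2 y2, dom S x1 y1 /\ dom S x2 y2 /\ u x1 y1 <> u x2 y2) ->
  exists Y1 Y2 : R -> R -> R,
    conformal_minimal_immersion (dom S) Y1 Y2 u /\
    complete_immersion (dom S) Y1 Y2 u.
Proof.
  intros Hu Hnc. destruct S.
  (* F = 0 gives the uniform bound |exp F| / 2 = 1/2, and a divergent curve leaves every disk. *)
  - destruct (weierstrass PlaneC u _ _ Hu (holo_const _ 0%C)) as [Y1 [Y2 [HY Hm]]].
    exists Y1, Y2. split; auto. apply plane_complete with (/ 2); auto; [lra|].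
    intros x y. destruct (Hm x y I) as [H _]. rewrite cexp_0, Cmod_1 in H.
    replace (/ 2) with (1 / 2) by field. exact H.
  - destruct (harmonic_holo DiskD u Hu) as [h' Hh].
    (* Here non-constancy enters: it provides a point where u_x - i u_y does not vanish, without
       which no good annuli exist. *)
    assert (Hz : exists z, Cmod z < 1 /\ wirtinger u z <> 0%C).
    { apply NNPP. intros Hn.
      assert (H0 : forall z, Cmod z < 1 -> wirtinger u z = 0%C).
      { intros z Hz. apply NNPP. intros H. apply Hn. now exists z. }
      destruct (Hnc eq_refl) as [x1 [y1 [x2 [y2 [D1 [D2 Hne]]]]]]. apply Hne.
      rewrite (wirtinger_zero_constant u Hu H0 x1 y1 D1).
      now rewrite (wirtinger_zero_constant u Hu H0 x2 y2 D2). }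
    destruct Hz as [z0 [Hz0 Hne]].
    destruct (exists_labyrinth _ (good_annuli _ _ z0 Hh Hz0 Hne)) as [F [F' [HF HL]]].
    destruct (weierstrass DiskD u _ _ Hu HF) as [Y1 [Y2 [HY Hm]]].
    exists Y1, Y2. split; auto. intros g Hg.
    now apply (labyrinth_infinite_length Y1 Y2 u F (wirtinger u) g HY Hm Hg).
Qed.
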